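(* Let $f:S_f\to S_f$ and $g:S_g\to S_g$ be generalized pseudo-Anosov homeomorphisms that are topologically conjugate via a homeomorphism $h:S_f\to S_g$, i.e. $g=h\circ f\circ h^{-1}$. Let $z\in S_f$ be a first intersection point of $f$. Then: (i) $h(z)$ is a first intersection point of $g$. (ii) The compatibility coefficients coincide: $n(z)=n(h(z))$. (iii) For every $n\ge n(z)=n(h(z))$, the image under $h$ of the primitive Markov partition of $f$ generated by $z$ and of order $n$ is the primitive Markov partition of $g$ generated by $h(z)$ and of order $n$, i.e. $h(\mathcal{R}(z,n))=\mathcal{R}(h(z),n)$.
   Context: **Pseudo-Anosov maps.** A surface $S$ is a smooth closed orientable 2-manifold. A generalized pseudo-Anosov homeomorphism $f:S\to S$ is an orientation-preserving homeomorphism for which there are $\lambda>1$ and two $f$-invariant transverse measured foliations $(\mathcal{F}^s,\mu^s)$ (stable) and $(\mathcal{F}^u,\mu^u)$ (unstable), with singularities, possibly including 1-prong singularities (spines), with $f_*\mu^s=\lambda\mu^s$, $f_*\mu^u=\lambda^{-1}\mu^u$; the convention is that $f$ stretches unstable arcs (measured by $\mu^s$) by $\lambda$ and contracts stable arcs (measured by $\mu^u$) by $\lambda^{-1}$. $\mathbf{Sing}(f)$ is the set of singularities of the foliations; if the invariant foliations have no singularities, the set of singular points is assumed to coincide with a finite family of periodic points of $f$. $\mathcal{F}^{s}(p),\mathcal{F}^u(p)$ (also $F^s_p$, $F^u_p$) are the leaves through $p$ (for a singularity, including all its prongs); $\mathcal{F}^{s}(\mathbf{Sing}(f))$ and $\mathcal{F}^{u}(\mathbf{Sing}(f))$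 are the unions of these over $p\in\mathbf{Sing}(f)$. A stable (unstable) separatrix $F^s(p)$ ($F^u(p)$) of $p\in\mathbf{Sing}(f)$ is a connected component of $\mathcal{F}^s(p)\setminus\{p\}$ ($\mathcal{F}^u(p)\setminus\{p\}$); for $x$ on it, $[p,x]^s$ ($[p,x]^u$) is the arc from $p$ to $x$ in the leaf. A stable (unstable) interval or segment is an arc in a stable (unstable) leaf. **First intersection points.** A point $x\notin\mathbf{Sing}(f)$ is a first intersection point of $f$ if there are $p,q\in\mathbf{Sing}(f)$, a stable separatrix $F^s(p)$ and an unstable separatrix $F^u(q)$ with $x\in F^s(p)\cap F^u(q)$ and $(p,x]^s\cap(q,x]^u=\{x\}$. **Rectangles.** For an open connected nonempty $r\subset S$ and $x\in r$, let $I_x$ (resp. $J_x$) be the closure of the connected component of $F^s_x\cap r$ (resp. $F^u_x\cap r$) containing $x$. The set $r$ is trivially bi-foliated if for all $x,y\in r$, $I_x$ and $J_y$ are homeomorphic to closed intervals and $I_x\cap J_y$ is a single point, lying in $r$. A rectangle $R$ is the closure of a trivially bi-foliated set. A parametrization of $R$ is a continuous map $\rho:[0,1]^2\to S$ with image $R$, restricting to an orientation-preserving homeomorphism from $(0,1)^2$ onto the interior $\overset{o}{R}:=\rho((0,1)^2)$, mapping each horizontal (vertical) segment homeomorphically onto an arc of a single stable (unstable) leaf, called a horizontal (vertical) leaf of $R$. $\partial^sR=\rho([0,1]\times\{0,1\})$, $\partial^uR=\rho(\{0,1\}\times[0,1])$, $\partial R=\partial^sR\cup\partial^uR$; the two arcs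 of $\partial^uR$ are the $u$-boundary components; the corners are the images of the vertices of $[0,1]^2$. $R$ is embedded if $\rho$ is a homeomorphism onto its image. A rectangle $H\subset R$ is a horizontal (vertical) subrectangle if for every $x\in\overset{o}{H}$ the component of $\overset{o}{H}\cap F^s_x$ ($\overset{o}{H}\cap F^u_x$) containing $x$ equals that of $\overset{o}{R}\cap F^s_x$ ($\overset{o}{R}\cap F^u_x$). **Markov partitions.** A Markov partition for $f$ is a finite family of rectangles $\mathcal{R}=\{R_i\}$ with $S=\bigcup R_i$, pairwise disjoint interiors $\overset{o}{R_i}$, and such that for all $i,j$ the closure of each nonempty component of $\overset{o}{R_i}\cap f^{-1}(\overset{o}{R_j})$ is a horizontal subrectangle of $R_i$ and the closure of each nonempty component of $f(\overset{o}{R_i})\cap\overset{o}{R_j}$ is a vertical subrectangle of $R_j$. Its stable (unstable) boundary is $\bigcup_i\partial^sR_i$ ($\bigcup_i\partial^uR_i$). It is adapted to $f$ if the set of periodic points of $f$ in $\bigcup_i\partial R_i$ equals $\mathbf{Sing}(f)$ and each such point is a corner of every rectangle of the family containing it. **Adapted graphs.** An $s$-graph adapted to $f$ is a finite family $\delta^s=\{I_i\}$ of nondegenerate compact stable intervals such that, with $\cup\delta^s:=\bigcup_iI_i$: $f(\cup\delta^s)\subset\cup\delta^s$; each $I_i$ lies in $\mathcal{F}^s(p)$ for some $p\in\mathbf{Sing}(f)$; for every $p\in\mathbf{Sing}(f)$ and every stable separatrix of $p$ some $I_i$ lies in that separatrix (together with $p$) and has $p$ as an endpoint; endpoints of each $I_i$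 lie in $\mathcal{F}^u(\mathbf{Sing}(f))$. A $u$-graph adapted to $f$ is defined exchanging $s,u$ and $f,f^{-1}$. **Rails and compatibility.** The regular part $\overset{o}{\delta^s}$ is $\cup\delta^s$ minus all endpoints of its intervals. A regular $u$-rail of $\delta^s$ is an unstable interval with interior disjoint from $\cup\delta^s$ and endpoints in $\overset{o}{\delta^s}$. An extreme $u$-rail of $\delta^s$ is an unstable segment $J$ with at least one endpoint not in $\overset{o}{\delta^s}$ for which there is an embedded rectangle $R$ with $\partial^sR\subset\cup\delta^s$, $J$ a $u$-boundary component of $R$, and every other vertical leaf of $R$ a regular $u$-rail. $s$-rails of $\delta^u$ are defined by exchanging $s$ and $u$. $\delta^s$ and $\delta^u$ are compatible if endpoints of intervals of $\delta^s$ lie in $\cup\delta^u$, endpoints of intervals of $\delta^u$ lie in $\cup\delta^s$, extreme $u$-rails of $\delta^s$ are contained in $\cup\delta^u$, and extreme $s$-rails of $\delta^u$ are contained in $\cup\delta^s$. **Construction of $\mathcal{R}(z,n)$.** Let $z\in F^s(p)\cap F^u(q)$ be a first intersection point. Put $J^u(z)=[q,z]^u$ and $\mathcal{J}^u(z)=\bigcup_{i\in\mathbb{N}}f^{-i}(J^u(z))$ (including $i=0$), a finite union of compact arcs, $f^{-1}$-invariant. Let $\delta^s(z)$ be the family of all stable segments with one endpoint in $\mathbf{Sing}(f)$, the other in $\mathcal{J}^u(z)$, and interior disjoint from $\mathcal{J}^u(z)$; it is an $s$-graph adapted to $f$. Let $\delta^u(z)$ be the family of all unstable segments with one endpoint in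 $\mathbf{Sing}(f)$, the other in $\cup\delta^s(z)$, and interior disjoint from $\cup\delta^s(z)$; it is a $u$-graph adapted to $f$. The compatibility coefficient $n(z)$ is the least natural number such that $\delta^s(z)$ and $f^n(\delta^u(z))$ are compatible for all $n\ge n(z)$. For $n\ge n(z)$, $\mathcal{R}(z,n)$, the primitive Markov partition of $f$ generated by $z$ of order $n$, is the adapted Markov partition for $f$ with stable boundary equal to $\cup\delta^s(z)$ and unstable boundary equal to $\bigcup f^n(\delta^u(z))$; its rectangles are the closures of the connected components of the complement in $S$ of these two sets. For $g$ the same objects are defined with $g$ in place of $f$. $h(\mathcal{R}(z,n))$ denotes $\{h(R):R\in\mathcal{R}(z,n)\}$.
   Formalization: When the invariant foliations of f have no singularities, so that Sing(f) and Sing(g) are chosen finite families of periodic points, it is additionally assumed that Sing(g) = h(Sing(f)); for unrelated choices the claim is false. *)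

(* Defs.v *)
From HB Require Import structures.
From mathcomp Require Import all_boot all_order all_algebra.
From mathcomp Require Import all_classical all_reals all_analysis.

Set Implicit Arguments.
Unset Strict Implicit.
Unset Printing Implicit Defensive.

Import Order.TTheory GRing.Theory Num.Theory numFieldNormedType.Exports.

Local Open Scope classical_set_scope.
Local Open Scope ring_scope.

Definition homeomorphism (X Y : topologicalType) (f : X -> Y) (finv : Y -> X) :=
  [/\ continuous f, continuous finv, cancel f finv & cancel finv f].

(* f restricts to a homeomorphism from A onto f(A). *)
Definition embeds (X Y : topologicalType) (A : set X) (f : X -> Y) :=
  {within A, continuous f} /\
  exists g : Y -> X, (forall x, A x -> g (f x) = x) /\
                     {within f @` A, continuous g}.

Section Plane.
Variable R : realType.

Definition unit_interval : set R := [set t | 0 <= t <= 1].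
Definition open_unit_interval : set R := [set t | 0 < t < 1].
Definition unit_square : set (R * R) := unit_interval `*` unit_interval.
Definition open_unit_square : set (R * R) :=
  open_unit_interval `*` open_unit_interval.

(* F is C^k on the open set O: its iterated directional derivatives up to
   order k exist and are continuous on O. *)
Fixpoint Ck (k : nat) (O : set (R * R)) (F : R * R -> R * R) : Prop :=
  {within O, continuous F} /\
  (if k is k'.+1 then
     forall v : R * R, (forall x, O x -> derivable F x v) /\
                       Ck k' O (fun x => 'D_v F x)
   else True).

(* F has local degree +1 at x: small circles around x are mapped to curves
   winding exactly once counterclockwise around F x; theta is a continuous
   determination of the angle along the image curve.  For an F which is a
   homeomorphism near x, this is the topological meaning of "F preserves the
   orientation at x". *)
Definition preserves_orientation_at (F : R * R -> R * R) (x : R * R) :=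
  exists2 r0 : R, 0 < r0 & forall r : R, 0 < r < r0 ->
    exists rho theta : R -> R,
      [/\ continuous theta,
          forall t, theta (t + 2 * pi) = theta t + 2 * pi
        & forall t, 0 < rho t /\
            F (x + r *: (cos t, sin t)) =
            F x + rho t *: (cos (theta t), sin (theta t))].

(* The plane as the complex line, (a, b) standing for a + ib. *)
Definition cmul (z w : R * R) : R * R :=
  (z.1 * w.1 - z.2 * w.2, z.1 * w.2 + z.2 * w.1).
Definition cpow (z : R * R) (k : nat) : R * R := iter k (cmul z) (1, 0).

End Plane.

Section Charts.
Variables (R : realType) (S : topologicalType).

(* cmap and cinv are total functions, meaningful only on cdom and on
   cmap @` cdom respectively. *)
Record chart := Chart {
  cdom : set S;
  cmap : S -> R * R;
  cinv : R * R -> S }.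

Definition is_chart (c : chart) :=
  [/\ open (cdom c),
      open (cmap c @` cdom c),
      forall x, cdom c x -> cinv c (cmap c x) = x,
      {within cdom c, continuous (cmap c)}
    & {within cmap c @` cdom c, continuous (cinv c)}].

End Charts.

Record surface (R : realType) := Surface {
  space :> topologicalType;
  atlas : set (chart R space);
  surface_hausdorff : hausdorff_space space;
  surface_compact : compact [set: space];
  atlas_chart : forall c, atlas c -> is_chart c;
  atlas_cover : forall x : space, exists2 c, atlas c & cdom c x;
  atlas_smooth : forall c d, atlas c -> atlas d -> forall k,
    Ck k (cmap c @` (cdom c `&` cdom d)) (cmap d \o cinv c);
  atlas_oriented : forall c d, atlas c -> atlas d ->
    forall x, cdom c x -> cdom d x ->
      preserves_orientation_at (cmap d \o cinv c) (cmap c x) }.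

Section Foliations.
Variables (R : realType) (S : surface R).

Definition orientation_preserving (f : S -> S) :=
  forall c d, @atlas R S c -> @atlas R S d ->
    forall x, cdom c x -> cdom d (f x) ->
      preserves_orientation_at (cmap d \o f \o cinv c) (cmap c x).

(* c is a chart centered at p (the only point of sing in its domain) in which
   the foliation whose local charts are fol is the standard k-prong: away
   from p, the transverse coordinate of fol is, up to sign and an additive
   constant, pr (z^(k/2)), where z is the complex coordinate given by c and
   zeta below is a continuous branch of z^(k/2).  With pr = imaginary
   (resp. real) part, the leaf of p is made of the k rays z^k >= 0
   (resp. z^k <= 0). *)
Definition prong_chart (sing : set S) (fol : set (chart R S)) (pr : R * R -> R)
    (k : nat) (p : S) (c : chart R S) :=
  [/\ is_chart c,
      cdom c `&` sing = [set p],
      cmap c p = (0, 0)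
    & forall d x, fol d -> cdom c x -> cdom d x ->
        exists (zeta : S -> R * R) (b : R),
          \forall y \near x,
            [/\ {for y, continuous zeta},
                cmul (zeta y) (zeta y) = cpow (cmap c y) k
              & (cmap d y).2 = pr (zeta y) + b]].

(* A transverse measured foliation with prong singularities, 1-prongs being
   allowed.  In a foliated chart (x, y) the leaves are the level sets of y
   and the transverse measure is |dy|; transitions (x, y) |-> (x', y')
   therefore satisfy y' = +/- y + b locally. *)
Record measured_foliation := MeasuredFoliation {
  fsing : set S;
  fcharts : set (chart R S);
  fsing_finite : finite_set fsing;
  fcharts_chart : forall c, fcharts c -> is_chart c;
  fcharts_cover : \bigcup_(c in fcharts) cdom c = ~` fsing;
  fcharts_transition : forall c d x, fcharts c -> fcharts d ->
    cdom c x -> cdom d x ->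
    exists (e : bool) (b : R),
      \forall y \near x, (cmap d y).2 = (-1) ^+ e * (cmap c y).2 + b;
  fsing_prong : forall p, fsing p ->
    exists (k : nat) (c : chart R S),
      [/\ (1 <= k)%N, k <> 2%N & prong_chart fsing fcharts snd k p c] }.

(* Off the singularities the two transverse coordinates together are local
   coordinates; at a singularity the two foliations are the imaginary and
   real foliations of one and the same prong chart. *)
Definition transverse (Fs Fu : measured_foliation) :=
  [/\ fsing Fs = fsing Fu,
      forall c d x, fcharts Fs c -> fcharts Fu d -> cdom c x -> cdom d x ->
        exists e : chart R S,
          [/\ is_chart e, cdom e x, cdom e `<=` cdom c `&` cdom d
            & forall y, cdom e y -> cmap e y = ((cmap d y).2, (cmap c y).2)]
    & forall p, fsing Fs p ->
        exists (k : nat) (c : chart R S),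
          [/\ (1 <= k)%N, k <> 2%N,
              prong_chart (fsing Fs) (fcharts Fs) snd k p c
            & prong_chart (fsing Fs) (fcharts Fu) fst k p c]].

(* f preserves F and multiplies the transverse measure |dy| of arcs by a. *)
Definition scales (f : S -> S) (F : measured_foliation) (a : R) :=
  f @` fsing F = fsing F /\
  forall c d x, fcharts F c -> fcharts F d -> cdom c x -> cdom d (f x) ->
    exists (e : bool) (b : R),
      \forall y \near x,
        (cmap d (f y)).2 = (-1) ^+ e * (a * (cmap c y).2) + b.

Definition periodic (f : S -> S) (x : S) :=
  exists2 n : nat, (0 < n)%N & iter n f x = x.

(* marked is Sing(f): the singularities of the foliations or, when there are
   none, a chosen finite family of periodic points. *)
Record pseudo_anosov := PseudoAnosov {
  pmap :> S -> S;
  stable : measured_foliation;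
  unstable : measured_foliation;
  stretch : R;
  marked : set S;
  pmap_homeomorphism : exists pinv, homeomorphism pmap pinv;
  pmap_orientation : orientation_preserving pmap;
  foliations_transverse : transverse stable unstable;
  stretch_gt1 : 1 < stretch;
  stable_scaled : scales pmap stable stretch;
  unstable_scaled : scales pmap unstable stretch^-1;
  marked_singular : fsing stable !=set0 -> marked = fsing stable;
  marked_regular : fsing stable = set0 ->
    finite_set marked /\ marked `<=` periodic pmap }.

(* A path inside a leaf of F.  Nothing has to be required at the times where
   gamma is at a singularity: by continuity, a path tangent to F at its
   regular times reaches a singularity, or leaves it, along a prong. *)
Definition leaf_path (F : measured_foliation) (gamma : R -> S) :=
  {within @unit_interval R, continuous gamma} /\
  forall t c, unit_interval t -> fcharts F c -> cdom c (gamma t) ->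
    \forall s \near t, unit_interval s ->
      (cmap c (gamma s)).2 = (cmap c (gamma t)).2.

(* The connected component containing x of (leaf of x) `&` A, for the
   topology of the leaf: leaves are dense, so that the topology induced by S
   on a leaf would not be the right one. *)
Definition leaf_component (F : measured_foliation) (A : set S) (x : S) : set S :=
  [set y | exists gamma, [/\ leaf_path F gamma, gamma 0 = x, gamma 1 = y
                           & gamma @` @unit_interval R `<=` A]].

Definition leaf (F : measured_foliation) (x : S) : set S :=
  leaf_component F setT x.

Definition leaf_arc_param (F : measured_foliation) (gamma : R -> S) :=
  leaf_path F gamma /\ set_inj (@unit_interval R) gamma.

(* I is a nondegenerate compact arc with endpoints a and b in a leaf of F. *)
Definition leaf_arc (F : measured_foliation) (I : set S) (a b : S) :=
  exists gamma, [/\ leaf_arc_param F gamma, gamma 0 = a, gamma 1 = b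
                  & I = gamma @` @unit_interval R].

Definition separatrix (F : measured_foliation) (p : S) (A : set S) :=
  exists x, [/\ leaf F p x, x <> p & A = leaf_component F (~` [set p]) x].

Definition support (delta : set (set S)) : set S := \bigcup_(I in delta) I.

Definition is_endpoint (F : measured_foliation) (I : set S) (a : S) :=
  exists b, leaf_arc F I a b.

Definition regular_part (F : measured_foliation) (delta : set (set S)) : set S :=
  support delta `\` \bigcup_(I in delta) is_endpoint F I.

End Foliations.

Section Rectangles.
Variables (R : realType) (S : surface R) (f : pseudo_anosov S).
Local Notation Fs := (stable f).
Local Notation Fu := (unstable f).

Definition closed_interval_like (A : set S) :=
  exists gamma : R -> S,
    [/\ {within @unit_interval R, continuous gamma},
        set_inj (@unit_interval R) gamma
      & A = gamma @` @unit_interval R].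

Definition trivially_bifoliated (r : set S) :=
  [/\ open r, connected r, r !=set0
    & forall x y, r x -> r y ->
        let Ix := closure (leaf_component Fs r x) in
        let Jy := closure (leaf_component Fu r y) in
        [/\ closed_interval_like Ix, closed_interval_like Jy
          & exists2 w, r w & Ix `&` Jy = [set w]]].

Definition rectangle (A : set S) :=
  exists2 r, trivially_bifoliated r & A = closure r.

Definition hleaf (rho : R * R -> S) (c : R) : set S :=
  (fun t => rho (t, c)) @` @unit_interval R.
Definition vleaf (rho : R * R -> S) (c : R) : set S :=
  (fun t => rho (c, t)) @` @unit_interval R.

Definition rect_interior (rho : R * R -> S) : set S :=
  rho @` @open_unit_square R.

Definition parametrizes (rho : R * R -> S) (A : set S) :=
  [/\ {within @unit_square R, continuous rho} /\ A = rho @` @unit_square R,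
      embeds (@open_unit_square R) rho,
      forall u c, open_unit_square u -> atlas c -> cdom c (rho u) ->
        preserves_orientation_at (cmap c \o rho) u,
      forall c, unit_interval c -> leaf_arc_param Fs (fun t => rho (t, c))
    & forall c, unit_interval c -> leaf_arc_param Fu (fun t => rho (c, t))].

Definition sboundary (rho : R * R -> S) : set S := hleaf rho 0 `|` hleaf rho 1.
Definition uboundary (rho : R * R -> S) : set S := vleaf rho 0 `|` vleaf rho 1.
Definition corners (rho : R * R -> S) : set S :=
  [set rho (0, 0); rho (0, 1)] `|` [set rho (1, 0); rho (1, 1)].

Definition subrectangle (F : measured_foliation S) (H A intA : set S) :=
  [/\ rectangle H, H `<=` A
    & exists2 sigma, parametrizes sigma H &
        forall x, rect_interior sigma x ->
          leaf_component F (rect_interior sigma) x = leaf_component F intA x].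

(* rho A is a parametrization of the rectangle A, for A in the family RR. *)
Definition markov_partition (RR : set (set S)) (rho : set S -> R * R -> S) :=
  [/\ finite_set RR,
      forall A, RR A -> rectangle A /\ parametrizes (rho A) A,
      \bigcup_(A in RR) A = setT,
      forall A B, RR A -> RR B -> A <> B ->
        rect_interior (rho A) `&` rect_interior (rho B) = set0
    & forall A B, RR A -> RR B ->
        let intA := rect_interior (rho A) in
        let intB := rect_interior (rho B) in
        (forall x, (intA `&` f @^-1` intB) x ->
           subrectangle Fs
             (closure (connected_component (intA `&` f @^-1` intB) x)) A intA) /\
        (forall x, (f @` intA `&` intB) x ->
           subrectangle Fu
             (closure (connected_component (f @` intA `&` intB) x)) B intB)].

Definition partition_sboundary (RR : set (set S)) (rho : set S -> R * R -> S) :=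
  \bigcup_(A in RR) sboundary (rho A).
Definition partition_uboundary (RR : set (set S)) (rho : set S -> R * R -> S) :=
  \bigcup_(A in RR) uboundary (rho A).

Definition adapted (RR : set (set S)) (rho : set S -> R * R -> S) :=
  (partition_sboundary RR rho `|` partition_uboundary RR rho) `&` periodic f
    = marked f /\
  forall p A, marked f p -> RR A -> A p -> corners (rho A) p.

(* A rail of delta is an arc of a leaf of F; G is the other foliation, whose
   leaves contain the intervals of delta.  Taking F = Fu, G = Fs,
   along = vleaf, across = hleaf gives the u-rails of an s-graph; taking
   F = Fs, G = Fu, along = hleaf, across = vleaf gives the s-rails of a
   u-graph. *)
Definition regular_rail (F G : measured_foliation S) (delta : set (set S))
    (J : set S) :=
  exists a b, [/\ leaf_arc F J a b,
                  (J `\` [set a; b]) `&` support delta = set0,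
                  regular_part G delta a & regular_part G delta b].

Definition extreme_rail (F G : measured_foliation S)
    (along across : (R * R -> S) -> R -> set S) (delta : set (set S))
    (J : set S) :=
  exists a b, [/\ leaf_arc F J a b,
    ~ (regular_part G delta a /\ regular_part G delta b)
  & exists (A : set S) (rho : R * R -> S) (c0 : R),
      [/\ rectangle A /\ parametrizes rho A,
          embeds (@unit_square R) rho,
          across rho 0 `|` across rho 1 `<=` support delta,
          (c0 = 0 \/ c0 = 1) /\ J = along rho c0
        & forall c, unit_interval c -> c <> c0 ->
            regular_rail F G delta (along rho c)]].

Definition compatible (deltas deltau : set (set S)) :=
  [/\ forall I a, deltas I -> is_endpoint Fs I a -> support deltau a,
      forall J a, deltau J -> is_endpoint Fu J a -> support deltas a,
      forall J, extreme_rail Fu Fs vleaf hleaf deltas J -> J `<=` support deltau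
    & forall I, extreme_rail Fs Fu hleaf vleaf deltau I -> I `<=` support deltas].

Definition first_intersection (x : S) :=
  ~ marked f x /\
  exists (p q : S) (A B : set S),
    [/\ marked f p /\ marked f q,
        separatrix Fs p A /\ separatrix Fu q B,
        A x /\ B x
      & exists I J, [/\ leaf_arc Fs I p x, leaf_arc Fu J q x
                      & (I `\ p) `&` (J `\ q) = [set x]]].

(* J^u(z) = [q, z]^u.  The union below has a single term: an unstable leaf
   contains at most one point of Sing(f) and no closed curve. *)
Definition Ju (z : S) : set S :=
  [set y | exists q J, [/\ marked f q, leaf_arc Fu J q z & J y]].

Definition cal_Ju (z : S) : set S := \bigcup_i (iter i f @^-1` Ju z).

Definition delta_s (z : S) : set (set S) :=
  [set I | exists p x, [/\ leaf_arc Fs I p x, marked f p, cal_Ju z x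
                         & (I `\` [set p; x]) `&` cal_Ju z = set0]].

Definition delta_u (z : S) : set (set S) :=
  [set J | exists q x, [/\ leaf_arc Fu J q x, marked f q, support (delta_s z) x
                         & (J `\` [set q; x]) `&` support (delta_s z) = set0]].

Definition image_family (n : nat) (delta : set (set S)) : set (set S) :=
  [set iter n f @` I | I in delta].

(* n = n(z).  The least such natural number is unique, so that equality of
   two compatibility coefficients is equivalence of these predicates. *)
Definition compatibility_coefficient (z : S) (n : nat) :=
  let good m := forall k, (m <= k)%N ->
    compatible (delta_s z) (image_family k (delta_u z)) in
  good n /\ forall m, good m -> (n <= m)%N.

Definition primitive_rectangles (z : S) (n : nat) : set (set S) :=
  let C := ~` (support (delta_s z) `|`
               support (image_family n (delta_u z))) in
  [set closure (connected_component C x) | x in C].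

(* RR = R(z, n). *)
Definition primitive_markov_partition (z : S) (n : nat) (RR : set (set S)) :=
  RR = primitive_rectangles z n /\
  exists rho : set S -> R * R -> S,
    [/\ markov_partition RR rho, adapted RR rho,
        partition_sboundary RR rho = support (delta_s z)
      & partition_uboundary RR rho = support (image_family n (delta_u z))].

End Rectangles.

(* Main.v *)
(* The conjugacy h is only a homeomorphism, so it has to be shown that every
   notion involved is topological.  A path gamma lies in a stable leaf if and
   only if, locally in time, f^n o gamma becomes small with respect to every open
   cover as n tends to infinity, because f^n expands the stable transverse
   measure and contracts the unstable one; the same holds for unstable leaves
   with f^-1.  Hence h maps leaves to leaves.  Singular points are those where
   the number of local stable prongs is not 2, so h preserves them as well.
   Parametrizations of rectangles must preserve the orientation: since the
   local degree of a homeomorphism of the plane is 1 or -1 and is locally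
   constant, h o rho, or h o rho composed with a reflection of the square, is
   again a parametrization.  All other notions are transported by images. *)

Require Import Defs.
From HB Require Import structures.
From mathcomp Require Import all_boot all_order all_algebra.
From mathcomp Require Import all_classical all_reals all_analysis.
From mathcomp Require Import ring lra.

Set Implicit Arguments.
Unset Strict Implicit.
Unset Printing Implicit Defensive.

Import Order.TTheory GRing.Theory Num.Theory numFieldNormedType.Exports.

Local Open Scope classical_set_scope.
Local Open Scope ring_scope.

(** The obstacle is that leaf paths may run through singularities, where no foliated chart exists,
    and that transverse coordinates are defined only up to sign and constant. Near every point both
    foliations are therefore read off from one function [Q], as the two components of its local
    square roots. A transverse coordinate is nowhere locally constant; this determines its branch
    and its constant, so that local branches chosen independently along a path fit together. A small
    transverse length does not by itself keep the iterates of a path inside one member of a cover: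
    it is turned into a bound on the variation of [Q], and compared with the variation needed to
    leave a neighbourhood. As the iterates of a point may go anywhere, compactness has to make this
    uniform. Notions are transported in one direction only, the converse being the same statement
    for the inverse conjugacy. Negative conditions, such as an interior avoiding a set, need an
    equality for that set first; this imposes the order in which the unstable arcs of [z], [delta_s]
    and [delta_u] are treated. *)

Lemma locally_constant_connected (T : topologicalType) (U : Type) (A : set T)
    (b : T -> U) :
  connected A ->
  (forall x, A x -> \forall y \near x, A y -> b y = b x) ->
  forall x y, A x -> A y -> b x = b y.
Proof.
move=> cA lc x y Ax Ay.
suff E : [set u | A u /\ b u = b x] = A.
  by move: Ay; rewrite -[X in X y -> _]E => -[].
apply: cA; first by exists x.
- exists [set u | \forall v \near u, A v -> b v = b x].
    by by rewrite openE => u /= H; exact: nbhs_interior.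
  apply/seteqP; split=> u /=.
    by move=> [Au ux]; split=> //; rewrite -ux; exact: lc.
  by move=> [Au /nbhs_singleton/(_ Au)].
- exists (~` [set u | \forall v \near u, A v -> b v <> b x]).
    rewrite closedC openE => u /= H.
    exact: nbhs_interior.
  apply/seteqP; split=> u /=.
    by move=> [Au ux]; split=> // /nbhs_singleton/(_ Au).
  move=> [Au H]; split=> //; apply: contrapT => ux; apply: H.
  by apply: filterS (lc _ Au) => v vu Av; rewrite (vu Av).
Qed.

(** Otherwise the complements of the [O m] generate a proper filter, which clusters at some [x] by
    compactness; but an [O m] containing [x] is a neighbourhood disjoint from a member of the
    filter. *)
Lemma increasing_open_cover (T : topologicalType) (O : nat -> set T) :
  compact [set: T] -> (forall m, open (O m)) ->
  (forall m n, (m <= n)%N -> O m `<=` O n) ->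
  (forall x, exists m, O m x) -> exists m, O m = setT.
Proof.
move=> cT oO incO covO; apply: contrapT => H.
have ne m : ~` O m !=set0.
  apply/set0P/eqP => E; apply: H; exists m.
  by rewrite -(setCK (O m)) E setC0.
pose F : set_system T := [set A | exists m, ~` O m `<=` A].
have FF : ProperFilter F.
  split.
    by move=> [m]; rewrite subset0 => E; have := ne m; rewrite E => -[].
  split.
  - by exists 0%N.
  - move=> A B [m mA] [n nB]; exists (maxn m n) => u Hu; split.
      by apply: mA => /= Om; apply: Hu; apply: incO Om; exact: leq_maxl.
    by apply: nB => /= Om; apply: Hu; apply: incO Om; exact: leq_maxr.
  - by move=> A B AB [m mA]; exists m; exact: subset_trans AB.
have [x [_ clx]] := cT F FF (filterT).
have [m Omx] := covO x.
have [u [/= Hu Ou]] : (~` O m) `&` O m !=set0.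
  apply: clx; first by exists m.
  exact: open_nbhs_nbhs.
exact: Hu.
Qed.

Lemma within_near (T U : topologicalType) (J : set T) (X : T -> U) s
    (P : U -> Prop) :
  {within J, continuous X} -> J s -> (\forall y \near X s, P y) ->
  \forall t \near s, J t -> P (X t).
Proof. by move=> /subspace_continuousP cX Js PX; exact: (cX _ Js). Qed.

Lemma continuous_near (T U : topologicalType) (f : T -> U) (x : T)
    (P : U -> Prop) :
  {for x, continuous f} -> (\forall y \near f x, P y) ->
  \forall y \near x, P (f y).
Proof. by move=> cf Pf; exact: (cf _ Pf). Qed.

Lemma open_near (T : topologicalType) (A : set T) x : open A -> A x -> \forall y \near x, A y.
Proof. by move=> oA Ax; exact: open_nbhs_nbhs. Qed.

Lemma open_within_continuous (X Y : topologicalType) (A : set X) (f : X -> Y) x :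
  open A -> {within A, continuous f} -> A x -> {for x, continuous f}.
Proof.
move=> oA /subspace_continuousP cf Ax; have := cf _ Ax; apply: cvg_trans.
have -> // : within A (nbhs x) = nbhs x.
by apply: within_interior; exact: open_nbhs_nbhs.
Qed.

Lemma continuous_fst (R : realType) (T : topologicalType) (z : T -> R * R) (x : T) :
  {for x, continuous z} -> {for x, continuous (fun y => (z y).1)}.
Proof. by move=> cz; apply: (cvg_comp _ _ cz); exact: cvg_fst. Qed.

Lemma continuous_snd (R : realType) (T : topologicalType) (z : T -> R * R) (x : T) :
  {for x, continuous z} -> {for x, continuous (fun y => (z y).2)}.
Proof. by move=> cz; apply: (cvg_comp _ _ cz); exact: cvg_snd. Qed.

Lemma compact_Hausdorff_regular (T : topologicalType) (x : T) (V : set T) :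
  hausdorff_space T -> compact [set: T] -> nbhs x V ->
  exists W, [/\ open W, W x & closure W `<=` V].
Proof.
move=> hT cT Vx.
have [W Wx WV] := compact_regular hT cT filterT Vx.
exists W^°; split; [exact: open_interior|exact: nbhs_singleton (nbhs_interior Wx)|].
exact: subset_trans (closureS (@interior_subset _ _)) WV.
Qed.

(** The times spent outside the open set form a compact set, whose minimum is attained: hence
    [~ V (X s)] at the exit time itself and [V] strictly before it. *)
Lemma first_exit (R : realType) (T : topologicalType) (X : R -> T) (a b : R)
    (V : set T) t1 :
  {within `[a, b], continuous X} -> open V -> a <= t1 <= b -> ~ V (X t1) ->
  exists s, [/\ a <= s <= t1, ~ V (X s) & forall t, a <= t < s -> V (X t)].
Proof.
move=> cX oV /andP[at1 t1b] nV.
pose C := `[a, b] `&` (X @^-1` (~` V)).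
have clC : closed C.
  have /closed_subspaceP[D cD E] :
      closed ((X : subspace `[a, b] -> T) @^-1` (~` V)).
    by apply: closed_comp => //; exact: open_closedC.
  rewrite /C setIC -[X in closed X]E; apply: closedI => //.
  exact: itv_closed.
have cC : compact C by apply: subclosed_compact (@segment_compact _ a b) _ => // u [].
have C0 : C !=set0 by exists t1; split=> //=; rewrite in_itv /= at1.
have cid_C : {within C, continuous (id : R -> R)}.
  by apply: continuous_subspaceT => u; exact: cvg_id.
have [s /set_mem [/= sab nVs] mins] := compact_EVT_min C0 cC cid_C.
move: sab; rewrite in_itv /= => /andP[as_ sb].
have st1 : s <= t1 by apply: mins; apply/mem_set; split=> //=; rewrite in_itv/= at1.
exists s; split=> //; first by rewrite as_.
move=> t /andP[at_ ts]; apply: contrapT => nVt.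
have : s <= t.
  by apply: mins; apply/mem_set; split=> //=; rewrite in_itv/= at_ (le_trans (ltW ts)).
by rewrite leNgt ts.
Qed.

(** * Transverse coordinates and their complex branches *)

Section PlaneAlgebra.
Variable R : realType.
Implicit Types z w : R * R.

Definition nsq z : R := z.1 ^+ 2 + z.2 ^+ 2.

(** A boolean selects the component so that exchanging the two foliations is [~~ i]; [false] is the
    second component, which prong charts assign to the stable foliation. *)
Definition proj (i : bool) z : R := if i then z.1 else z.2.

Lemma nsq_cmul z w : nsq (cmul z w) = nsq z * nsq w.
Proof. by rewrite /nsq /cmul /=; ring. Qed.

Lemma nsq_ge0 z : 0 <= nsq z.
Proof. by rewrite addr_ge0 ?sqr_ge0. Qed.

Lemma nsq_eq0 z : nsq z = 0 -> z = 0.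
Proof.
case: z => a b /eqP; rewrite /nsq /= paddr_eq0 ?sqr_ge0 // !sqrf_eq0.
by move=> /andP[/eqP -> /eqP ->].
Qed.

Lemma nsq0 : nsq 0 = 0.
Proof. by rewrite /nsq /= expr0n addr0. Qed.

Lemma cmul_sq_eq z w : cmul z z = cmul w w -> z = w \/ z = - w.
Proof.
move=> E.
have : nsq (cmul (z - w) (z + w)) = 0.
  have -> : cmul (z - w) (z + w) = cmul z z - cmul w w.
    by rewrite /cmul /=; apply: injective_projections => /=; ring.
  by rewrite E subrr nsq0.
rewrite nsq_cmul => /eqP; rewrite mulf_eq0 => /orP[] /eqP/nsq_eq0/eqP.
  by rewrite subr_eq0 => /eqP; left.
by rewrite addr_eq0 => /eqP; right.
Qed.

Lemma cmul_oppK z : cmul (- z) (- z) = cmul z z.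
Proof. by rewrite /cmul /= !mulrNN. Qed.

Lemma projN i z : proj i (- z) = - proj i z.
Proof. by case: i. Qed.

Lemma proj_sq_le i z : proj i z ^+ 2 <= nsq z.
Proof. by case: i; rewrite /nsq /= (lerDl, lerDr) sqr_ge0. Qed.

Lemma cmul_sq_neq0 z : cmul z z <> 0 -> z <> 0.
Proof. by move=> H E; apply: H; rewrite E /cmul /= mulr0 subr0 addr0. Qed.

Lemma nsq_proj i z : nsq z = proj i z ^+ 2 + proj (~~ i) z ^+ 2.
Proof. by case: i => //=; rewrite /nsq addrC. Qed.

End PlaneAlgebra.

Section Germs.
Variables (R : realType) (S : surface R).
Implicit Types (F G : measured_foliation S) (phi : S -> R) (Q zeta : S -> R * R).

Lemma chart_continuous (c : chart R S) x :
  is_chart c -> cdom c x -> {for x, continuous (cmap c)}.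
Proof. by move=> [oc _ _ cc _]; exact: open_within_continuous oc cc. Qed.

Lemma chart_near (c : chart R S) x : is_chart c -> cdom c x ->
  \forall y \near x, cdom c y.
Proof. by move=> [oc _ _ _ _] cx; exact: open_nbhs_nbhs. Qed.

Lemma chart_image_near (c : chart R S) x : is_chart c -> cdom c x ->
  \forall w \near cmap c x, cdom c (cinv c w) /\ cmap c (cinv c w) = w.
Proof.
move=> [oc oi ci _ _] cx.
have : nbhs (cmap c x) (cmap c @` cdom c).
  by apply: open_nbhs_nbhs; split=> //; exists x.
by apply: filterS => w [u cu <-]; rewrite ci.
Qed.

Lemma chart_inv_continuous (c : chart R S) x : is_chart c -> cdom c x ->
  {for cmap c x, continuous (cinv c)}.
Proof.
move=> [_ oi _ _ cc] cx; apply: open_within_continuous oi cc _.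
by exists x.
Qed.

(** Unlike the second coordinates of charts, these functions are stable under pushing forward by the
    dynamics with its scaling factor; a coordinate can thus follow the iterates and still be
    compared with the charts found there. *)
Definition transversal_at F phi x :=
  exists d e b, [/\ fcharts F d, cdom d x
    & \forall y \near x, phi y = (-1) ^+ (e : bool) * (cmap d y).2 + b].

Definition branch_at Q (pr : R * R -> R) phi (x : S) zeta (b : R) :=
  \forall y \near x, [/\ {for y, continuous zeta},
    cmul (zeta y) (zeta y) = Q y & phi y = pr (zeta y) + b].

Definition branched F (pr : R * R -> R) (V : set S) Q :=
  forall d x, fcharts F d -> V x -> cdom d x ->
    exists zeta b, branch_at Q pr (fun y => (cmap d y).2) x zeta b.

Lemma transversal_of_chart F d x : fcharts F d -> cdom d x ->
  transversal_at F (fun y => (cmap d y).2) x.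
Proof.
move=> Fd dx; exists d, false, 0; split=> //.
by apply: nearW => y; rewrite expr0 mul1r addr0.
Qed.

Lemma transversal_regular F phi x : transversal_at F phi x -> ~ fsing F x.
Proof.
move=> [d [_ [_ [Fd dx _]]]].
have : (\bigcup_(c in fcharts F) cdom c) x by exists d.
by rewrite fcharts_cover.
Qed.

(** [phi] is followed along a vertical segment [w] of a foliated chart, where it varies exactly like
    the parameter, up to sign. *)
Lemma transversal_nonconstant F phi x c : transversal_at F phi x ->
  (\forall y \near x, phi y = c) -> False.
Proof.
move=> [d [e [b [Fd dx phiE]]]] phic.
have ch := fcharts_chart Fd.
pose w (t : R) : R * R := cmap d x + (0, t).
have wc : w @ 0 --> cmap d x.
  have -> : cmap d x = cmap d x + (0, 0).
    by apply: injective_projections; rewrite /= addr0.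
  rewrite /w; apply: (@cvgD _ (R * R)%type _ _ _ (fun=> _) (fun t => (0, t))).
    exact: cvg_cst.
  apply: (cvg_pair (G := nbhs (0:R)) (H := nbhs (0:R))); first exact: cvg_cst.
  exact: cvg_id.
have P1 : \forall t \near (0:R), cdom d (cinv d (w t)) /\ cmap d (cinv d (w t)) = w t.
  exact: (wc _ (chart_image_near ch dx)).
have P2 : \forall t \near (0:R), (-1) ^+ e * (cmap d (cinv d (w t))).2 + b = c.
  have N : \forall y \near cinv d (cmap d x), (-1) ^+ e * (cmap d y).2 + b = c.
    have [_ _ ci _ _] := ch; rewrite ci //.
    by near=> y; rewrite -(near phiE y) // (near phic y).
  exact: (wc _ (chart_inv_continuous ch dx N)).
have P3 : \forall t \near (0:R), (-1) ^+ e * ((cmap d x).2 + t) + b = c.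
  by apply: filterS2 P1 P2 => t [_ ->].
have /nbhs_ballP[r /= r0 br] := P3.
have H0 := br 0 (ballxx _ r0).
have : ball (0:R) r (r / 2) by rewrite /ball /= sub0r normrN ger0_norm; lra.
move=> /br; move: H0; have r2 : r / 2 != 0 by lra.
rewrite addr0 => <- /addIr /(can_inj (signrMK e)) /eqP.
by rewrite -subr_eq0 addrAC subrr add0r (negbTE r2).
Unshelve. all: by end_near. Qed.

(** At each point the roots agree up to sign; the sign cannot jump. If [z x = w x], then [z + w] is
    nonzero at [x], hence nearby, which excludes [z = - w] there. The other case uses [z - w]. *)
Lemma branch_sign Q z w x :
  {for x, continuous z} -> {for x, continuous w} ->
  (\forall y \near x, cmul (z y) (z y) = Q y) ->
  (\forall y \near x, cmul (w y) (w y) = Q y) -> Q x <> 0 ->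
  (\forall y \near x, z y = w y) \/ (\forall y \near x, z y = - w y).
Proof.
move=> cz cw zQ wQ Q0.
have key (v : S -> R * R) : {for x, continuous v} -> v x <> 0 ->
    \forall y \near x, v y <> 0.
  move=> cv v0; apply: (cv (fun u => u <> 0)).
  apply: open_nbhs_nbhs; split=> //.
  have -> : (fun u : R * R => u <> 0) = ~` [set 0] by [].
  apply: closed_openC; apply: accessible_closed_set1.
  exact: hausdorff_accessible (@norm_hausdorff _ _).
have zx : cmul (z x) (z x) = Q x by exact: nbhs_singleton zQ.
have wx : cmul (w x) (w x) = Q x by exact: nbhs_singleton wQ.
have w0 : w x <> 0 by apply: cmul_sq_neq0; rewrite wx.
have w2 : w x + w x <> 0.
  move=> E; apply: w0; move: E; case: (w x) => a b [].
  move=> Ea Eb; congr pair; lra.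
have [zw|zw] := cmul_sq_eq (etrans zx (esym wx)).
- left.
  have : \forall y \near x, z y + w y <> 0.
    by apply: (key (fun y => z y + w y)); [exact: cvgD|rewrite zw].
  move=> N; near=> y.
  have [//|E] : z y = w y \/ z y = - w y.
    by apply: cmul_sq_eq; rewrite (near zQ y) // (near wQ y).
  by exfalso; apply: (near N y) => //; rewrite E addNr.
- right.
  have : \forall y \near x, z y - w y <> 0.
    apply: (key (fun y => z y - w y)); [exact: cvgB|rewrite zw -opprD].
    by move=> /eqP; rewrite oppr_eq0 => /eqP.
  move=> N; near=> y.
  have [E|//] : z y = w y \/ z y = - w y.
    by apply: cmul_sq_eq; rewrite (near zQ y) // (near wQ y).
  by exfalso; apply: (near N y) => //; rewrite E subrr.
Unshelve. all: by end_near. Qed.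

(** Opposite roots are impossible: [phi = p + b] and [phi = - p + c] would make [phi] constant,
    equal to [(b + c) / 2]. With equal roots the constants coincide. *)
Lemma branch_unique F i Q phi x z b w c : transversal_at F phi x -> Q x <> 0 ->
  branch_at Q (proj i) phi x z b -> branch_at Q (proj i) phi x w c ->
  (\forall y \near x, z y = w y) /\ b = c.
Proof.
move=> tr Q0 bz bw.
have [cz _ _] := nbhs_singleton bz; have [cw _ _] := nbhs_singleton bw.
have zQ : \forall y \near x, cmul (z y) (z y) = Q y by apply: filterS bz => y [].
have wQ : \forall y \near x, cmul (w y) (w y) = Q y by apply: filterS bw => y [].
have [E|E] := branch_sign cz cw zQ wQ Q0.
  split=> //; have [_ _ H1] := nbhs_singleton bz; have [_ _ H2] := nbhs_singleton bw.
  by move: H1; rewrite H2 (nbhs_singleton E) => /addrI.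
exfalso; apply: (transversal_nonconstant (c := (b + c) / 2) tr).
near=> y.
have [_ _ H1] : [/\ {for y, continuous z}, cmul (z y) (z y) = Q y
  & phi y = proj i (z y) + b] by near: y.
have [_ _ H2] : [/\ {for y, continuous w}, cmul (w y) (w y) = Q y
  & phi y = proj i (w y) + c] by near: y.
have H3 : proj i (z y) = - proj i (w y) by rewrite (near E y) // projN.
by lra.
Unshelve. all: by end_near. Qed.

Lemma branch_opp Q i phi x z b (e : bool) (b' : R) phi' :
  branch_at Q (proj i) phi x z b ->
  (\forall y \near x, phi' y = (-1) ^+ e * phi y + b') ->
  exists z' b'', branch_at Q (proj i) phi' x z' b'' /\
    forall y, z' y = (-1) ^+ e *: z y.
Proof.
move=> bz phiE; exists (fun y => (-1) ^+ e *: z y), ((-1) ^+ e * b + b'); split=> //.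
near=> y.
have [cz zz pE] : [/\ {for y, continuous z}, cmul (z y) (z y) = Q y
  & phi y = proj i (z y) + b] by near: y.
split.
- by apply: cvgZr.
- by rewrite -zz; case: (e); rewrite ?expr0 ?scale1r // expr1 scaleN1r cmul_oppK.
- rewrite (near phiE y) // pE.
  by case: (e); rewrite ?expr0 ?scale1r ?expr1 ?scaleN1r ?projN; ring.
Unshelve. all: by end_near. Qed.

Lemma transversal_branch F i V Q phi x : branched F (proj i) V Q ->
  transversal_at F phi x -> V x -> exists z b, branch_at Q (proj i) phi x z b.
Proof.
move=> br [d [e [b [Fd dx phiE]]]] Vx.
have [z [c bz]] := br d x Fd Vx dx.
by have [z' [b' [H _]]] := branch_opp bz phiE; exists z', b'.
Qed.

(* As phi is nowhere locally constant, the germ of the branch z and the constant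
   b are determined by phi; hence the local branches agree along X. *)
Lemma branch_along F i V Q phi (X : R -> S) (J : set R) :
  branched F (proj i) V Q -> connected J -> {within J, continuous X} ->
  (forall t, J t -> V (X t)) -> (forall t, J t -> transversal_at F phi (X t)) ->
  (forall t, J t -> Q (X t) <> 0) ->
  exists (z : R -> S -> R * R) (b : R),
    (forall t, J t -> branch_at Q (proj i) phi (X t) (z t) b) /\
    (forall t, J t -> \forall t' \near t, J t' -> z t' (X t') = z t (X t')).
Proof.
move=> br cJ cX JV Jt JQ.
have H t : exists zb : (S -> R * R) * R, J t ->
    branch_at Q (proj i) phi (X t) zb.1 zb.2.
  have [Jt'|nJ] := pselect (J t); last by exists (fun=> 0, 0).
  have [z [b zb]] := transversal_branch br (Jt _ Jt') (JV _ Jt').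
  by exists (z, b).
have [zb zbP] := choice H.
have near_eq t : J t -> \forall t' \near t, J t' ->
    (zb t').2 = (zb t).2 /\ (zb t').1 (X t') = (zb t).1 (X t').
  move=> Jt0.
  have := nbhs_interior (zbP _ Jt0); move=> /(within_near cX Jt0).
  apply: filterS => t' H' Jt'.
  have [E1 E2] := branch_unique (Jt _ Jt') (JQ _ Jt') (zbP _ Jt') (H' Jt').
  by split=> //; exact: nbhs_singleton E1.
have [[t0 Jt0]|J0] := pselect (J !=set0); last first.
  exists (fun=> fun=> 0), 0; split=> t Ht; exfalso; apply: J0; by exists t.
exists (fun t => (zb t).1), (zb t0).2; split=> t Ht.
  have -> : (zb t0).2 = (zb t).2.
    apply: (locally_constant_connected (b := fun t => (zb t).2) cJ) => // u Ju.
    by apply: filterS (near_eq _ Ju) => v vu Jv; have [] := vu Jv.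
  exact: zbP.
by apply: filterS (near_eq _ Ht) => v vu Jv; have [] := vu Jv.
Qed.

End Germs.

(** * Action of the dynamics on transverse coordinates and leaf paths *)

Section Scaling.
Variables (R : realType) (S : surface R).
Implicit Types (F G : measured_foliation S) (phi : S -> R).

Lemma homeomorphism_sym (X Y : topologicalType) (f : X -> Y) finv :
  homeomorphism f finv -> homeomorphism finv f.
Proof. by case. Qed.

Lemma iter_homeomorphism (f finv : S -> S) n : homeomorphism f finv ->
  homeomorphism (iter n f) (iter n finv).
Proof.
move=> [cf cfi fK fiK]; elim: n => [|n [cfn cfin fnK finK]].
  by split=> // x; exact: cvg_id.
split.
- by move=> x; apply: (continuous_comp (cfn x)); exact: cf.
- by move=> x; apply: (continuous_comp (cfin x)); exact: cfi.
- by move=> x; rewrite iterSr iterS fK fnK.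
- by move=> x; rewrite iterSr iterS fiK finK.
Qed.

Lemma scales_inv (f finv : S -> S) F a : homeomorphism f finv -> a != 0 ->
  scales f F a -> scales finv F a^-1.
Proof.
move=> [cf cfi fK fiK] a0 [fs sc]; split.
  rewrite -{1}fs; apply/seteqP; split=> x /=.
    by move=> [_ [y sy <-] <-]; rewrite fK.
  by move=> sx; exists (f x) => //; exists x.
move=> c d x Fc Fd cx dx.
have cfx : cdom c (f (finv x)) by rewrite fiK.
have [e [b H]] := sc d c (finv x) Fd Fc dx cfx.
exists e, (- ((-1) ^+ e * (a^-1 * b))).
have := continuous_near (cfi x) H; apply: filterS => y.
rewrite fiK => ->.
by case: (e); rewrite ?expr0 ?expr1; field.
Qed.

Lemma scales_sing (f finv : S -> S) F a x : homeomorphism f finv ->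
  scales f F a -> fsing F (f x) <-> fsing F x.
Proof.
move=> [_ _ fK _] [fs _]; split; last by move=> sx; rewrite -fs; exists x.
by rewrite -{1}fs => -[y sy /(can_inj fK) E]; rewrite -E.
Qed.

Lemma regular_chart F x : ~ fsing F x -> exists2 c, fcharts F c & cdom c x.
Proof.
move=> nx; have : (~` fsing F) x by [].
by rewrite -fcharts_cover => -[c Fc cx]; exists c.
Qed.

Lemma scales_transversal (f finv : S -> S) F a phi x :
  homeomorphism f finv -> scales f F a -> transversal_at F phi x ->
  transversal_at F (fun y => a * phi (finv y)) (f x).
Proof.
move=> hf sc tr; have [cf cfi fK fiK] := hf.
have [d Fd dfx] : exists2 d, fcharts F d & cdom d (f x).
  apply: regular_chart; rewrite (scales_sing _ hf sc).
  exact: transversal_regular tr.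
have [c [e [b [Fc cx phiE]]]] := tr.
have [e' [b' H]] := sc.2 c d x Fc Fd cx dfx.
exists d, (e (+) e'), (a * b - (-1) ^+ (e (+) e') * b'); split=> //.
have H' : \forall y \near f x, (cmap d y).2 = (-1) ^+ e' * (a * (cmap c (finv y)).2) + b'.
  have N : \forall y \near finv (f x), (cmap d (f y)).2 =
     (-1) ^+ e' * (a * (cmap c y).2) + b' by rewrite fK.
  by have := continuous_near (cfi _) N; apply: filterS => y; rewrite fiK.
have phiE' : \forall y \near f x, phi (finv y) = (-1) ^+ e * (cmap c (finv y)).2 + b.
  have N : \forall y \near finv (f x), phi y = (-1) ^+ e * (cmap c y).2 + b.
    by rewrite fK.
  exact: continuous_near (cfi _) N.
apply: filterS2 H' phiE' => y -> ->.
by case: (e); case: (e'); rewrite /= ?expr0 ?expr1; ring.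
Qed.

Lemma scales_transversal_iter (f finv : S -> S) F a phi x n :
  homeomorphism f finv -> scales f F a -> transversal_at F phi x ->
  transversal_at F (fun y => a ^+ n * phi (iter n finv y)) (iter n f x).
Proof.
move=> hf sc tr; elim: n => [|n IH] /=.
  have -> // : (fun y => a ^+ 0 * phi y) = phi.
  by apply/funext => y; rewrite expr0 mul1r.
have := scales_transversal hf sc IH.
congr (transversal_at F _ _); apply/funext => y.
by rewrite -iterSr /= exprS mulrA.
Qed.

Lemma scales_sing_iter (f finv : S -> S) F a x n : homeomorphism f finv ->
  scales f F a -> fsing F (iter n f x) <-> fsing F x.
Proof. by move=> hf sc; elim: n => //= n IH; rewrite (scales_sing _ hf sc). Qed.

Lemma leaf_path_transversal F X t phi : leaf_path F X -> unit_interval t ->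
  transversal_at F phi (X t) ->
  \forall s \near t, unit_interval s -> phi (X s) = phi (X t).
Proof.
move=> [cX H] ut [d [e [b [Fd dx phiE]]]].
have phit := nbhs_singleton phiE.
have phiE' := within_near cX ut phiE.
apply: filterS2 (H t d ut Fd dx) phiE' => s H1 H2 us.
by rewrite phit H2 // H1.
Qed.

(** The scaling of [finv] pulls a chart at [f (X t)] back to a transverse coordinate at [X t], which
    is constant along [X]. *)
Lemma leaf_path_image F f finv a X : homeomorphism f finv -> a != 0 ->
  scales f F a -> leaf_path F X -> leaf_path F (f \o X).
Proof.
move=> hf a0 sc lX; have [cf cfi fK fiK] := hf; split.
  have [cX _] := lX; apply: within_continuous_comp => // y _; exact: cf.
move=> t c ut Fc cx.
have tr := transversal_of_chart Fc cx.
have := scales_transversal (homeomorphism_sym hf) (scales_inv hf a0 sc) tr.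
rewrite /= fK => /(leaf_path_transversal lX ut).
apply: filterS => s /[apply] /=; apply: mulfI.
by rewrite invr_neq0.
Qed.

Lemma leaf_path_image_iter F f finv a X n : homeomorphism f finv -> a != 0 ->
  scales f F a -> leaf_path F X -> leaf_path F (iter n f \o X).
Proof.
by move=> hf a0 sc lX; elim: n => //= n IH; exact: (leaf_path_image hf a0 sc IH).
Qed.

Lemma leaf_path_reparam F X (p : R -> R) : continuous p ->
  (forall t, unit_interval t -> unit_interval (p t)) ->
  leaf_path F X -> leaf_path F (X \o p).
Proof.
move=> cp up [cX H].
have key (P : R -> Prop) t : unit_interval t ->
    (\forall s \near p t, unit_interval s -> P s) ->
    \forall s \near t, unit_interval s -> P (p s).
  by move=> ut H0; have := continuous_near (cp t) H0; apply: filterS => s H1 /up.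
split.
  apply/subspace_continuousP => t ut B /= NB.
  have := within_near cX (up _ ut) NB => /(key _ _ ut) H1.
  exact: H1.
move=> t c ut Fc cx.
exact: (key (fun s => (cmap c (X s)).2 = _) t ut (H (p t) c (up _ ut) Fc cx)).
Qed.

End Scaling.

(** * Common local models of the two foliations *)

Section Models.
Variables (R : realType) (S : surface R).
Implicit Types (F G : measured_foliation S) (phi : S -> R) (Q : S -> R * R).

(* A common model of both foliations near x: z being a local square root of Q,
   proj i z and proj (~~ i) z are, up to sign and a constant, the transverse
   coordinates of F and G.  At a k-prong Q is the k-th power of the complex
   coordinate; at a regular point Q is w ^ 2, where w has been translated so
   that Q is injective and its square roots have nonzero components. *)
Record model F G (i : bool) (x : S) (V : set S) Q : Prop := Model {
  model_open : open V;
  model_mem : V x;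
  model_continuous : forall y, V y -> {for y, continuous Q};
  model_inj : forall y, V y -> Q y = Q x -> y = x;
  model_sing : forall y, V y -> fsing F y -> y = x;
  model_neq0 : forall y, V y -> ~ fsing F y -> Q y <> 0;
  model_branch : branched F (proj i) V Q;
  model_branch_transverse : branched G (proj (~~ i)) V Q;
  model_bound : forall y, V y -> nsq (Q y) <= 16;
  model_dichotomy : Q x = 0 \/
    forall y z j, V y -> cmul z z = Q y -> proj j z <> 0 }.

(** [Q y] is the square of [z], so [nsq (Q y)] is the square of [nsq z]: the constant 16 of the
    models means that every root has modulus at most 2. *)
Lemma model_root_bound F G i x V Q y z j : model F G i x V Q -> V y ->
  cmul z z = Q y -> `|proj j z| <= 2.
Proof.
move=> m Vy zz; have := model_bound m Vy; rewrite -zz nsq_cmul => H.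
have z4 : nsq z <= 4 by have := nsq_ge0 z; nra.
have := le_trans (proj_sq_le j z) z4.
rewrite -(@ler_sqr _ `|proj j z|) ?nnegrE // real_normK ?num_real //.
by rewrite -natrX.
Qed.

(* |proj i z| is locally constant along the path and tends to 0 at its origin,
   where Q vanishes. *)
Lemma leaf_path_from_zero F G i x V Q X (a b : R) :
  model F G i x V Q -> leaf_path F X -> 0 <= a -> b <= 1 -> X a = x ->
  Q x = 0 -> (forall t, a < t <= b -> V (X t) /\ ~ fsing F (X t)) ->
  forall t z, a < t <= b -> cmul z z = Q (X t) -> proj i z = 0.
Proof.
move=> m lX a0 b1 Xa Qx0 VX.
pose J := `]a, b]%classic : set R.
have JE t : J t = (a < t <= b) by rewrite /J /= in_itv.
have Ju t : J t -> unit_interval t.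
  by rewrite JE /unit_interval /= => /andP[? ?]; lra.
(* Two roots differ by a sign, so [A] does not depend on the root picked by [xget]. *)
pose A t : R := `|proj i (xget 0 [set z | cmul z z = Q (X t)])|.
have AE t z : cmul z z = Q (X t) -> A t = `|proj i z|.
  move=> zz; rewrite /A; case: xgetP => [w _ /= ww|/(_ z)//].
  by have [->|->] := cmul_sq_eq (etrans ww (esym zz)); rewrite // projN normrN.
have near_A t : J t -> \forall s \near t, J s -> A s = A t.
  move=> Jt; have [Vt rt] := VX t Jt.
  have [c Fc cx] := regular_chart rt.
  have [z [b' bz]] := model_branch m Fc Vt cx.
  have H1 := lX.2 t c (Ju _ Jt) Fc cx.
  have H2 := within_near lX.1 (Ju _ Jt) bz.
  have [_ zt pt] := nbhs_singleton bz.
  apply: filterS2 H1 H2 => s H1 H2 Js.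
  have [_ zs ps] := H2 (Ju _ Js).
  rewrite (AE _ _ zs) (AE _ _ zt); congr `|_|.
  by apply: (addIr b'); rewrite -ps -pt H1 //; exact: Ju.
have cJ : connected J by apply/connected_intervalP; exact: interval_is_interval.
have Ac := locally_constant_connected cJ near_A.
move=> t z /[dup] tab; rewrite -JE => Jt zz.
apply/eqP; rewrite -normr_eq0 -(AE _ _ zz); apply/eqP.
apply: contrapT => A0.
have {A0}A0 : 0 < A t by rewrite lt_def normr_ge0 andbT; apply/eqP.
have ua : unit_interval a by rewrite /unit_interval /=; move: tab => /andP[]; lra.
(* A fourth power, because [nsq (Q y)] is the square of [nsq z], which at the times of [J] is at
   least [A t ^+ 2] for every root [z]. *)
have NQ : \forall y \near X a, nsq (Q y) < A t ^+ 4.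
  have : {for X a, continuous (@nsq R \o Q)}.
    have cQ : {for X a, continuous Q} by rewrite Xa; exact: (model_continuous m (model_mem m)).
    apply: continuous_comp => //.
    have -> : @nsq R = (fun z => z.1 * z.1 + z.2 * z.2).
      by apply/funext => w; rewrite /nsq !expr2.
    apply: cvgD; apply: cvgM; (exact: cvg_fst || exact: cvg_snd).
  move=> /cvgr_lt; apply.
  by rewrite /= Xa Qx0 nsq0 exprn_gt0.
have /nbhs_ballP[r /= r0 br] := within_near lX.1 ua NQ.
pose s := a + Num.min (r / 2) (t - a).
have m0 : 0 < Num.min (r / 2) (t - a).
  by rewrite lt_min; move: tab => /andP[? _]; apply/andP; split; lra.
have sJ : J s.
  rewrite JE /s ltrDl m0 /=; move: tab => /andP[_].
  have : Num.min (r / 2) (t - a) <= t - a by rewrite ge_min lexx orbT.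
  lra.
have Qs : nsq (Q (X s)) < A t ^+ 4.
  apply: br; last exact: Ju.
  rewrite /ball /= /s opprD addNKr normrN gtr0_norm //.
  have : Num.min (r / 2) (t - a) <= r / 2 by rewrite ge_min lexx.
  lra.
have [Vs rs] := VX s sJ.
have [c Fc cx] := regular_chart rs.
have [w [b' bw]] := model_branch m Fc Vs cx.
have [_ ww _] := nbhs_singleton bw.
have := AE _ _ ww; rewrite (Ac _ _ sJ Jt) => At.
have : A t ^+ 2 <= nsq (w (X s)).
  by rewrite At real_normK ?num_real // proj_sq_le.
move: Qs; rewrite -ww nsq_cmul.
have -> : A t ^+ 4 = A t ^+ 2 * A t ^+ 2 by rewrite -exprD.
rewrite ltNge => /negP Qs H; apply: Qs.
by apply: ler_pM => //; exact: sqr_ge0.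
Qed.

End Models.

(** * Dynamical characterization of the leaves *)

Section Expanding.
Variables (R : realType) (S : surface R).
Implicit Types (F G : measured_foliation S) (phi : S -> R) (Q : S -> R * R).

(* F is the foliation whose leaves f contracts.  The pair (F, G) and f are
   abstract so that f^-1 with the two foliations exchanged is an instance. *)
Record expanding (f finv : S -> S) F G (i : bool) (a : R) : Prop := Expanding {
  exp_homeo : homeomorphism f finv;
  exp_gt1 : 1 < a;
  exp_scales : scales f F a;
  exp_scales_transverse : scales f G a^-1;
  exp_sing : fsing F = fsing G;
  exp_model : forall x O, nbhs x O ->
    exists V Q, model F G i x V Q /\ V `<=` O }.

Definition open_cover (UU : set (set S)) :=
  (forall U, UU U -> open U) /\ (forall x, exists2 U, UU U & U x).

(** Only continuity, iteration and open covers occur, and [f] is any map: this makes the notion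
    invariant under conjugacy. A single member of the cover has to contain the image of the whole
    window of radius [e]. *)
Definition contracted (f : S -> S) (X : R -> S) :=
  {within @unit_interval R, continuous X} /\
  forall t, unit_interval t -> exists2 e : R, 0 < e &
    forall UU, open_cover UU -> exists n0 : nat, forall n, (n0 <= n)%N ->
      exists2 U, UU U &
        forall s, unit_interval s -> `|s - t| <= e -> U (iter n f (X s)).

Lemma small_power (a e : R) : 1 < a -> 0 < e ->
  exists m : nat, forall n, (m <= n)%N -> a^-1 ^+ n <= e.
Proof.
move=> a1 e0.
have a0 : 0 < a by exact: lt_trans a1.
have ai : `|a^-1| < 1 by rewrite gtr0_norm ?invr_gt0 // invf_lt1.
have /cvgr0_norm_le /(_ _ e0) [m _ H] := cvg_expr ai.
exists m => n mn; have := H n mn; rewrite /= ger0_norm //.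
by rewrite exprn_ge0 // invr_ge0 ltW.
Qed.

(** The components of a square are, up to sign, the difference of the squares of the two projections
    and twice their product. As [proj i] is common to [z] and [w], the first varies by at most
    [(2 + 2) * e] and the second by at most [2 * 2 * e]. *)
Lemma root_dist i (z w : R * R) (e : R) :
  proj i z = proj i w -> `|proj (~~ i) z - proj (~~ i) w| <= e ->
  `|proj i z| <= 2 ->
  `|proj (~~ i) z| <= 2 -> `|proj (~~ i) w| <= 2 ->
  `|cmul z z - cmul w w| <= 4 * e.
Proof.
move=> E H b1 b2 b3.
have H1 : `|proj (~~ i) z ^+ 2 - proj (~~ i) w ^+ 2| <= 4 * e.
  rewrite subr_sqr normrM mulrC; apply: ler_pM => //.
  by apply: le_trans (ler_normD _ _) _; lra.
have H2 : `|proj i z * (proj (~~ i) z - proj (~~ i) w)| <= 2 * e.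
  by rewrite normrM; apply: ler_pM.
rewrite prod_normE /= ge_max.
case: i E H H1 H2 {b1 b2 b3} => /= E H H1 H2.
- apply/andP; split.
    apply: le_trans H1; rewrite -normrN le_eqVlt; apply/orP; left; apply/eqP.
    by congr `|_|; rewrite E; ring.
  have -> : z.1 * z.2 + z.2 * z.1 - (w.1 * w.2 + w.2 * w.1) =
    2 * (z.1 * (z.2 - w.2)) by rewrite E; ring.
  by rewrite normrM ger0_norm //; lra.
- apply/andP; split.
    apply: le_trans H1; rewrite le_eqVlt; apply/orP; left; apply/eqP.
    by congr `|_|; rewrite E; ring.
  have -> : z.1 * z.2 + z.2 * z.1 - (w.1 * w.2 + w.2 * w.1) =
    2 * (z.2 * (z.1 - w.1)) by rewrite E; ring.
  by rewrite normrM ger0_norm //; lra.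
Qed.

Lemma unit_intervalE : @unit_interval R = `[0, 1]%classic.
Proof. by apply/seteqP; split=> t; rewrite /unit_interval /= in_itv. Qed.

Section Fixed.
Variables (f finv : S -> S) (F G : measured_foliation S) (i : bool) (a : R).
Hypothesis ex : expanding f finv F G i a.

Lemma exp_gt0 : 0 < a. Proof. exact: lt_trans (exp_gt1 ex). Qed.

(* A path starting near x can leave V' only if Q varies by at least d. *)
Definition trap x V Q (V' : set S) (d : R) :=
  [/\ model F G i x V Q, open V' /\ V' x, closure V' `<=` V, 0 < d
    & forall y, closure V' y -> ~ V' y -> 2 * d <= `|Q y - Q x| ].

(** On the frontier of a smaller neighbourhood [W], a compact set avoiding [x], the distance from
    [Q] to [Q x] has a positive minimum, since [Q] takes the value [Q x] only at [x]. *)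
Lemma exists_trap x (O : set S) : nbhs x O ->
  exists V Q V' d, trap x V Q V' d /\ V `<=` O.
Proof.
move=> Ox; have [V [Q [m VO]]] := exp_model ex Ox.
have NV : nbhs x V.
  by apply: open_nbhs_nbhs; split; [exact: model_open m|exact: model_mem m].
have [W [oW Wx WV]] := compact_Hausdorff_regular
  (@surface_hausdorff _ S) (@surface_compact _ S) NV.
have cK : compact (closure W `&` ~` W).
  apply: subclosed_compact (@surface_compact _ S) _ => //.
  by apply: closedI; [exact: closed_closure|exact: open_closedC].
have [K0|K0] := pselect (closure W `&` ~` W !=set0); last first.
  (* With an empty frontier the exit condition is vacuous, and 1 is an arbitrary choice. *)
  exists V, Q, W, 1; split=> //; split=> // y y1 y2.
  by exfalso; apply: K0; exists y.
have cQ : {within closure W `&` ~` W, continuous (fun y => `|Q y - Q x|)}.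
  apply/subspace_continuousP => y [Wy _].
  apply: cvg_within_filter; apply: cvg_norm; apply: cvgB; last exact: cvg_cst.
  exact: (model_continuous m (WV _ Wy)).
have [c /set_mem [Wc nWc] minc] := compact_EVT_min K0 cK cQ.
(* Half the minimum: a path will start with [Q] within [d] of [Q x] and exit at distance at least
   [2 * d]. *)
exists V, Q, W, (`|Q c - Q x| / 2); split=> //; split=> //.
  apply: divr_gt0 => //; rewrite normr_gt0 subr_eq0; apply/eqP => E.
  by apply: nWc; rewrite (model_inj m (WV _ Wc) E).
move=> y Wy nWy; rewrite mulrC divfK //.
by apply: minc; apply/mem_set.
Qed.

(** If [Q x = 0], then [proj i z] vanishes along the path, and [proj (~~ i) z = 0] would give
    [Q = 0] at a regular point. Otherwise the dichotomy of the model says that no component of a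
    root vanishes. *)
Lemma proj_transverse_neq0 x V Q X (s1 s2 : R) :
  model F G i x V Q -> leaf_path F X -> 0 <= s1 -> s2 <= 1 -> X s1 = x ->
  (forall t, s1 < t <= s2 -> V (X t) /\ ~ fsing F (X t)) ->
  forall t z, s1 < t <= s2 -> cmul z z = Q (X t) -> proj (~~ i) z <> 0.
Proof.
move=> m lX s10 s21 Xs1 VX t z tb zz.
have [Vt rt] := VX _ tb.
have [Q0|D] := model_dichotomy m; last exact: D Vt zz.
move=> z0; have z0' := leaf_path_from_zero m lX s10 s21 Xs1 Q0 VX tb zz.
apply: (model_neq0 m Vt rt); rewrite -zz.
have -> : z = 0.
  by apply: nsq_eq0; rewrite (nsq_proj i) z0 z0' expr0n addr0.
by rewrite /cmul /= mulr0 subr0 addr0.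
Qed.

(* |proj (~~ i) z| does not depend on the choice of the root z: this is a global
   function on V, so that no branch of the root has to be followed along a path. *)
Lemma abs_root_transversal x V Q y :
  model F G i x V Q -> V y -> ~ fsing F y ->
  (forall z, cmul z z = Q y -> proj (~~ i) z <> 0) ->
  transversal_at G
    (fun u => `|proj (~~ i) (xget 0 [set z | cmul z z = Q u])|) y.
Proof.
move=> m Vy ry nz.
have ry' : ~ fsing G y by rewrite -(exp_sing ex).
have [c Gc cy] := regular_chart ry'.
have [z [b bz]] := model_branch_transverse m Gc Vy cy.
have [cz zz pz] := nbhs_singleton bz.
have AE u : cmul (z u) (z u) = Q u ->
    `|proj (~~ i) (xget 0 [set w | cmul w w = Q u])| = `|proj (~~ i) (z u)|.
  move=> zu; case: xgetP => [w _ /= ww|/(_ (z u))//].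
  by have [->|->] := cmul_sq_eq (etrans ww (esym zu)); rewrite // projN normrN.
have cp : {for y, continuous (fun u => proj (~~ i) (z u))}.
  rewrite /proj; case: (~~ i).
    exact: continuous_fst.
  exact: continuous_snd.
have := nz _ zz => /eqP; rewrite neq_lt => /orP[neg|pos].
- exists c, true, b; split=> //.
  have H : \forall u \near y, proj (~~ i) (z u) < 0 by exact: (cvgr_lt _ cp).
  apply: filterS2 bz H => u [_ zu /= pu] lu.
  by rewrite AE // ltr0_norm //= pu expr1; ring.
- exists c, false, (- b); split=> //.
  have H : \forall u \near y, 0 < proj (~~ i) (z u) by exact: (cvgr_gt _ cp).
  apply: filterS2 bz H => u [_ zu /= pu] lu.
  by rewrite AE // gtr0_norm //= pu expr0; ring.
Qed.

(* At its exit time the path would have moved Q by d; but since it was last at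
   x0 its G-length is at most 2 and, once pushed by f^n, at most 2 a^-n. *)
Lemma path_in_trap x V Q V' d n x0 V0 Q0 X :
  trap x V Q V' d -> 8 * a^-1 ^+ n <= d ->
  V' (iter n f x0) -> `|Q (iter n f x0) - Q x| < d ->
  model F G i x0 V0 Q0 -> leaf_path F X -> X 0 = x0 ->
  (forall t, unit_interval t -> V0 (X t)) ->
  forall t, unit_interval t -> V' (iter n f (X t)).
Proof.
move=> [m [oV' V'x] V'V d0 exitV'] nd V'0 Q0d m0 lX X0 V0X t1 ut1.
have a0 : a != 0 by rewrite gt_eqF // exp_gt0.
have lXn := leaf_path_image_iter n (exp_homeo ex) a0 (exp_scales ex) lX.
apply: contrapT => nV'.
have [s [/andP[s0_ st1] nV's ltV']] :
    exists s, [/\ 0 <= s <= t1, ~ V' (iter n f (X s)) &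
      forall t, 0 <= t < s -> V' (iter n f (X t))].
  by apply: (first_exit (b := 1)) => //; rewrite -unit_intervalE; have [] := lXn.
have s1 : s <= 1 by move: ut1 => /andP[_]; lra.
have us : unit_interval s by rewrite /unit_interval /=; lra.
(* A first exit for the path reversed from time [s] is the last visit [c0 = s - r] to [x0].
   Afterwards the path avoids [x0], the only possible singularity in [V0]. *)
have [r [/andP[r0 rs] Yr Yt]] : exists r, [/\ 0 <= r <= s, ~ (X (s - r) != x0)
    & forall t, 0 <= t < r -> X (s - t) != x0].
  apply: (@first_exit R S (fun t => X (s - t)) 0 s [set y | y != x0] s).
  - apply/subspace_continuousP => t; rewrite /= in_itv /= => ts B NB.
    have us' : unit_interval (s - t) by rewrite /unit_interval /=; lra.
    have H := within_near lX.1 us' NB.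
    have cs : {for t, continuous (fun u : R => s - u)}.
      by apply: cvgB; [exact: cvg_cst|exact: cvg_id].
    have := continuous_near cs H; apply: filterS => u H' /=.
    rewrite in_itv /= => us''; apply: H'; rewrite /unit_interval /=; lra.
  - have -> : [set y | y != x0] = ~` [set x0] by apply/seteqP; split=> y /eqP.
    apply: closed_openC; apply: accessible_closed_set1.
    exact: hausdorff_accessible (@surface_hausdorff _ S).
  - by rewrite s0_ lexx.
  - by rewrite /= subrr X0 eqxx.
pose c0 := s - r.
have c00 : 0 <= c0 by rewrite /c0; lra.
have Xc0 : X c0 = x0 by move/negP: Yr; rewrite negbK => /eqP.
have c0s : c0 < s.
  rewrite lt_neqAle; apply/andP; split; last by rewrite /c0; lra.
  by apply/eqP => E; apply: nV's; rewrite -E Xc0.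
have Xne t : c0 < t <= s -> X t != x0.
  move=> tb; have -> : t = s - (s - t) by ring.
  by apply: Yt; move: tb; rewrite /c0; lra.
have uJ t : c0 < t <= s -> unit_interval t by rewrite /unit_interval /=; lra.
have VX t : c0 < t <= s -> V0 (X t) /\ ~ fsing F (X t).
  move=> tb; split; first by apply: V0X; exact: uJ.
  by move=> sg; have := Xne t tb; rewrite (model_sing m0 (V0X _ (uJ _ tb)) sg) eqxx.
have pn := proj_transverse_neq0 m0 lX c00 s1 Xc0 VX.
(* A transverse coordinate of [G] with values in [0, 2] along the path. Pushed by the [n]-th iterate
   it becomes [phi], whose variation is at most [2 * a^-1 ^+ n]. *)
pose phi0 u := `|proj (~~ i) (xget 0 [set z | cmul z z = Q0 u])|.
have phi0_tr t : c0 < t <= s -> transversal_at G phi0 (X t).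
  move=> tb; have [V0t rt] := VX t tb.
  by apply: (abs_root_transversal m0) => // z; exact: pn.
have phi0_bound t : c0 < t <= s -> 0 <= phi0 (X t) <= 2.
  move=> tb; rewrite normr_ge0 /= /phi0; have [V0t rt] := VX t tb.
  case: xgetP => [w _ /= ww|_]; first exact: model_root_bound m0 V0t ww.
  by rewrite /proj; case: (~~ i); rewrite /= normr0.
pose phi y := a^-1 ^+ n * phi0 (iter n finv y).
have [_ _ fnK _] := iter_homeomorphism n (exp_homeo ex).
have phiE t : phi (iter n f (X t)) = a^-1 ^+ n * phi0 (X t) by rewrite /phi fnK.
have phi_tr t : c0 < t <= s -> transversal_at G phi (iter n f (X t)).
  move=> tb; apply: scales_transversal_iter (phi0_tr t tb).
    exact: exp_homeo ex.
  exact: exp_scales_transverse ex.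
have clV' t : c0 < t <= s -> closure V' (iter n f (X t)).
  move=> /andP[ct]; rewrite le_eqVlt => /orP[/eqP ->|ts]; last first.
    by apply: subset_closure; apply: ltV'; lra.
  move=> B NB.
  have /nbhs_ballP[e /= e0 be] := within_near lXn.1 us NB.
  exists (iter n f (X (s - Num.min (e / 2) (s - c0)))).
  have mp : 0 < Num.min (e / 2) (s - c0) by rewrite lt_min; apply/andP; split; lra.
  have m1 : Num.min (e / 2) (s - c0) <= e / 2 by rewrite ge_min lexx.
  have m2 : Num.min (e / 2) (s - c0) <= s - c0 by rewrite ge_min lexx orbT.
  split; first by apply: ltV'; lra.
  apply: be; last by rewrite /unit_interval /=; lra.
  by rewrite /ball /= opprB addrC subrK gtr0_norm //; lra.
pose J := `]c0, s]%classic : set R.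
have JE t : J t = (c0 < t <= s) by rewrite /J /= in_itv.
have cJ : connected J by apply/connected_intervalP; exact: interval_is_interval.
have JV t : J t -> V (iter n f (X t)) by rewrite JE => tb; apply: V'V; exact: clV'.
have JQ t : J t -> Q (iter n f (X t)) <> 0.
  move=> Jt; apply: (model_neq0 m (JV t Jt)).
  rewrite (scales_sing_iter _ _ (exp_homeo ex) (exp_scales ex)).
  by move: Jt; rewrite JE => /VX[].
have cXJ : {within J, continuous (iter n f \o X)}.
  apply: continuous_subspaceW lXn.1 => t; rewrite JE; exact: uJ.
have Jtr t : J t -> transversal_at G phi ((iter n f \o X) t).
  by rewrite JE; exact: phi_tr.
have [z [b [bz zz]]] := branch_along (model_branch_transverse m) cJ cXJ JV Jtr JQ.
(* The branch [z] is attached to the [G]-coordinate [phi]. The branch [w] attached to an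
   [F]-coordinate has constant [proj i] along the leaf path, and [z] is locally [w] or [- w]. *)
have projz_const t : J t ->
    \forall t' \near t, J t' -> proj i (z t' (iter n f (X t'))) = proj i (z t (iter n f (X t))).
  move=> Jt; have ut : unit_interval t by apply: uJ; rewrite -JE.
  have rt : ~ fsing F (iter n f (X t)).
    rewrite (scales_sing_iter _ _ (exp_homeo ex) (exp_scales ex)).
    by move: Jt; rewrite JE => /VX[].
  have [c Fc cx] := regular_chart rt.
  have [w [e bw]] := model_branch m Fc (JV t Jt) cx.
  have [cz zQ _] := nbhs_singleton (bz t Jt).
  have [cw wQ _] := nbhs_singleton bw.
  have zN : \forall y \near iter n f (X t), cmul (z t y) (z t y) = Q y.
    by apply: filterS (bz t Jt) => y [].
  have wN : \forall y \near iter n f (X t), cmul (w y) (w y) = Q y.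
    by apply: filterS bw => y [].
  have cwt := lXn.2 t c ut Fc cx.
  have H1 : \forall t' \near t, J t' ->
      proj i (w (iter n f (X t'))) = proj i (w (iter n f (X t))).
    have := within_near lXn.1 ut bw; apply: filterS2 cwt => t' H1 H2 Jt'.
    have ut' : unit_interval t' by apply: uJ; rewrite -JE.
    have [_ _ /= p1] := H2 ut'; have [_ _ /= p2] := nbhs_singleton bw.
    by apply: (addIr e); rewrite -p1 -p2; exact: H1.
  have [E|E] := branch_sign cz cw zN wN (JQ t Jt).
    have := within_near lXn.1 ut E; apply: filterS3 (zz t Jt) H1 => t' H2 H1 H3 Jt'.
    have ut' : unit_interval t' by apply: uJ; rewrite -JE.
    by rewrite H2 // H3 // (nbhs_singleton E) H1.
  have := within_near lXn.1 ut E; apply: filterS3 (zz t Jt) H1 => t' H2 H1 H3 Jt'.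
  have ut' : unit_interval t' by apply: uJ; rewrite -JE.
  by rewrite H2 // H3 // (nbhs_singleton E) !projN H1.
have projz := locally_constant_connected cJ projz_const.
have Js : J s by rewrite JE c0s lexx.
have Qdist t : J t -> `|Q (iter n f (X t)) - Q (iter n f (X s))| <= d.
  move=> Jt; apply: le_trans nd.
  have [_ zt pt] := nbhs_singleton (bz t Jt).
  have [_ zs ps] := nbhs_singleton (bz s Js).
  (* Of the 8, a factor 4 comes from [root_dist] and a factor 2 from the range of [phi0]. *)
  rewrite -zt -zs -[8](_ : 4 * 2 = 8); last by ring.
  rewrite -mulrA; apply: (root_dist (i := i)) => //.
  - exact: projz.
  - move: pt ps; rewrite !phiE => pt ps.
    have -> : proj (~~ i) (z t (iter n f (X t))) - proj (~~ i) (z s (iter n f (X s)))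
       = a^-1 ^+ n * (phi0 (X t) - phi0 (X s)) by rewrite mulrBr pt ps; ring.
    have an : 0 <= a^-1 ^+ n by rewrite exprn_ge0 // invr_ge0 ltW // exp_gt0.
    rewrite normrM ger0_norm // mulrC; apply: ler_wpM2r => //.
    have := phi0_bound t; rewrite -JE => /(_ Jt) /andP[? ?].
    have := phi0_bound s; rewrite -JE => /(_ Js) /andP[? ?].
    by rewrite ler_norml; lra.
  - exact: model_root_bound m (JV t Jt) zt.
  - exact: model_root_bound m (JV t Jt) zt.
  - exact: model_root_bound m (JV s Js) zs.
have uc0 : unit_interval c0 by rewrite /unit_interval /=; lra.
(* At [c0] the image may be singular and carry no branch, so the comparison starts at a slightly
   later time [t], with [Q] still within [d] of [Q x]. From [t] to [s] it varies by at most [d], too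
   little to reach distance [2 * d]. *)
have NQ : \forall y \near iter n f (X c0), `|Q y - Q x| < d.
  have cQ : {for iter n f (X c0), continuous (fun y => `|Q y - Q x|)}.
    apply: cvg_norm; apply: cvgB; last exact: cvg_cst.
    by apply: (model_continuous m); rewrite Xc0; apply: V'V; exact: subset_closure.
  by apply: (cvgr_lt _ cQ); rewrite Xc0.
have /nbhs_ballP[e /= e0 be] := within_near lXn.1 uc0 NQ.
have mp : 0 < Num.min (e / 2) (s - c0) by rewrite lt_min; apply/andP; split; lra.
have m1 : Num.min (e / 2) (s - c0) <= e / 2 by rewrite ge_min lexx.
have m2 : Num.min (e / 2) (s - c0) <= s - c0 by rewrite ge_min lexx orbT.
pose t := c0 + Num.min (e / 2) (s - c0).
have Jt : J t by rewrite JE /t; lra.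
have H1 : `|Q (iter n f (X t)) - Q x| < d.
  apply: be; last by apply: uJ; rewrite -JE.
  by rewrite /ball /= /t opprD addNKr normrN gtr0_norm //; lra.
have H2 := Qdist t Jt.
have H3 : 2 * d <= `|Q (iter n f (X s)) - Q x|.
  by apply: exitV' => //; apply: clV'; rewrite -JE.
have := ler_distD (Q (iter n f (X t))) (Q (iter n f (X s))) (Q x).
by rewrite (distrC (Q (iter n f (X s))) (Q (iter n f (X t)))); lra.
Qed.

(** The point [iter n f x0] may be anywhere, so one rank must suit all traps. Points with a trap
    that works from rank [m] on form an open set increasing with [m]; these sets cover the surface,
    and compactness gives a single rank. It does not depend on [x0] or [V0], because the bound 2 on
    roots is common to all models. *)
Lemma uniform_contraction UU : open_cover UU ->
  exists n0 : nat, forall n, (n0 <= n)%N -> forall x0, exists2 U, UU U &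
    forall V0 Q0 X, model F G i x0 V0 Q0 -> leaf_path F X -> X 0 = x0 ->
      (forall t, unit_interval t -> V0 (X t)) ->
      forall t, unit_interval t -> U (iter n f (X t)).
Proof.
move=> [oUU cUU].
pose good m (y x : S) U V Q V' d := [/\ UU U, trap x V Q V' d, V `<=` U,
  (forall n, (m <= n)%N -> 8 * a^-1 ^+ n <= d) & V' y /\ `|Q y - Q x| < d].
pose O m := [set y | exists x U V Q V' d, good m y x U V Q V' d].
have oO m : open (O m).
  rewrite openE => y [x [U [V [Q [V' [d [UUU tr VU md [V'y Qy]]]]]]]].
  have [mo [oV' _] V'V _ _] := tr.
  have N1 : \forall u \near y, V' u by exact: open_nbhs_nbhs.
  have cQ : {for y, continuous (fun u => `|Q u - Q x|)}.
    apply: cvg_norm; apply: cvgB; last exact: cvg_cst.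
    by apply: (model_continuous mo); apply: V'V; exact: subset_closure.
  have N2 : \forall u \near y, `|Q u - Q x| < d by exact: (cvgr_lt _ cQ).
  apply: filterS2 N1 N2 => u V'u Qu.
  by exists x, U, V, Q, V', d; split.
have incO m n : (m <= n)%N -> O m `<=` O n.
  move=> mn y [x [U [V [Q [V' [d [UUU tr VU md Qy]]]]]]].
  exists x, U, V, Q, V', d; split=> // k nk; apply: md; exact: leq_trans nk.
have covO x : exists m, O m x.
  have [U UUU Ux] := cUU x.
  have [V [Q [V' [d [tr VU]]]]] : exists V Q V' d, trap x V Q V' d /\ V `<=` U.
    by apply: exists_trap; apply: open_nbhs_nbhs; split=> //; exact: oUU.
  have [_ [_ V'x] _ d0 _] := tr.
  have d8 : 0 < d / 8 by lra.
  have [m md] := small_power (exp_gt1 ex) d8.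
  exists m, x, U, V, Q, V', d; split=> //.
    by move=> n mn; have := md n mn; lra.
  by rewrite subrr normr0.
have [m Om] := increasing_open_cover (@surface_compact _ S) oO incO covO.
exists m => n mn x0.
have : O m (iter n f x0) by rewrite Om.
move=> [x [U [V [Q [V' [d [UUU tr VU md [V'y Qy]]]]]]]].
exists U => // V0 Q0 X m0 lX X0 V0X t ut.
have [_ _ V'V _ _] := tr.
apply: VU; apply: V'V; apply: subset_closure.
exact: (path_in_trap tr (md _ mn) V'y Qy m0 lX X0 V0X).
Qed.

Lemma leaf_path_contracted X : leaf_path F X -> contracted f X.
Proof.
move=> lX; split; first exact: lX.1.
move=> t ut.
have [V0 [Q0 [m0 _]]] := exp_model ex (filterT : nbhs (X t) setT).
have NV : \forall y \near X t, V0 y.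
  by apply: open_nbhs_nbhs; split; [exact: model_open m0|exact: model_mem m0].
have /nbhs_ballP[e /= e0 be] := within_near lX.1 ut NV.
exists (e / 2); first lra.
move=> UU cUU; have [n0 H] := uniform_contraction cUU.
exists n0 => n nn; have [U UUU HU] := H n nn (X t).
exists U => // s us st.
(* The segment from [t] to [s], in either direction, run as a path based at [X t]. Clamping [r] to
   [0, 1] makes [p] a continuous map of the whole line into the unit interval. *)
pose p (r : R) := t + Num.min 1 (Num.max 0 r) * (s - t).
have p01 (r : R) : 0 <= Num.min 1 (Num.max 0 r) <= 1.
  by rewrite ge_min lexx le_min ler01 le_max lexx.
have up r : unit_interval (p r).
  by move: ut us; rewrite /unit_interval /p /= => ut us; have := p01 r; nra.
have cp : continuous p.
  move=> r; apply: cvgD; first exact: cvg_cst.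
  apply: cvgM; last exact: cvg_cst.
  apply: continuous_min; first exact: cvg_cst.
  apply: continuous_max; [exact: cvg_cst|exact: cvg_id].
have p0 : p 0 = t by rewrite /p max_l // min_r ?ler01 // mul0r addr0.
have p1 : p 1 = s by rewrite /p max_r ?ler01 // min_l // mul1r addrC subrK.
rewrite -p1; apply: (HU V0 Q0 (X \o p) m0).
- by apply: leaf_path_reparam => // r _; exact: up.
- by rewrite /= p0.
- move=> r ur; apply: be; last exact: up.
  rewrite /ball /= /p opprD addNKr normrN normrM.
  have := p01 r; have := normr_ge0 (s - t) => h1 h2.
  rewrite ger0_norm; last by move: h2 => /andP[].
  nra.
- by rewrite /unit_interval /= ler01 lexx.
Qed.

(* A variation of the transverse coordinate of F would be multiplied by a^n,
   whereas that coordinate is bounded in every model. *)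
Lemma contracted_leaf_path X : contracted f X -> leaf_path F X.
Proof.
move=> [cX H]; split=> // t c ut Fc cx.
have ch := fcharts_chart Fc.
have Nc := chart_near ch cx.
have /nbhs_ballP[r /= r0 br] := within_near cX ut Nc.
have [e e0 He] := H t ut.
pose rho := Num.min e (r / 2).
have rho0 : 0 < rho by rewrite lt_min e0 /=; lra.
have rhoe : rho <= e by rewrite ge_min lexx.
have rhor : rho <= r / 2 by rewrite ge_min lexx orbT.
(* In the cover by all models, each late iterate of the window lies in one model, where roots are
   bounded by 2. *)
pose UU : set (set S) := [set V | exists x Q, model F G i x V Q].
have cUU : open_cover UU.
  split; first by move=> V [x [Q m]]; exact: model_open m.
  move=> x; have [V [Q [m _]]] := exp_model ex (filterT : nbhs x setT).
  by exists V; [exists x, Q|exact: model_mem m].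
have [n0 Hn] := He UU cUU.
pose J : set R := [set s | unit_interval s /\ `|s - t| <= rho].
have cJ : connected J.
  apply/connected_intervalP => u v [/andP[? ?] Hu] [/andP[? ?] Hv] w /andP[? ?].
  move: Hu Hv; rewrite !ler_norml => /andP[? ?] /andP[? ?].
  split; first by apply/andP; split; lra.
  by rewrite ler_norml; apply/andP; split; lra.
have Jt : J t by split=> //; rewrite subrr normr0 ltW.
have Jc s : J s -> cdom c (X s).
  by move=> [us st]; apply: br => //; rewrite /ball /= distrC; lra.
pose phi0 y := (cmap c y).2.
have tr0 s : J s -> transversal_at F phi0 (X s).
  by move=> Js; exact: transversal_of_chart (Jc s Js).
have bound n : (n0 <= n)%N -> forall s, J s ->
    a ^+ n * `|phi0 (X s) - phi0 (X t)| <= 4.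
  move=> nn s Js; have [V [x [Q m]] HV] := Hn n nn.
  pose phi y := a ^+ n * phi0 (iter n finv y).
  have [cfn _ fnK _] := iter_homeomorphism n (exp_homeo ex).
  have phiE u : phi (iter n f (X u)) = a ^+ n * phi0 (X u) by rewrite /phi fnK.
  have JV u : J u -> V ((iter n f \o X) u).
    by move=> [uu ut']; apply: HV => //; exact: le_trans rhoe.
  have Jtr u : J u -> transversal_at F phi ((iter n f \o X) u).
    move=> Ju; apply: scales_transversal_iter (tr0 u Ju).
      exact: exp_homeo ex.
    exact: exp_scales ex.
  have JQ u : J u -> Q ((iter n f \o X) u) <> 0.
    move=> Ju; apply: (model_neq0 m (JV u Ju)).
    exact: transversal_regular (Jtr u Ju).
  have cXJ : {within J, continuous (iter n f \o X)}.
    apply: within_continuous_comp; first by move=> y _; exact: cfn.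
    by apply: continuous_subspaceW cX => u [].
  have [z [b [bz _]]] := branch_along (model_branch m) cJ cXJ JV Jtr JQ.
  have [_ zt pt] := nbhs_singleton (bz t Jt).
  have [_ zs ps] := nbhs_singleton (bz s Js).
  have b1 := model_root_bound i m (JV t Jt) zt.
  have b2 := model_root_bound i m (JV s Js) zs.
  move: pt ps; rewrite /= !phiE => pt ps.
  have a0 : 0 <= a ^+ n by rewrite exprn_ge0 // ltW // exp_gt0.
  rewrite -[X in X * _](ger0_norm a0) -normrM mulrBr pt ps.
  move: b1 b2; rewrite /= !ler_norml => /andP[? ?] /andP[? ?].
  by apply/andP; split; lra.
have const s : J s -> phi0 (X s) = phi0 (X t).
  move=> Js; apply/eqP; rewrite -subr_eq0 -normr_eq0; apply/eqP.
  apply: contrapT => /eqP ne.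
  have D0 : 0 < `|phi0 (X s) - phi0 (X t)| by rewrite lt_def ne normr_ge0.
  set D := `|_| in D0 *.
  (* The bound 4 comes from two values of modulus at most 2; once [a^-1 ^+ k <= D / 8], the product
     [a ^+ k * D] is at least 8. *)
  have D8 : 0 < D / 8 by lra.
  have [m Hm] := small_power (exp_gt1 ex) D8.
  have := Hm (maxn m n0) (leq_maxl _ _); have := bound (maxn m n0) (leq_maxr _ _) s Js.
  rewrite -/D; set k := maxn m n0.
  have ak : 0 < a ^+ k by rewrite exprn_gt0 // exp_gt0.
  rewrite exprVn => H1; rewrite -[X in X <= _]mul1r ler_pdivrMr // => H2.
  nra.
have Nt : \forall s \near t, `|s - t| <= rho.
  by apply/nbhs_ballP; exists rho => //= s; rewrite /ball /= distrC => /ltW.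
by apply: filterS Nt => s st us; exact: const.
Qed.

End Fixed.
End Expanding.

(** * Existence of models at singular and at regular points *)

Section ModelExistence.
Variables (R : realType) (S : surface R).
Implicit Types (F G Fs Fu : measured_foliation S) (Q : S -> R * R).

Lemma continuous_cmul (T : topologicalType) (z w : T -> R * R) (x : T) :
  {for x, continuous z} -> {for x, continuous w} ->
  {for x, continuous (fun y => cmul (z y) (w y))}.
Proof.
move=> cz cw.
apply: (cvg_pair (F := nbhs x)
  (G := nbhs ((z x).1 * (w x).1 - (z x).2 * (w x).2))
  (H := nbhs ((z x).1 * (w x).2 + (z x).2 * (w x).1))).
  by apply: cvgB; apply: cvgM; first [exact: continuous_fst|exact: continuous_snd].
by apply: cvgD; apply: cvgM; first [exact: continuous_fst|exact: continuous_snd].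
Qed.

Lemma continuous_cpow (T : topologicalType) (z : T -> R * R) k (x : T) :
  {for x, continuous z} -> {for x, continuous (fun y => cpow (z y) k)}.
Proof.
move=> cz; elim: k => [|k IH]; first exact: cvg_cst.
exact: continuous_cmul.
Qed.

Lemma nsq_cpow (z : R * R) k : nsq (cpow z k) = nsq z ^+ k.
Proof.
elim: k => [|k IH]; first by rewrite /nsq /= expr0n expr1n addr0.
by rewrite /cpow iterS nsq_cmul -/(cpow z k) IH exprS.
Qed.

Lemma continuous_nsq (T : topologicalType) (z : T -> R * R) (x : T) :
  {for x, continuous z} -> {for x, continuous (fun y => nsq (z y))}.
Proof.
move=> cz.
have p1 : {for x, continuous (fun y => (z y).1)}.
  exact: continuous_fst.
have p2 : {for x, continuous (fun y => (z y).2)}.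
  exact: continuous_snd.
have -> : (fun y => nsq (z y)) =
    (fun y => (z y).1 * (z y).1 + (z y).2 * (z y).2).
  by apply/funext => y; rewrite /nsq !expr2.
by apply: cvgD; apply: cvgM.
Qed.

Lemma model_sym F G i x V Q : fsing F = fsing G ->
  model F G i x V Q -> model G F (~~ i) x V Q.
Proof.
move=> FG [m1 m2 m3 m4 m5 m6 m7 m8 m9 m10]; split=> //.
- by rewrite -FG.
- by rewrite -FG.
- by rewrite negbK.
Qed.

Lemma prong_model Fs Fu k c x O : fsing Fs = fsing Fu -> (0 < k)%N ->
  prong_chart (fsing Fs) (fcharts Fs) snd k x c ->
  prong_chart (fsing Fs) (fcharts Fu) fst k x c -> nbhs x O ->
  exists V, model Fs Fu false x V (fun y => cpow (cmap c y) k) /\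
    V `<=` O `&` cdom c.
Proof.
move=> FsFu k1 [ch cs cx brs] [_ _ _ bru] Ox.
have [sx cdx] : fsing Fs x /\ cdom c x.
  by have : (cdom c `&` fsing Fs) x; [rewrite cs|case].
pose Q y := cpow (cmap c y) k.
have cQ y : cdom c y -> {for y, continuous Q}.
  by move=> cy; apply: continuous_cpow; exact: chart_continuous.
have Qx : Q x = 0.
  apply: nsq_eq0; rewrite nsq_cpow cx.
  by rewrite (_ : (0, 0) = 0 :> R * R) // nsq0 expr0n (gtn_eqF k1).
have Q0 y : cdom c y -> Q y = 0 -> y = x.
  move=> cy Qy.
  have : nsq (Q y) = 0 by rewrite Qy nsq0.
  rewrite nsq_cpow => /eqP; rewrite expf_eq0 => /andP[_ /eqP/nsq_eq0 E].
  have [_ _ ci _ _] := ch.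
  by rewrite -(ci y cy) E -(ci x cdx) cx.
have sing_x y : cdom c y -> fsing Fs y -> y = x.
  by move=> cy sy; have : (cdom c `&` fsing Fs) y by []; rewrite cs.
pose V := cdom c `&` O^° `&` [set y | cdom c y /\ nsq (Q y) < 1].
exists V; split; last by move=> y [[cy /interior_subset]].
split.
- rewrite openE => y [[cy Oy] [_ Qy]].
  have N1 := chart_near ch cy.
  have N2 : \forall u \near y, O^° u by apply: open_nbhs_nbhs; split=> //; exact: open_interior.
  have N3 : \forall u \near y, nsq (Q u) < 1.
    exact: (cvgr_lt _ (continuous_nsq (cQ y cy))).
  by apply: filterS3 N1 N2 N3.
- by split; [split|split=> //; rewrite Qx nsq0].
- by move=> y [[cy _] _]; exact: cQ.
- by move=> y [[cy _] _] E; apply: Q0 => //; rewrite -Qx.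
- by move=> y [[cy _] _]; exact: sing_x.
- by move=> y [[cy _] _] ny Qy; apply: ny; rewrite (Q0 y).
- by move=> d y Fd [[cy _] _] dy; exact: (brs d y).
- by move=> d y Fd [[cy _] _] dy; exact: (bru d y).
- by move=> y [_ [_ H]]; apply: le_trans (ltW H) _; rewrite ler1n.
- by left.
Qed.

Lemma singular_model Fs Fu x O : transverse Fs Fu -> fsing Fs x -> nbhs x O ->
  exists V Q, model Fs Fu false x V Q /\ V `<=` O.
Proof.
move=> [FsFu _ prong] sx Ox; have [k [c [k1 _ ps pu]]] := prong x sx.
have [V [m VO]] := prong_model FsFu k1 ps pu Ox.
by exists V, (fun y => cpow (cmap c y) k); split=> // y /VO[].
Qed.

(** On all of [V], [w] is itself a branch of the root of its square for the coordinate of [c]; a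
    chart transition only changes the sign and the constant. *)
Lemma shifted_branch F i (V : set S) (w : S -> R * R) c :
  fcharts F c -> (forall y, V y -> cdom c y) ->
  (forall y, V y -> {for y, continuous w}) -> open V ->
  (exists b0, forall y, (cmap c y).2 = proj i (w y) + b0) ->
  branched F (proj i) V (fun y => cmul (w y) (w y)).
Proof.
move=> Fc Vc cw oV [b0 cE] d y Fd Vy dy.
have bw : branch_at (fun y => cmul (w y) (w y)) (proj i) (fun y => (cmap c y).2) y w b0.
  have NV : \forall u \near y, V u by exact: open_nbhs_nbhs.
  by apply: filterS NV => u Vu; split=> //; exact: cw.
have [e [b dE]] := fcharts_transition Fc Fd (Vc y Vy) dy.
by have [z [b' [H _]]] := branch_opp bw dE; exists z, b'.
Qed.

Lemma regular_model Fs Fu x O : transverse Fs Fu -> ~ fsing Fs x -> nbhs x O ->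
  exists V Q, model Fs Fu false x V Q /\ V `<=` O.
Proof.
move=> [FsFu tr _] rx Ox.
have [c Fc cx] := regular_chart rx.
have [d Gd dx] : exists2 d, fcharts Fu d & cdom d x.
  by apply: regular_chart; rewrite -FsFu.
have [e [ch ex ecd eE]] := tr c d x Fc Gd cx dx.
(* Both components are 1/2 at [x], and [V] keeps them in ]0, 1[: this excludes [w y = - w x], so
   that squaring stays injective, and it bounds [Q]. *)
pose w y : R * R := ((cmap d y).2 - (cmap d x).2 + 2^-1, (cmap c y).2 - (cmap c x).2 + 2^-1).
have cw y : cdom e y -> {for y, continuous w}.
  move=> ey; have [cy dy] := ecd _ ey.
  apply: (cvg_pair (F := nbhs y)
    (G := nbhs ((cmap d y).2 - (cmap d x).2 + 2^-1))
    (H := nbhs ((cmap c y).2 - (cmap c x).2 + 2^-1))).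
    apply: cvgD; last exact: cvg_cst.
    apply: cvgB; last exact: cvg_cst.
    apply: continuous_snd.
    exact: chart_continuous (fcharts_chart Gd) dy.
  apply: cvgD; last exact: cvg_cst.
  apply: cvgB; last exact: cvg_cst.
  apply: continuous_snd.
  exact: chart_continuous (fcharts_chart Fc) cy.
pose V := [set y | cdom e y /\ O^° y /\ (0 < (w y).1 < 1 /\ 0 < (w y).2 < 1)].
have oV : open V.
  rewrite openE => y [ey [Oy [/andP[w1 w2] /andP[w3 w4]]]].
  have N1 := chart_near ch ey.
  have N2 : \forall u \near y, O^° u by apply: open_nbhs_nbhs; split=> //; exact: open_interior.
  have c1 : {for y, continuous (fun u => (w u).1)}.
    exact: continuous_fst (cw _ ey).
  have c2 : {for y, continuous (fun u => (w u).2)}.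
    exact: continuous_snd (cw _ ey).
  near=> u; split; [by near: u|split; [by near: u|]].
  by split; apply/andP; split; near: u;
    first [exact: (cvgr_gt _ c1)|exact: (cvgr_lt _ c1)
          |exact: (cvgr_gt _ c2)|exact: (cvgr_lt _ c2)].
have roots y z : V y -> cmul z z = cmul (w y) (w y) -> z = w y \/ z = - w y.
  by move=> _; exact: cmul_sq_eq.
exists V, (fun y => cmul (w y) (w y)); split; last by move=> y [_ [/interior_subset]].
have cwV y : V y -> {for y, continuous w} by move=> [ey _]; exact: cw.
split=> //.
- split=> //; split; last by rewrite /w /= !subrr !add0r; lra.
  exact: Ox.
- by move=> y Vy; apply: continuous_cmul; exact: cwV.
- move=> y [ey [_ [w1 w2]]] /cmul_sq_eq E.
  have [_ _ ci _ _] := ch.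
  suff E' : w y = w x.
    rewrite -(ci y ey) -(ci x ex) !eE //; case: E' => E1 E2.
    by congr (cinv e (_, _)); lra.
  case: E => // E'; have E1 : (w y).1 = - (w x).1 by rewrite E'.
  by exfalso; move: w1 E1; rewrite /w /=; clear => /andP[? ?] ?; lra.
- move=> y [ey _] sy; have [cy _] := ecd _ ey.
  by have := transversal_regular (transversal_of_chart Fc cy).
- move=> y [ey [_ [/andP[w1 _] _]]] _ E.
  have := cmul_sq_eq (etrans E (_ : 0 = cmul 0 0)) => H.
  have wy : w y = 0.
    by case: H; rewrite ?oppr0 // /cmul /= mulr0 subr0 addr0.
  by move: w1; rewrite wy ltxx.
- apply: (shifted_branch Fc) => //; first by move=> y [/ecd[]].
  by exists ((cmap c x).2 - 2^-1) => y; rewrite /= /w /=; ring.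
- apply: (shifted_branch Gd) => //; first by move=> y [/ecd[]].
  by exists ((cmap d x).2 - 2^-1) => y; rewrite /= /w /=; ring.
- move=> y [_ [_ [/andP[w1 w1'] /andP[w2 w2']]]].
  have H : nsq (w y) <= 2 by move: w1 w1' w2 w2'; rewrite /nsq; clear; nra.
  have H0 := nsq_ge0 (w y).
  by rewrite nsq_cmul; move: H H0; clear; nra.
- right=> y z j [_ [_ [/andP[w1 _] /andP[w2 _]]]] zz.
  have pj : 0 < proj j (w y) by case: j.
  by case/cmul_sq_eq: zz => ->; apply/eqP; rewrite ?projN ?oppr_eq0 gt_eqF.
Unshelve. all: by end_near. Qed.

Lemma transverse_model Fs Fu x O : transverse Fs Fu -> nbhs x O ->
  exists V Q, model Fs Fu false x V Q /\ V `<=` O.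
Proof.
move=> tr; have [sx|nsx] := pselect (fsing Fs x).
  exact: singular_model.
exact: regular_model.
Qed.

End ModelExistence.

(** * Leaves under a conjugacy *)

Section PseudoAnosov.
Variables (R : realType) (S : surface R) (f : pseudo_anosov S).

Lemma stretch_gt0 : 0 < stretch f. Proof. exact: lt_trans (stretch_gt1 f). Qed.

Lemma stable_expanding finv : homeomorphism f finv ->
  expanding f finv (stable f) (unstable f) false (stretch f).
Proof.
move=> hf; have tr := foliations_transverse f; split=> //.
- exact: stretch_gt1.
- exact: stable_scaled.
- exact: unstable_scaled.
- by case: tr.
- by move=> x O; exact: transverse_model.
Qed.

(** The abstract situation is met again by [finv], with the foliations exchanged and hence the other
    component; inverting [unstable_scaled] gives the same factor [stretch f]. *)
Lemma unstable_expanding finv : homeomorphism f finv ->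
  expanding finv f (unstable f) (stable f) true (stretch f).
Proof.
move=> hf; have tr := foliations_transverse f.
have l0 : stretch f != 0 by rewrite gt_eqF // stretch_gt0.
have FG : fsing (stable f) = fsing (unstable f) by case: tr.
split=> //.
- exact: homeomorphism_sym.
- exact: stretch_gt1.
- rewrite -[X in scales _ _ X]invrK; apply: scales_inv hf _ (unstable_scaled f).
  by rewrite invr_eq0.
- exact: scales_inv hf l0 (stable_scaled f).
- move=> x O Ox; have [V [Q [m VO]]] := transverse_model tr Ox.
  by exists V, Q; split=> //; exact: model_sym m.
Qed.

End PseudoAnosov.

(** A cover of the target is pulled back by [h], which intertwines the iterates. *)
Lemma contracted_conj (R : realType) (Sf Sg : surface R) (f : Sf -> Sf)
    (g : Sg -> Sg) (h : Sf -> Sg) hinv X :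
  homeomorphism h hinv -> (forall x, g (h x) = h (f x)) ->
  contracted f X -> contracted g (h \o X).
Proof.
move=> [ch chi hK hiK] gh [cX H]; split.
  by apply: within_continuous_comp => // y _; exact: ch.
move=> t ut; have [e e0 He] := H t ut; exists e => // UU [oUU cUU].
have [n0 Hn] : exists n0 : nat, forall n, (n0 <= n)%N ->
    exists2 U, [set h @^-1` U | U in UU] U &
      forall s, unit_interval s -> `|s - t| <= e -> U (iter n f (X s)).
  apply: He; split.
    by move=> _ [U UUU <-]; apply: open_comp => [y _|]; [exact: ch|exact: oUU].
  by move=> x; have [U UUU Ux] := cUU (h x); exists (h @^-1` U) => //; exists U.
exists n0 => n nn; have [_ [U UUU <-] HU] := Hn n nn; exists U => // s us st.
have -> : iter n g ((h \o X) s) = h (iter n f (X s)).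
  by elim: n {nn HU} => //= n ->; rewrite gh.
exact: HU.
Qed.

Section ConjugateLeaves.
Variables (R : realType) (Sf Sg : surface R).
Variables (f : pseudo_anosov Sf) (g : pseudo_anosov Sg).
Variables (h : Sf -> Sg) (hinv : Sg -> Sf).
Hypothesis h_homeo : homeomorphism h hinv.
Hypothesis h_comm : forall x, g (h x) = h (f x).

Lemma conj_stable_path X :
  leaf_path (stable f) X -> leaf_path (stable g) (h \o X).
Proof.
have [finv hf] := pmap_homeomorphism f; have [ginv hg] := pmap_homeomorphism g.
move=> lX; apply: (contracted_leaf_path (stable_expanding hg)).
apply: contracted_conj h_homeo h_comm _.
exact: (leaf_path_contracted (stable_expanding hf)).
Qed.

Lemma conj_unstable_path X :
  leaf_path (unstable f) X -> leaf_path (unstable g) (h \o X).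
Proof.
have [finv hf] := pmap_homeomorphism f; have [ginv hg] := pmap_homeomorphism g.
move=> lX; apply: (contracted_leaf_path (unstable_expanding hg)).
have comm x : ginv (h x) = h (finv x).
  have [_ _ _ fiK] := hf; have [_ _ gK _] := hg.
  by rewrite -{1}(fiK x) -h_comm gK.
apply: contracted_conj h_homeo comm _.
exact: (leaf_path_contracted (unstable_expanding hf)).
Qed.

End ConjugateLeaves.

(** * Topological characterization of the singularities *)

Section Stars.
Variables (R : realType) (S : surface R).
Implicit Types (F G Fs Fu : measured_foliation S) (Q : S -> R * R).

(** Half the difference of the angles lies in ]0, pi[, where the sine is positive, whereas a double
    angle of cosine 1 makes that sine vanish. *)
Lemma unit_circle_inj (s t : R) : s < t -> t < s + 2 * pi ->
  cos s = cos t -> sin s = sin t -> False.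
Proof.
move=> st ts Ec Es.
have c1 : cos (t - s) = 1 by rewrite cosB Ec Es -!expr2 cos2Dsin2.
pose d := (t - s) / 2.
have d0 : 0 < d < pi by rewrite /d; lra.
have : cos (d *+ 2) = 1 by rewrite -c1; congr cos; rewrite mulr2n /d; lra.
rewrite cos_mulr2n => H.
have := cos2Dsin2 d; have := sin_gt0_pi d0 => H1 H2.
have : sin d ^+ 2 = 0 by lra.
by move/eqP; rewrite sqrf_eq0 gt_eqF.
Qed.

Definition polar (r t : R) : R * R := (r * cos t, r * sin t).

Lemma cpow_polar r t k : cpow (polar r t) k = polar (r ^+ k) (t *+ k).
Proof.
elim: k => [|k IH]; first by rewrite /polar /= mul1r mulr0n cos0 sin0 mulr0.
rewrite /cpow iterS -/(cpow _ k) IH /polar /cmul /=.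
by rewrite exprS mulrS cosD sinD; congr pair; ring.
Qed.

Lemma nsq_polar r t : nsq (polar r t) = r ^+ 2.
Proof.
by rewrite /nsq /polar /= !exprMn -mulrDr cos2Dsin2 mulr1.
Qed.

(* A regular point carries 2-stars but no 3-star, a spine no 2-star, a k-prong
   with k >= 3 a 3-star: stars detect the singularities. *)
Definition star F (m : nat) (x : S) := exists gamma : nat -> R -> S,
  (forall j, (j < m)%N -> [/\ leaf_path F (gamma j), gamma j 0 = x
     & forall t, 0 < t <= 1 -> gamma j t <> x]) /\
  (forall j k s t, (j < m)%N -> (k < m)%N -> j <> k -> 0 < s <= 1 ->
     0 < t <= 1 -> gamma j s <> gamma k t).

(** Two paths issuing from the end of a half-line must meet: both reach the smaller of the two final
    values. As this value is positive, the meeting times are positive. *)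
Lemma crossing (u v : R -> R) (a b : R) : 0 <= a -> 0 <= b ->
  {within `[0, a], continuous u} -> {within `[0, b], continuous v} ->
  u 0 = 0 -> v 0 = 0 -> 0 < u a -> 0 < v b ->
  exists s t, [/\ 0 < s <= a, 0 < t <= b & u s = v t].
Proof.
move=> a0 b0 cu cv u0 v0 ua vb.
pose m := Num.min (u a) (v b).
have m0 : 0 < m by rewrite lt_min ua.
have mu : m <= u a by rewrite ge_min lexx.
have mv : m <= v b by rewrite ge_min lexx orbT.
have key (w : R -> R) c : 0 <= c -> {within `[0, c], continuous w} -> w 0 = 0 ->
    m <= w c -> exists2 s, 0 < s <= c & w s = m.
  move=> c0 cw w0 mw; have [|s] := @IVT R w 0 c m c0 cw.
    by rewrite w0 ge_min le_max mw (ltW m0) orbT.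
  rewrite in_itv /= => /andP[s0 sc] ws; exists s => //.
  rewrite sc andbT lt_neqAle s0 andbT; apply/eqP => E.
  by move: m0; rewrite -ws -E w0 ltxx.
have [s sa us] := key u a a0 cu u0 mu; have [t tb vt] := key v b b0 cv v0 mv.
by exists s, t; split=> //; rewrite us vt.
Qed.

Lemma path_initial_segment F X (V : set S) : leaf_path F X ->
  (\forall y \near X 0, V y) ->
  exists2 e, 0 < e <= 1 & forall t, 0 <= t <= e -> V (X t).
Proof.
move=> lX NV; have u0 : @unit_interval R 0 by rewrite /unit_interval /= lexx ler01.
have /nbhs_ballP[r /= r0 br] := within_near lX.1 u0 NV.
have m0 : 0 < Num.min 1 (r / 2) by rewrite lt_min ltr01 /=; lra.
have m1 : Num.min 1 (r / 2) <= 1 by rewrite ge_min lexx.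
have m2 : Num.min 1 (r / 2) <= r / 2 by rewrite ge_min lexx orbT.
exists (Num.min 1 (r / 2)); first by rewrite m0.
move=> t tb; apply: br; last by rewrite /unit_interval /=; lra.
by rewrite /ball /= sub0r normrN ger0_norm; lra.
Qed.

Lemma path_coordinate_continuous F X (V : set S) (u : S -> R) e :
  leaf_path F X -> e <= 1 -> (forall t, 0 <= t <= e -> V (X t)) ->
  (forall y, V y -> {for y, continuous u}) -> {within `[0, e], continuous (u \o X)}.
Proof.
move=> lX e1 VX cu; apply: within_continuous_comp.
  move=> y /set_mem [t]; rewrite /= in_itv /= => tb <-; apply: cu; exact: VX.
apply: continuous_subspaceW lX.1 => t; rewrite /= in_itv /= => tb.
by rewrite /unit_interval /=; lra.
Qed.

(** The arms are the two horizontal half-segments from [x] in a chart straightening both foliations;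
    the parity of the index selects the side. *)
Lemma regular_star2 Fs Fu x : transverse Fs Fu -> ~ fsing Fs x -> star Fs 2 x.
Proof.
move=> [FsFu tr _] rx.
have [c Fc cx] := regular_chart rx.
have [d Gd dx] : exists2 d, fcharts Fu d & cdom d x.
  by apply: regular_chart; rewrite -FsFu.
have [e [ch ex ecd eE]] := tr c d x Fc Gd cx dx.
have [_ _ ci _ _] := ch.
pose p (sg : R) (t : R) : R * R := cmap e x + (sg * t, 0).
have p0 sg : p sg 0 = cmap e x.
  by rewrite /p mulr0; apply: injective_projections; rewrite /= addr0.
have cp sg : continuous (p sg).
  move=> t; apply: (@cvgD _ (R * R)%type _ _ _ (fun=> _) (fun t => (sg * t, 0))).
    exact: cvg_cst.
  apply: (cvg_pair (G := nbhs (sg * t)) (H := nbhs (0:R))); last exact: cvg_cst.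
  by apply: cvgM; [exact: cvg_cst|exact: cvg_id].
have := chart_image_near ch ex.
rewrite -(p0 1) => N1'; have N1 := continuous_near (cp 1 0) N1'.
have := chart_image_near ch ex.
rewrite -(p0 (-1)) => N2'; have N2 := continuous_near (cp (-1) 0) N2'.
pose good v t := cdom e (cinv e (p v t)) /\ cmap e (cinv e (p v t)) = p v t.
have N12 : \forall t \near (0:R), good 1 t /\ good (-1) t.
  by apply: filterS2 N1 N2.
have /nbhs_ballP[r /= r0 br] := N12.
have brt (b : bool) t : 0 <= t <= 1 ->
    cdom e (cinv e (p ((-1) ^+ b) (r / 2 * t))) /\
    cmap e (cinv e (p ((-1) ^+ b) (r / 2 * t))) = p ((-1) ^+ b) (r / 2 * t).
  move=> t01; have : ball (0:R) r (r / 2 * t).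
    by rewrite /ball /= sub0r normrN ger0_norm; nra.
  by move=> /br[]; case: b; rewrite ?expr0 ?expr1.
pose gam (j : nat) t := cinv e (p ((-1) ^+ odd j) (r / 2 * t)).
exists gam; split.
  move=> j _.
  have cg : {within @unit_interval R, continuous (gam j)}.
    apply/subspace_continuousP => s us; apply: cvg_within_filter.
    have cm : {for s, continuous (fun u : R => r / 2 * u)}.
      by apply: cvgM; [exact: cvg_cst|exact: cvg_id].
    have cpm : {for s, continuous (p ((-1) ^+ odd j) \o (fun u : R => r / 2 * u))}.
      apply: continuous_comp => //; exact: cp.
    apply: (@continuous_comp _ _ _ (p ((-1) ^+ odd j) \o (fun u : R => r / 2 * u)) (cinv e)) => //.
    have [H1' H2'] := brt (odd j) s us.
    have := chart_inv_continuous ch H1'.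
    by rewrite H2'.
  split.
  - split.
      exact: cg.
    move=> t d' ut Fd' d't.
    have [H1 H2] := brt (odd j) t ut.
    have [ct _] := ecd _ H1.
    have [e' [b' E]] := fcharts_transition Fc Fd' ct d't.
    have E2 s : unit_interval s -> (cmap c (gam j s)).2 = (cmap e x).2.
      move=> us; have [H1' H2'] := brt (odd j) s us.
      have := eE _ H1'; rewrite H2' => /(congr1 snd) /= <-.
      by rewrite addr0.
    have := within_near cg ut E; apply: filterS => s Hs us.
    by rewrite Hs // (nbhs_singleton E) !E2.
  - by rewrite /gam mulr0 p0 ci.
  - move=> t t01 E.
    have [|_ H2] := brt (odd j) t; first by lra.
    have := congr1 fst H2; rewrite -/(gam j t) E /= => /eqP.
    rewrite -subr_eq0 opprD addNKr oppr_eq0 mulf_eq0 signr_eq0 /= gt_eqF //.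
    by nra.
move=> j k s t j2 k2 jk s01 t01 E.
have [|_ Hs] := brt (odd j) s; first lra.
have [|_ Ht] := brt (odd k) t; first lra.
have : (p ((-1) ^+ odd j) (r / 2 * s)).1 = (p ((-1) ^+ odd k) (r / 2 * t)).1.
  by rewrite -Hs -Ht -/(gam j s) E.
rewrite /= => /addrI; clear - jk j2 k2 s01 t01 r0.
case: j k j2 k2 jk => [|[|//]] [|[|//]] // _ _ _; rewrite /= ?expr0 ?expr1 => H; nra.
Qed.

(** Near [x] each arm stays on the horizontal line through [x] and reaches a nonzero abscissa [u].
    Two of the three signs agree, and the corresponding arms meet by [crossing]. *)
Lemma regular_no_star3 Fs Fu x : transverse Fs Fu -> ~ fsing Fs x -> ~ star Fs 3 x.
Proof.
move=> [FsFu tr _] rx [gam [gP gdis]].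
have [c Fc cx] := regular_chart rx.
have [d Gd dx] : exists2 d, fcharts Fu d & cdom d x.
  by apply: regular_chart; rewrite -FsFu.
have [e [ch ex ecd eE]] := tr c d x Fc Gd cx dx.
have [_ _ ci _ _] := ch.
pose u y := (cmap d y).2 - (cmap d x).2.
have cu y : cdom e y -> {for y, continuous u}.
  move=> /ecd[_ dy]; apply: cvgB; last exact: cvg_cst.
  apply: continuous_snd.
  exact: chart_continuous (fcharts_chart Gd) dy.
have ux : u x = 0 by rewrite /u subrr.
have H j : (j < 3)%N -> exists a, [/\ 0 < a <= 1,
    forall t, 0 <= t <= a -> cdom e (gam j t) /\ (cmap c (gam j t)).2 = (cmap c x).2
    & u (gam j a) != 0].
  move=> j3; have [lg g0 gx] := gP j j3.
  have Ne : \forall y \near gam j 0, cdom e y by rewrite g0; exact: chart_near.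
  have [a a01 Ha] := path_initial_segment lg Ne.
  have cs t : 0 <= t <= a -> (cmap c (gam j t)).2 = (cmap c x).2.
    move=> ta; rewrite -g0.
    apply: (@locally_constant_connected _ _ `[0, a]%classic
      (fun t => (cmap c (gam j t)).2)); rewrite /= ?in_itv /= //.
    - exact: segment_connected.
    - move=> s; rewrite in_itv /= => sa.
      have us : unit_interval s by rewrite /unit_interval /=; lra.
      have [cs _] := ecd _ (Ha s sa).
      apply: filterS (lg.2 s c us Fc cs) => w + wa; apply.
      by move: wa; rewrite in_itv /unit_interval /=; lra.
    - lra.
  exists a; split=> //; first by move=> t ta; split; [exact: Ha|exact: cs].
  apply/eqP => ua; apply: (gx a) => //.
  have ea : cdom e (gam j a) by apply: Ha; lra.
  rewrite -(ci _ ea) -(ci _ ex) !eE // cs; last lra.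
  by congr (cinv e (_, _)); move: ua; rewrite /u => /eqP; rewrite subr_eq0 => /eqP.
have cross j k : (j < 3)%N -> (k < 3)%N -> j <> k ->
    forall a b (sg : R), sg != 0 -> 0 < a <= 1 -> 0 < b <= 1 ->
    (forall t, 0 <= t <= a -> cdom e (gam j t) /\ (cmap c (gam j t)).2 = (cmap c x).2) ->
    (forall t, 0 <= t <= b -> cdom e (gam k t) /\ (cmap c (gam k t)).2 = (cmap c x).2) ->
    0 < sg * u (gam j a) -> 0 < sg * u (gam k b) -> False.
  move=> j3 k3 jk a b sg sg0 a01 b01 ja kb ua ub.
  have [lj j0 _] := gP j j3; have [lk k0 _] := gP k k3.
  have csu y : cdom e y -> {for y, continuous (fun y => sg * u y)}.
    by move=> ey; apply: cvgM; [exact: cvg_cst|exact: cu].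
  have cj := path_coordinate_continuous lj (proj2 (andP a01)) (fun t ta => (ja t ta).1) csu.
  have ck := path_coordinate_continuous lk (proj2 (andP b01)) (fun t tb => (kb t tb).1) csu.
  have zj : ((fun y => sg * u y) \o gam j) 0 = 0 by rewrite /= j0 ux mulr0.
  have zk : ((fun y => sg * u y) \o gam k) 0 = 0 by rewrite /= k0 ux mulr0.
  have a0 : 0 <= a by lra.
  have b0 : 0 <= b by lra.
  have [s [t [sa tb st]]] := crossing a0 b0 cj ck zj zk ua ub.
  have s1 : 0 < s <= 1 by lra.
  have t1 : 0 < t <= 1 by lra.
  have [|e1 c1] := ja s; first lra.
  have [|e2 c2] := kb t; first lra.
  apply: (gdis j k s t) => //.
  rewrite -(ci _ e1) -(ci _ e2) !eE // c1 c2; congr (cinv e (_, _)).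
  by move: st => /= /(mulfI sg0) /addIr.
have [a [a01 aP ua]] := H 0%N isT.
have [b [b01 bP ub]] := H 1%N isT.
have [f [f01 fP uf]] := H 2%N isT.
have n1 : (-1 : R) != 0 by rewrite oppr_eq0 oner_eq0.
have n0 : (1 : R) != 0 by rewrite oner_eq0.
have X01 := cross 0%N 1%N isT isT (fun E => ltac:(discriminate E)) a b.
have X02 := cross 0%N 2%N isT isT (fun E => ltac:(discriminate E)) a f.
have X12 := cross 1%N 2%N isT isT (fun E => ltac:(discriminate E)) b f.
have {}X01 sg s0 := X01 sg s0 a01 b01 aP bP.
have {}X02 sg s0 := X02 sg s0 a01 f01 aP fP.
have {}X12 sg s0 := X12 sg s0 b01 f01 bP fP.
have Y01 := X01 1 n0; have Z01 := X01 (-1) n1.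
have Y02 := X02 1 n0; have Z02 := X02 (-1) n1.
have Y12 := X12 1 n0; have Z12 := X12 (-1) n1.
move: Y01 Z01 Y02 Z02 Y12 Z12; rewrite !mul1r !mulN1r !oppr_gt0.
move: ua ub uf; rewrite !neq_lt.
by move=> /orP[] ? /orP[] ? /orP[] ?; auto.
Qed.
Lemma cpow1 (z : R * R) : cpow z 1 = z.
Proof. by case: z => a b; rewrite /cpow /= /cmul /=; congr pair; ring. Qed.

(** For a spine [Q] is the coordinate of the chart. Along a stable path from [x] the root has zero
    second component, so its square is on the positive real axis: there is a single ray, on which
    [crossing] makes two arms meet. *)
Lemma spine_no_star2 Fs Fu x c : fsing Fs = fsing Fu ->
  prong_chart (fsing Fs) (fcharts Fs) snd 1 x c ->
  prong_chart (fsing Fs) (fcharts Fu) fst 1 x c -> ~ star Fs 2 x.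
Proof.
move=> FsFu ps pu [gam [gP gdis]].
have [V [m Vc]] := @prong_model R S Fs Fu 1%N c x setT FsFu isT ps pu filterT.
have [ch _ cx0 _] := ps.
have [_ _ ci _ _] := ch.
have NV y : y = x -> \forall u \near y, V u.
  by move=> ->; apply: open_nbhs_nbhs; split; [exact: model_open m|exact: model_mem m].
have H j : (j < 2)%N -> exists a, [/\ 0 < a <= 1, forall t, 0 <= t <= a -> V (gam j t)
    & forall t, 0 < t <= a -> 0 < (cmap c (gam j t)).1 /\ (cmap c (gam j t)).2 = 0].
  move=> j2; have [lg g0 gx] := gP j j2.
  have [a a01 Ha] := path_initial_segment lg (NV _ g0).
  exists a; split=> // t ta.
  have Vr s : 0 < s <= a -> V (gam j s) /\ ~ fsing Fs (gam j s).
    move=> sa; split; first by apply: Ha; lra.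
    move=> sg; apply: (gx s); first lra.
    by apply: (model_sing m) sg; apply: Ha; lra.
  have Q0 : cpow (cmap c x) 1 = 0 by rewrite cpow1 cx0.
  have zero := leaf_path_from_zero m lg (lexx 0) (proj2 (andP a01)) g0 Q0 Vr.
  have [Vt rt] := Vr t ta.
  have [d Fd dt] := regular_chart rt.
  have [z [b bz]] := model_branch m Fd Vt dt.
  have [_ zz _] := nbhs_singleton bz.
  have z2 := zero t _ ta zz.
  have n0 := model_neq0 m Vt rt.
  move: zz n0 z2; rewrite cpow1 => <- n0 /= z2.
  rewrite /cmul /= z2 !mulr0 !mul0r subr0 addr0; split=> //.
  rewrite -expr2 exprn_even_gt0 //=; apply/eqP => z1; apply: n0.
  by rewrite /cmul /= z1 z2 !mulr0 subr0 addr0.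
have [a [a01 aV aP]] := H 0%N isT.
have [b [b01 bV bP]] := H 1%N isT.
have [l0 g0 _] := gP 0%N isT; have [l1 g1 _] := gP 1%N isT.
pose u y := (cmap c y).1.
have cu y : V y -> {for y, continuous u}.
  move=> /Vc[_ cy]; apply: continuous_fst.
  exact: chart_continuous.
have c0 := path_coordinate_continuous l0 (proj2 (andP a01)) aV cu.
have c1 := path_coordinate_continuous l1 (proj2 (andP b01)) bV cu.
have u0 : (u \o gam 0%N) 0 = 0 by rewrite /u /= g0 cx0.
have u1 : (u \o gam 1%N) 0 = 0 by rewrite /u /= g1 cx0.
have a0 : 0 <= a by lra.
have b0 : 0 <= b by lra.
have ua : 0 < (u \o gam 0%N) a by apply: (aP a _).1; lra.
have ub : 0 < (u \o gam 1%N) b by apply: (bP b _).1; lra.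
have [s [t [sa tb st]]] := crossing a0 b0 c0 c1 u0 u1 ua ub.
have s01 : 0 < s <= 1 by lra.
have t01 : 0 < t <= 1 by lra.
have [_ cs] : V (gam 0%N s) /\ cdom c (gam 0%N s).
  have Vs : V (gam 0%N s) by apply: aV; lra.
  by split=> //; have [] := Vc _ Vs.
have [_ ct] : V (gam 1%N t) /\ cdom c (gam 1%N t).
  have Vt : V (gam 1%N t) by apply: bV; lra.
  by split=> //; have [] := Vc _ Vt.
apply: (gdis 0%N 1%N s t) => //.
rewrite -(ci _ cs) -(ci _ ct); congr (cinv c _).
by apply: injective_projections; [exact: st|rewrite (aP s sa).2 (bP t tb).2].
Qed.

(** The arms are three of the [k] rays, at angles [2 * pi * j / k], distinct because [k >= 3]. On
    them the [k]-th power is a positive real number, so its square roots are real and the transverse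
    coordinate is constant. *)
Lemma prong_star3 Fs k x c : (3 <= k)%N ->
  prong_chart (fsing Fs) (fcharts Fs) snd k x c -> star Fs 3 x.
Proof.
move=> k3 [ch cs cx brs].
have [_ _ ci _ _] := ch.
have [sx cdx] : fsing Fs x /\ cdom c x.
  by have : (cdom c `&` fsing Fs) x; [rewrite cs|case].
have k0 : (0 < k)%N by exact: leq_trans k3.
have k0R : 0 < k%:R :> R by rewrite ltr0n.
have N1 := chart_image_near ch cdx.
have /nbhs_ballP[r /= r0 br] := N1.
pose ang (j : nat) : R := 2 * pi * j%:R / k%:R.
pose q j (t : R) : R * R := polar (r / 2 * t) (ang j).
have cq j : continuous (q j).
  have cm (v : R) t : {for t, continuous (fun u : R => r / 2 * u * v)}.
    apply: cvgM; last exact: cvg_cst.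
    by apply: cvgM; [exact: cvg_cst|exact: cvg_id].
  move=> t; apply: (cvg_pair (F := nbhs t) (G := nbhs (r / 2 * t * cos (ang j)))
    (H := nbhs (r / 2 * t * sin (ang j)))); exact: cm.
have good j t : 0 <= t <= 1 -> cdom c (cinv c (q j t)) /\ cmap c (cinv c (q j t)) = q j t.
  move=> t01; apply: br; rewrite -ball_normE /ball_ /= cx.
  rewrite prod_normE /= gt_max !sub0r !normrN !(normrM (r / 2 * t)).
  have rt : `|r / 2 * t| < r by rewrite ger0_norm; nra.
  have c1 : `|cos (ang j)| <= 1 by rewrite ler_norml cos_geN1 cos_le1.
  have s1 : `|sin (ang j)| <= 1 by rewrite ler_norml sin_geN1 sin_le1.
  by apply/andP; split; apply: le_lt_trans rt; rewrite ler_piMr.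
pose gam j t := cinv c (q j t).
have cg j : {within @unit_interval R, continuous (gam j)}.
  apply/subspace_continuousP => t ut; apply: cvg_within_filter.
  apply: (@continuous_comp _ _ _ (q j) (cinv c)); first exact: cq.
  have [H1 H2] := good j t ut.
  by have := chart_inv_continuous ch H1; rewrite H2.
have g0 j : gam j 0 = x.
  by rewrite /gam /q /polar mulr0 !mul0r -cx ci.
have nsqg j t : 0 <= t <= 1 -> nsq (cmap c (gam j t)) = (r / 2 * t) ^+ 2.
  by move=> t01; rewrite (good j t t01).2 nsq_polar.
exists gam; split.
  move=> j _; split => //.
  - split=> // t d ut Fd dt.
    have t0 : 0 < t.
      move: (ut); rewrite /unit_interval /= => /andP[]; rewrite le_eqVlt => /orP[/eqP E|//].
      move: dt; rewrite -E g0 => /(transversal_of_chart Fd)/transversal_regular.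
      by case.
    have [z [b bz]] := brs d _ Fd (good j t ut).1 dt.
    have key s : unit_interval s -> 0 < s ->
        [/\ {for gam j s, continuous z},
            cmul (z (gam j s)) (z (gam j s)) = cpow (cmap c (gam j s)) k
        & (cmap d (gam j s)).2 = snd (z (gam j s)) + b] -> (cmap d (gam j s)).2 = b.
      move=> us s0 [_ + ->]; rewrite (good j s us).2 /q cpow_polar.
      case: (z _) => u v; rewrite /cmul /polar /=.
      have -> : ang j *+ k = pi *+ 2 *+ j.
        rewrite /ang -(mulr_natr (_ / _)) -(mulr_natr (pi *+ 2)) -(mulr_natr pi).
        by field; exact: lt0r_neq0.
      have -> : cos (pi *+ 2 *+ j) = 1 :> R.
        by rewrite -[_ *+ j]add0r (periodicn (@cosD2pi R)) cos0.
      have -> : sin (pi *+ 2 *+ j) = 0 :> R.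
        by rewrite -[_ *+ j]add0r (periodicn (@sinD2pi R)) sin0.
      rewrite mulr1 mulr0 => -[E1 E2].
      have p0 : 0 < (r / 2 * s) ^+ k by rewrite exprn_gt0 //; nra.
      (* The root [u + i v] has a square with positive real part and zero imaginary part, hence
         [v = 0]. *)
      have : u * v = 0 by lra.
      move/eqP; rewrite mulf_eq0 => /orP[] /eqP E; last by rewrite E add0r.
      by move: E1; rewrite E; nra.
    have Nt : \forall s \near t, 0 < s by exact: lt_nbhsr.
    have := within_near (cg j) ut bz; apply: filterS2 Nt => s s0 Hs us.
    by rewrite (key s us s0 (Hs us)) (key t ut t0 (nbhs_singleton bz)).
  - move=> t t01 E; have t01' : 0 <= t <= 1 by lra.
    have := nsqg j t t01'; rewrite E cx /nsq /= expr0n /= addr0 => /esym/eqP.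
    by rewrite expf_eq0 /= gt_eqF //; nra.
move=> j l s t j3 l3 jl s01 t01 E.
have s01' : 0 <= s <= 1 by lra.
have t01' : 0 <= t <= 1 by lra.
have st : s = t.
  have := nsqg j s s01'; rewrite E nsqg // => /eqP.
  have r2 : r / 2 != 0 by rewrite gt_eqF //; lra.
  rewrite eqrXn2 //; [|nra|nra].
  by move=> /eqP/(mulfI r2).
have := (good j s s01').2; rewrite -/(gam j s) E (good l t t01').2 st.
have rt0 : r / 2 * t != 0 by rewrite gt_eqF //; nra.
rewrite /q /polar => -[/(mulfI rt0) Ec /(mulfI rt0) Es].
have ang_lt a b : (a < b)%N -> (b < 3)%N -> ang a < ang b /\ ang b < ang a + 2 * pi.
  move=> ab b3; have p0 := pi_gt0 R.
  have bk : b%:R < k%:R :> R by rewrite ltr_nat; exact: leq_trans b3 k3.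
  have abR : a%:R < b%:R :> R by rewrite ltr_nat.
  have a0 : 0 <= a%:R :> R by rewrite ler0n.
  rewrite /ang; split.
    by rewrite ltr_pM2r ?invr_gt0 // ltr_pM2l //; lra.
  rewrite -ltrBlDl -mulrBl -mulrBr ltr_pdivrMr //.
  by rewrite ltr_pM2l //; lra.
case: (ltngtP j l) => [jl'|lj|//].
  have [h1 h2] := ang_lt j l jl' l3.
  by apply: (unit_circle_inj h1 h2); symmetry.
have [h1 h2] := ang_lt l j lj j3.
exact: (unit_circle_inj h1 h2).
Qed.

End Stars.

Lemma star_conj (R : realType) (S S' : surface R) (F : measured_foliation S)
    (G : measured_foliation S') (h : S -> S') hinv m x :
  homeomorphism h hinv ->
  (forall X, leaf_path F X -> leaf_path G (h \o X)) ->
  star F m x -> star G m (h x).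
Proof.
move=> [_ _ hK _] hF [gam [gP gdis]].
exists (fun j => h \o gam j); split.
  move=> j jm; have [lg g0 gx] := gP j jm; split; first exact: hF.
    by rewrite /= g0.
  by move=> t t01 /= /(can_inj hK); exact: gx.
by move=> j k s t jm km jk s01 t01 /= /(can_inj hK); exact: gdis.
Qed.

(** * Singularities under a conjugacy *)

Section ConjugateSingularities.
Variables (R : realType) (Sf Sg : surface R).
Variables (f : pseudo_anosov Sf) (g : pseudo_anosov Sg).
Variables (h : Sf -> Sg) (hinv : Sg -> Sf).
Hypothesis h_homeo : homeomorphism h hinv.
Hypothesis h_comm : forall x, g (h x) = h (f x).

Lemma conj_comm_sym y : f (hinv y) = hinv (g y).
Proof.
have [_ _ hK hiK] := h_homeo.
by rewrite -{2}(hiK y) h_comm hK.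
Qed.

(** If [h x] were regular, transport along [h] and its inverse would give [x] a 2-star and no
    3-star; the former excludes a spine, the latter every prong with [k >= 3]. *)
Lemma conj_singular x : fsing (stable f) x -> fsing (stable g) (h x).
Proof.
move=> sx; apply: contrapT => rx.
have trf := foliations_transverse f; have trg := foliations_transverse g.
have [_ _ hK _] := h_homeo.
have pf := conj_stable_path h_homeo h_comm.
have pg := conj_stable_path (homeomorphism_sym h_homeo) conj_comm_sym.
have s2 : star (stable f) 2 x.
  by rewrite -(hK x); apply: star_conj (homeomorphism_sym h_homeo) pg _;
    exact: regular_star2 trg rx.
have s3 : ~ star (stable f) 3 x.
  by move=> /(star_conj h_homeo pf); exact: regular_no_star3 trg rx.
have [FsFu _ prong] := trf; have [k [c [k1 k2 ps pu]]] := prong x sx.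
case: k k1 k2 ps pu => [|[|[|k]]] // _ _ ps pu.
  exact: spine_no_star2 FsFu ps pu s2.
by apply: s3; exact: prong_star3 ps.
Qed.

End ConjugateSingularities.

(** * Winding numbers, local degrees and orientation *)

Section Winding.
Variable R : realType.
Implicit Types (G : R -> R * R) (z w : R * R).

Definition dot z w : R := z.1 * w.1 + z.2 * w.2.
Definition cross z w : R := z.1 * w.2 - z.2 * w.1.

Definition angle_lift G (th : R -> R) := continuous th /\
  forall t, exists2 rho : R, 0 < rho & G t = polar rho (th t).

Definition winds G (n : int) := exists2 th, angle_lift G th &
  forall t, th (t + 2 * pi) = th t + 2 * pi * n%:~R.

Lemma polar_inj (r s a b : R) : 0 < r -> 0 < s -> polar r a = polar s b ->
  cos (a - b) = 1.
Proof.
move=> r0 s0 E.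
have : r ^+ 2 = s ^+ 2 by rewrite -(nsq_polar r a) E nsq_polar.
move=> /eqP; rewrite eqrXn2 ?ltW // => /eqP rs.
move: E; rewrite rs /polar => -[/(mulfI (lt0r_neq0 s0)) Ec /(mulfI (lt0r_neq0 s0)) Es].
by rewrite cosB Ec Es -!expr2 cos2Dsin2.
Qed.

Lemma lift_cos1 G G' th th' a b : angle_lift G th -> angle_lift G' th' ->
  G a = G' b -> cos (th a - th' b) = 1.
Proof.
move=> [_ L] [_ L']; have [r r0 ->] := L a; have [s s0 ->] := L' b.
exact: polar_inj.
Qed.

(** The values of [D] are multiples of [2 * pi]. A rise by less than [pi] contradicts
    [unit_circle_inj]; a larger one crosses [D a + pi], where the cosine is -1. A fall of [D] is a
    rise of [- D]. *)
Lemma cos1_constant (D : R -> R) (a b : R) : a <= b ->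
  {within `[a, b], continuous D} -> (forall t, a <= t <= b -> cos (D t) = 1) ->
  D a = D b.
Proof.
have p0 := pi_gt0 R.
have small (x y : R) : cos x = 1 -> cos y = 1 -> x < y -> y < x + pi -> False.
  move=> cx cy xy yx.
  have sin0' (u : R) : cos u = 1 -> sin u = 0.
    move=> cu; have := cos2Dsin2 u; rewrite cu expr1n => H.
    by apply/eqP; rewrite -sqrf_eq0; apply/eqP; lra.
  by apply: (unit_circle_inj xy); rewrite ?cx ?cy ?sin0' //; lra.
suff key (E : R -> R) : a <= b -> {within `[a, b], continuous E} ->
    (forall t, a <= t <= b -> cos (E t) = 1) -> E b <= E a.
  move=> ab cD D1; apply/eqP; rewrite eq_le key // andbT -lerN2.
  apply: (key (fun t => - D t)) => //; first by move=> x; apply: cvgN; exact: cD.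
  by move=> t tab; rewrite cosN D1.
move=> ab cE E1; rewrite leNgt; apply/negP => lt.
have [lt'|ge'] := ltP (E b) (E a + pi).
  by apply: small lt lt'; apply: E1; rewrite ?lexx ?ab.
have [|c] := @IVT R E a b (E a + pi) ab cE.
  rewrite ge_min le_max ge' orbT andbT; apply/orP; left; lra.
by rewrite in_itv /= => /E1 + Ec; rewrite Ec cosDpi E1 ?lexx ?ab //; lra.
Qed.

Lemma lift_unique G G' th th' (a b : R) : angle_lift G th -> angle_lift G' th' ->
  a <= b -> (forall t, a <= t <= b -> G t = G' t) ->
  th a - th' a = th b - th' b.
Proof.
move=> L L' ab E; apply: (cos1_constant (D := th \- th')) => //.
  apply: continuous_subspaceT => x; apply: cvgB; [exact: L.1|exact: L'.1].
by move=> t /E; exact: lift_cos1.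
Qed.

Lemma cos1_int (x : R) : cos x = 1 -> exists n : int, x = 2 * pi * n%:~R.
Proof.
move=> cx; have p0 := pi_gt0 R.
have cosn (m : nat) y : cos (y + 2 * pi * m%:R) = cos y :> R.
  have -> : 2 * pi * m%:R = pi *+ 2 *+ m :> R.
    by rewrite -(mulr_natr (pi *+ 2)) -(mulr_natr pi) (mulrC 2).
  exact: periodicn (@cosD2pi R) _ _.
have cosz (n : int) y : cos (y + 2 * pi * n%:~R) = cos y :> R.
  case: n => m; first exact: cosn.
  rewrite NegzE mulrNz -[in RHS](addrNK (2 * pi * m.+1%:R) y) cosn.
  by congr cos; rewrite pmulrn; ring.
pose n := Num.floor (x / (2 * pi)).
exists n; pose e := x - 2 * pi * n%:~R.
have tp : 0 < 2 * pi :> R by lra.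
have e0 : 0 <= e < 2 * pi.
  have n1 : n%:~R <= x / (2 * pi) by exact: floor_le.
  have n2 : x / (2 * pi) < n%:~R + 1 by have := floorD1_gt (x / (2 * pi)); rewrite intrD.
  move: n1 n2; rewrite ler_pdivlMr // ltr_pdivrMr // /e => n1 n2; lra.
have ce : cos e = 1 by rewrite -(cosz n) /e subrK.
have : ~ (0 < e).
  move=> e1; apply: (@unit_circle_inj _ 0 e) => //; first lra.
    by rewrite cos0.
  rewrite sin0; have := cos2Dsin2 e; rewrite ce expr1n => H.
  by apply/esym/eqP; rewrite -sqrf_eq0; apply/eqP; lra.
by move: e0; rewrite /e => /andP[] ? ? ?; lra.
Qed.

Lemma winds_unique G n m : winds G n -> winds G m -> n = m.
Proof.
move=> [th L P] [th' L' P']; have p0 := pi_gt0 R.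
have b0 : 0 <= 2 * pi :> R by lra.
have := lift_unique L L' b0 (fun t _ => erefl).
have := P 0; have := P' 0; rewrite add0r => -> -> E.
have : 2 * pi * n%:~R = 2 * pi * m%:~R :> R by lra.
have tp : 2 * pi != 0 :> R by rewrite gt_eqF //; lra.
by move/(mulfI tp)/eqP; rewrite eqr_int => /eqP.
Qed.

(** At [t = 0] a full turn changes the angle by a multiple of [2 * pi]. The shifted lift is a lift
    of the same loop, so the change is the same at all times. *)
Lemma lift_winds G th : angle_lift G th -> (forall t, G (t + 2 * pi) = G t) ->
  exists n, winds G n.
Proof.
move=> L per; have p0 := pi_gt0 R.
have [n En] : exists n : int, th (0 + 2 * pi) - th 0 = 2 * pi * n%:~R.
  by apply: cos1_int; exact: (lift_cos1 L L (per 0)).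
exists n; exists th => // t.
have cs : continuous (fun t : R => t + 2 * pi).
  by move=> u; apply: cvgD; [exact: cvg_id|exact: cvg_cst].
have L' : angle_lift (fun t => G (t + 2 * pi)) (fun t => th (t + 2 * pi)).
  split; last by move=> u; exact: L.2.
  by move=> u; apply: (continuous_comp (cs u)); exact: L.1.
have [t0|/ltW t0] := leP 0 t.
  by have := lift_unique L' L t0 (fun t _ => per t); lra.
by have := lift_unique L' L t0 (fun t _ => per t); lra.
Qed.

(* The signed angle from z to w, provided dot z w > 0. *)
Definition turn z w : R := atan (cross z w / dot z w).

(** A positive scalar product keeps the angle from [G] to [G'] between [- pi / 2] and [pi / 2],
    where the arctangent gives it continuously: a lift passes to a nearby curve without any
    choice. *)
Lemma lift_step G G' th : continuous G -> continuous G' ->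
  (forall t, 0 < dot (G t) (G' t)) -> angle_lift G th ->
  angle_lift G' (fun t => th t + turn (G t) (G' t)).
Proof.
move=> cG cG' d0 [cth Lth].
split.
  move=> t; have cGt : {for t, continuous G} := cG t.
  have cG't : {for t, continuous G'} := cG' t.
  apply: cvgD; first exact: cth.
  apply: (@continuous_comp _ _ _ (fun t => cross (G t) (G' t) / dot (G t) (G' t)) (@atan R)).
    apply: cvgM.
      by apply: cvgB; apply: cvgM; first [exact: continuous_fst|exact: continuous_snd].
    apply: cvgV; first by rewrite gt_eqF.
    by apply: cvgD; apply: cvgM; first [exact: continuous_fst|exact: continuous_snd].
  exact: continuous_atan.
move=> t; have [r r0 E] := Lth t.
set x := turn _ _; pose A := dot (G t) (G' t); pose B := cross (G t) (G' t).
have A0 : 0 < A by exact: d0.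
have c0 : 0 < cos x.
  have /andP[h1 h2] := (atan_def (B / A)).1; apply: cos_gt0_pihalf.
  by rewrite /x /turn h1 h2.
have s0 : sin x = B / A * cos x.
  rewrite -[B / A](atan_def (B / A)).2 -/(turn (G t) (G' t)) -/x /tan.
  by rewrite divfK // gt_eqF.
(* The modulus of [G' t], since the scalar product [A] is the product of both moduli and [cos x]. *)
exists (A / (r * cos x)); first by rewrite divr_gt0 // mulr_gt0.
have rr : r ^+ 2 = r ^+ 2 * ((cos (th t)) ^+ 2 + (sin (th t)) ^+ 2).
  by rewrite cos2Dsin2 mulr1.
have rn : r != 0 by rewrite gt_eqF.
have cn : cos x != 0 by rewrite gt_eqF.
have An : A != 0 by rewrite gt_eqF.
have cs := cos2Dsin2 (th t).
rewrite /polar cosD sinD s0.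
have e1 : A / (r * cos x) * (cos (th t) * cos x - sin (th t) * (B / A * cos x)) =
   (A * cos (th t) - B * sin (th t)) / r by field; rewrite rn cn An.
have e2 : A / (r * cos x) * (sin (th t) * cos x + cos (th t) * (B / A * cos x)) =
   (A * sin (th t) + B * cos (th t)) / r by field; rewrite rn cn An.
rewrite e1 e2 /A /B /dot /cross E /polar /=.
apply: injective_projections => /=.
  have -> : r * cos (th t) * (G' t).1 + r * sin (th t) * (G' t).2 =
     r * (cos (th t) * (G' t).1 + sin (th t) * (G' t).2) by ring.
  have -> : r * cos (th t) * (G' t).2 - r * sin (th t) * (G' t).1 =
     r * (cos (th t) * (G' t).2 - sin (th t) * (G' t).1) by ring.
  rewrite -!mulrA -mulrBr mulrC mulKf // -[LHS]mulr1 -cs; ring.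
have -> : r * cos (th t) * (G' t).1 + r * sin (th t) * (G' t).2 =
   r * (cos (th t) * (G' t).1 + sin (th t) * (G' t).2) by ring.
have -> : r * cos (th t) * (G' t).2 - r * sin (th t) * (G' t).1 =
   r * (cos (th t) * (G' t).2 - sin (th t) * (G' t).1) by ring.
rewrite -!mulrA -mulrDr mulrC mulKf // -[LHS]mulr1 -cs; ring.
Qed.

Lemma turn_id z : turn z z = 0.
Proof. by rewrite /turn /cross [z.2 * z.1]mulrC subrr mul0r atan0. Qed.

Lemma dotC z w : dot z w = dot w z.
Proof. by rewrite /dot (mulrC z.1) (mulrC z.2). Qed.

Lemma dot_self z : z <> 0 -> 0 < dot z z.
Proof.
move=> z0; rewrite lt_def -[dot z z]/(z.1 * z.1 + z.2 * z.2) -!expr2 -/(nsq z).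
by rewrite nsq_ge0 andbT; apply/eqP => /nsq_eq0.
Qed.

Definition jointly_continuous (H : R -> R -> R * R) :=
  forall s t, 0 <= s <= 1 -> {for (s, t), continuous (fun p : R * R => H p.1 p.2)}.

Lemma jointly_continuous_slice H s : jointly_continuous H -> 0 <= s <= 1 ->
  continuous (H s).
Proof.
move=> cH s01 t.
apply: (@continuous_comp _ _ _ (fun t => (s, t)) (fun p : R * R => H p.1 p.2)).
  apply: (cvg_pair (F := nbhs t) (G := nbhs s) (H := nbhs t)); [exact: cvg_cst|exact: cvg_id].
exact: cH.
Qed.

(** A tube lemma: at [s = s0] the scalar product is a squared norm, hence positive, and compactness
    of the range of [t] makes the neighbourhood of [s0] uniform. *)
Lemma homotopy_near H s0 (a b : R) : jointly_continuous H -> 0 <= s0 <= 1 ->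
  (forall t, H s0 t <> 0) ->
  \forall s \near s0, forall t, a <= t <= b -> 0 < dot (H s0 t) (H s t).
Proof.
move=> cH s01 H0.
have cov := (compact_near_coveringP _).1 (@segment_compact R a b).
have := cov R (nbhs s0) (fun s t => 0 < dot (H s0 t) (H s t)) _.
have Fn : Filter (nbhs s0) by exact: nbhs_filter.
move=> /(_ Fn) K.
suff : \forall s \near s0, `[a, b] `<=` (fun t => 0 < dot (H s0 t) (H s t)).
  by apply: filterS => s Hs t tab; apply: Hs; rewrite /= in_itv.
apply: K => t _.
have cd : {for (t, s0), continuous (fun q : R * R => dot (H s0 q.1) (H q.2 q.1))}.
  have c1 : {for (t, s0), continuous (fun q : R * R => H s0 q.1)}.
    apply: (@continuous_comp _ _ _ fst (H s0)); first exact: cvg_fst.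
    exact: jointly_continuous_slice.
  have c2 : {for (t, s0), continuous (fun q : R * R => H q.2 q.1)}.
    apply: (@continuous_comp _ _ _ (fun q : R * R => (q.2, q.1)) (fun p : R * R => H p.1 p.2)).
      apply: (cvg_pair (F := nbhs (t, s0)) (G := nbhs s0) (H := nbhs t)).
        exact: cvg_snd.
      exact: cvg_fst.
    exact: cH.
  by apply: cvgD; apply: cvgM; first [exact: continuous_fst|exact: continuous_snd].
have pos : \forall q \near (t, s0), 0 < dot (H s0 q.1) (H q.2 q.1).
  by apply: (cvgr_gt _ cd); exact: dot_self.
exact: pos.
Qed.

End Winding.

Section Homotopy.
Variable R : realType.
Implicit Types (G : R -> R * R) (z w : R * R).

Lemma periodic_int (T : Type) (F : R -> T) (c : R) :
  (forall t, F (t + c) = F t) -> forall (n : int) t, F (t + c * n%:~R) = F t.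
Proof.
move=> per.
have pern (m : nat) t : F (t + c * m%:R) = F t.
  elim: m t => [|m IH] t; first by rewrite mulr0 addr0.
  by rewrite -natr1 mulrDr mulr1 addrA per.
case=> m t; first exact: pern.
rewrite NegzE mulrNz -[in RHS](addrNK (c * m.+1%:R) t) pern.
by congr F; rewrite pmulrn; ring.
Qed.

Lemma periodic_reduce (T : Type) (F : R -> T) : (forall t, F (t + 2 * pi) = F t) ->
  forall t, exists2 t0, 0 <= t0 <= 2 * pi & F t = F t0.
Proof.
move=> per t; have p0 := pi_gt0 R.
have tp : 0 < 2 * pi :> R by lra.
pose n := Num.floor (t / (2 * pi)).
exists (t - 2 * pi * n%:~R); last first.
  by rewrite -[in LHS](subrK (2 * pi * n%:~R) t) periodic_int.
have n1 : n%:~R <= t / (2 * pi) by exact: floor_le.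
have n2 : t / (2 * pi) < n%:~R + 1 by have := floorD1_gt (t / (2 * pi)); rewrite intrD.
by move: n1 n2; rewrite ler_pdivlMr // ltr_pdivrMr // => n1 n2; lra.
Qed.

Lemma winds_step G G' n : continuous G -> continuous G' ->
  (forall t, G (t + 2 * pi) = G t) -> (forall t, G' (t + 2 * pi) = G' t) ->
  (forall t, 0 < dot (G t) (G' t)) -> winds G n -> winds G' n.
Proof.
move=> cG cG' per per' d0 [th L P].
exists (fun t => th t + turn (G t) (G' t)); first exact: lift_step.
by move=> t; rewrite P per per'; ring.
Qed.

(** By [homotopy_near] and [winds_step] the proposition [winds (H s) n] is locally constant in [s];
    hence the use of [locally_constant_connected] with values in [Prop]. *)
Lemma winds_homotopy (H : R -> R -> R * R) n : jointly_continuous H ->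
  (forall s t, 0 <= s <= 1 -> H s (t + 2 * pi) = H s t) ->
  (forall s t, 0 <= s <= 1 -> H s t <> 0) ->
  winds (H 0) n <-> winds (H 1) n.
Proof.
move=> cH per H0.
suff -> : winds (H 0) n = winds (H 1) n by [].
apply: (@locally_constant_connected R Prop `[0, 1]%classic (fun s => winds (H s) n) _ _ 0 1);
  rewrite /= ?in_itv /= ?lexx ?ler01 //; first exact: segment_connected.
move=> s0; rewrite in_itv /= => s01.
have := homotopy_near 0 (2 * pi) cH s01 (fun t => H0 s0 t s01).
apply: filterS => s Hs; rewrite in_itv /= => s1.
have d0 t : 0 < dot (H s0 t) (H s t).
  have [|t0 t01 ->] := @periodic_reduce _ (fun t => dot (H s0 t) (H s t)) _ t.
    by move=> u; rewrite !per.
  exact: Hs.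
have c0 := jointly_continuous_slice cH s01.
have c1 := jointly_continuous_slice cH s1.
apply/propext; split; apply: winds_step => //; try by move=> t; exact: per.
by move=> t; rewrite dotC.
Qed.

Lemma polar_exists z : z <> 0 -> exists rho th, 0 < rho /\ z = polar rho th.
Proof.
move=> z0.
have n0 : 0 < nsq z.
  by rewrite lt_def nsq_ge0 andbT; apply/eqP => /nsq_eq0.
pose rho := Num.sqrt (nsq z).
have r0 : 0 < rho by rewrite sqrtr_gt0.
have r2 : rho ^+ 2 = z.1 ^+ 2 + z.2 ^+ 2 by rewrite sqr_sqrtr // ltW.
pose c := z.1 / rho; pose s := z.2 / rho.
have cs : c ^+ 2 + s ^+ 2 = 1.
  rewrite /c /s !expr_div_n -mulrDl -r2 divff // expf_neq0 // gt_eqF //.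
have c1 : -1 <= c <= 1 by have := sqr_ge0 s; nra.
have ca : cos (acos c) = c by apply: acosK; rewrite in_itv.
have z1 : z.1 = rho * c by rewrite /c mulrC divfK // gt_eqF.
have z2 : z.2 = rho * s by rewrite /s mulrC divfK // gt_eqF.
have sa : sin (acos c) ^+ 2 = s ^+ 2.
  by have := cos2Dsin2 (acos c); rewrite ca -cs => /addrI.
have := sa => /eqP; rewrite eqf_sqr => /orP[] /eqP E.
  exists rho, (acos c); split=> //; rewrite /polar ca E -z1 -z2.
  by case: (z).
exists rho, (- acos c); split=> //; rewrite /polar cosN sinN ca E opprK -z1 -z2.
by case: (z).
Qed.

(** The curves [G (s * t)] join the constant [G 0], which has a lift, to [G]. Existence of a lift
    with value [th0] at 0 is locally constant in [s]: all these curves agree at 0, so the correcting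
    angle vanishes there. *)
Lemma lift_exists_segment G (M th0 rho0 : R) : 0 <= M -> continuous G ->
  (forall t, G t <> 0) -> 0 < rho0 -> G 0 = polar rho0 th0 ->
  exists th, [/\ continuous th, th 0 = th0 &
    forall t, - M <= t <= M -> exists2 rho, 0 < rho & G t = polar rho (th t)].
Proof.
move=> M0 cG G0 r0 E0.
(* Clamping confines [t] to a compact segment, as [homotopy_near] requires. *)
pose cl (t : R) : R := Num.max (- M) (Num.min M t).
have cl1 t : - M <= cl t <= M.
  by rewrite le_max lexx ge_max ge_min lexx andbT /=; lra.
have cl2 t : - M <= t <= M -> cl t = t.
  by move=> /andP[h1 h2]; rewrite /cl min_r // max_r.
have ccl : continuous cl.
  move=> t; apply: (@continuous_max R R (fun=> - M) (fun t => Num.min M t) t).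
    exact: cvg_cst.
  apply: (@continuous_min R R (fun=> M) id t); [exact: cvg_cst|exact: cvg_id].
pose H s t := G (s * t).
have cH : jointly_continuous H.
  move=> s t _; apply: (@continuous_comp _ _ _ (fun p : R * R => p.1 * p.2) G).
    by apply: cvgM; [exact: cvg_fst|exact: cvg_snd].
  exact: cG.
pose K s t := H s (cl t).
have cK s : 0 <= s <= 1 -> continuous (K s).
  move=> s01 t; apply: (@continuous_comp _ _ _ cl (H s)); first exact: ccl.
  exact: jointly_continuous_slice.
pose B s := exists2 th, angle_lift (K s) th & th 0 = th0.
have K0 s : K s 0 = G 0 by rewrite /K cl2 /H ?mulr0 //; lra.
have B0 : B 0.
  exists (fun=> th0) => //; split; first by move=> t; exact: cvg_cst.
  by move=> t; exists rho0 => //; rewrite /K /H mul0r.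
have EB : B 0 = B 1.
  apply: (@locally_constant_connected R Prop `[0, 1]%classic B _ _ 0 1);
    rewrite /= ?in_itv /= ?lexx ?ler01 //; first exact: segment_connected.
  move=> s0; rewrite in_itv /= => s01.
  have := homotopy_near (- M) M cH s01 (fun t => G0 (s0 * t)).
  apply: filterS => s Hs; rewrite in_itv /= => s1.
  have step u v : 0 <= u <= 1 -> 0 <= v <= 1 ->
      (forall t, 0 < dot (K u t) (K v t)) -> B u -> B v.
    move=> u1 v1 d0 [th L T0].
    exists (fun t => th t + turn (K u t) (K v t)).
      by apply: lift_step => //; exact: cK.
    by rewrite T0 !K0 turn_id addr0.
  apply/propext; split; apply: step => // t; last exact: Hs (cl1 t).
  by rewrite dotC; exact: Hs (cl1 t).
have [th L T0] : B 1 by rewrite -EB.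
exists th; split=> //; first exact: L.1.
move=> t tM; have [rho r1 E] := L.2 t; exists rho => //.
by rewrite -E /K /H mul1r cl2.
Qed.

(* The lifts over the segments [- M, M] agree where they overlap. *)
Lemma lift_exists G : continuous G -> (forall t, G t <> 0) ->
  exists th, angle_lift G th.
Proof.
move=> cG G0.
have [rho0 [th0 [r0 E0]]] := polar_exists (G0 0).
have N0 (M : R) : 0 <= `|M| by [].
have HM (M : R) := lift_exists_segment (N0 M) cG G0 r0 E0.
have [Th ThP] := choice HM.
have agree (M N t : R) : `|t| <= `|M| -> `|t| <= `|N| -> Th M t = Th N t.
  move=> tM tN; have [cM M0 LM] := ThP M; have [cN N0' LN] := ThP N.
  have D1 u : `|u| <= `|t| -> cos ((Th M \- Th N) u) = 1.
    move=> ut; have [|r1 r10 E1] := LM u; first by rewrite -ler_norml; exact: le_trans tM.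
    have [|r2 r20 E2] := LN u; first by rewrite -ler_norml; exact: le_trans tN.
    by apply: (polar_inj r10 r20); rewrite -E1 -E2.
  have cD (a b : R) : {within `[a, b], continuous (Th M \- Th N)}.
    by apply: continuous_subspaceT => x; apply: cvgB; [exact: cM|exact: cN].
  have D0 : (Th M \- Th N) 0 = 0 by rewrite /= M0 N0' subrr.
  suff : (Th M \- Th N) t = 0 by move=> /= /eqP; rewrite subr_eq0 => /eqP.
  have [t0|/ltW t0] := leP 0 t.
    rewrite -(cos1_constant t0 (cD _ _)) // => u /andP[u0 ut]; apply: D1.
    by rewrite !ger0_norm.
  rewrite (cos1_constant t0 (cD _ _)) // => u /andP[ut u0]; apply: D1.
  by rewrite !ler0_norm // lerN2.
exists (fun t => Th (`|t| + 1) t); split.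
  move=> t0; have [cM _ _] := ThP (`|t0| + 2).
  have E t : `|t - t0| <= 1 -> Th (`|t| + 1) t = Th (`|t0| + 2) t.
    move=> tt; have : `|t| <= `|t0| + 1.
      by rewrite -{1}(subrK t0 t) addrC; apply: le_trans (ler_normD _ _) _; rewrite lerD2l.
    have n1 : `| `|t| + 1 | = `|t| + 1 by rewrite ger0_norm // addr_ge0.
    have n2 : `| `|t0| + 2 | = `|t0| + 2 by rewrite ger0_norm // addr_ge0.
    by move=> h; apply: agree; rewrite ?n1 ?n2; lra.
  have N : \forall t \near t0, Th (`|t0| + 2) t = Th (`|t| + 1) t.
    apply/nbhs_ballP; exists 1 => //= t; rewrite /ball /= distrC => /ltW h.
    by rewrite E.
  rewrite /continuous_at /= E ?subrr ?normr0 //.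
  exact: cvg_trans (near_eq_cvg N) (cM t0).
move=> t; have [_ _ LM] := ThP (`|t| + 1); apply: LM.
by rewrite -ler_norml (ger0_norm (_ : 0 <= `|t| + 1)) ?addr_ge0 // lerDl.
Qed.

End Homotopy.

(** * Local degree of planar embeddings *)

Section Degree.
Variable R : realType.
Implicit Types (M N : R * R -> R * R) (u w : R * R) (O : set (R * R)).

Definition circle_image M u (r t : R) : R * R := M (u + polar r t) - M u.

Definition deg_at M u (n : int) := exists2 r0 : R, 0 < r0 &
  forall r, 0 < r < r0 -> winds (circle_image M u r) n.

Definition local_embedding O M := [/\ open O,
  forall w, O w -> {for w, continuous M} &
  forall w w', O w -> O w' -> M w = M w' -> w = w'].

Lemma preserves_orientationP M u :
  preserves_orientation_at M u <-> deg_at M u 1.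
Proof.
split=> -[r0 r00 H]; exists r0 => // r rr.
  have [rho [theta [ct per E]]] := H r rr.
  exists theta; last by move=> t; rewrite per mulr1.
  split=> // t; have [p0 Et] := E t; exists (rho t) => //.
  have Er : u + polar r t = u + r *: (cos t, sin t) by [].
  by rewrite /circle_image Er Et addrC addKr.
have [th [cth L] per] := H r rr.
have L' t : exists p, 0 < p /\ circle_image M u r t = polar p (th t).
  by have [p p0 E] := L t; exists p.
have [rho rhoP] := choice L'.
exists rho, th; split=> //; first by move=> t; rewrite per mulr1.
move=> t; have [p0 E] := rhoP t; split=> //.
have -> : M (u + r *: (cos t, sin t)) = M u + circle_image M u r t.
  by rewrite /circle_image [RHS]addrC subrK.
by rewrite E.
Qed.

Lemma continuous_polar (T : topologicalType) (rho th : T -> R) (x : T) :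
  {for x, continuous rho} -> {for x, continuous th} ->
  {for x, continuous (fun y => polar (rho y) (th y))}.
Proof.
move=> cr ct.
apply: (cvg_pair (F := nbhs x) (G := nbhs (rho x * cos (th x))) (H := nbhs (rho x * sin (th x)))).
  apply: cvgM => //; apply: (@continuous_comp _ _ _ th (@cos R)) => //.
  exact: continuous_cos.
apply: cvgM => //; apply: (@continuous_comp _ _ _ th (@sin R)) => //.
exact: continuous_sin.
Qed.

Lemma polar_norm_le (r t : R) : 0 <= r -> `|polar r t| <= r.
Proof.
move=> r0; rewrite prod_normE /polar /= ge_max !normrM !(ger0_norm r0).
have c1 : `|cos t| <= 1 by rewrite ler_norml cos_geN1 cos_le1.
have s1 : `|sin t| <= 1 by rewrite ler_norml sin_geN1 sin_le1.
by apply/andP; split; rewrite ler_piMr.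
Qed.

Lemma near_polar u (P : R * R -> Prop) : (\forall w \near u, P w) ->
  exists2 e : R, 0 < e & forall w (r t : R), `|w - u| < e -> 0 <= r < e -> P (w + polar r t).
Proof.
move=> /nbhs_ballP[e /= e0 be]; exists (e / 2); first lra.
move=> w r t wu /andP[r0 re]; apply: be; rewrite -ball_normE /= distrC.
rewrite addrAC; apply: le_lt_trans (ler_normD _ _) _.
have := polar_norm_le t r0; lra.
Qed.

Lemma polar2pi (r t : R) : polar r (t + 2 * pi) = polar r t.
Proof.
have -> : 2 * pi = pi *+ 2 :> R by rewrite -(mulr_natr pi) mulrC.
by rewrite /polar cosD2pi sinD2pi.
Qed.

(** Injectivity of [M] keeps the image of each circle away from the image of its centre, so moving
    centre and radius is a homotopy of loops avoiding 0. *)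
Lemma circle_homotopy M O (u : R -> R * R) (r : R -> R) n :
  continuous u -> continuous r -> local_embedding O M ->
  (forall s t, 0 <= s <= 1 -> [/\ O (u s), O (u s + polar (r s) t) & 0 < r s]) ->
  winds (circle_image M (u 0) (r 0)) n <-> winds (circle_image M (u 1) (r 1)) n.
Proof.
move=> cu cr [oO cM iM] H.
apply: (@winds_homotopy R (fun s t => circle_image M (u s) (r s) t)).
- move=> s t s01; have [Ow1 Ow2 _] := H s t s01.
  have cu1 : {for (s, t), continuous (fun p : R * R => u p.1)}.
    by apply: (@continuous_comp _ _ _ fst u); [exact: cvg_fst|exact: cu].
  have cr1 : {for (s, t), continuous (fun p : R * R => r p.1)}.
    by apply: (@continuous_comp _ _ _ fst r); [exact: cvg_fst|exact: cr].
  apply: cvgB.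
    apply: (@continuous_comp _ _ _ (fun p : R * R => u p.1 + polar (r p.1) p.2) M).
      have c2 : {for (s, t), continuous (fun p : R * R => p.2)} by exact: cvg_snd.
      exact: cvgD cu1 (continuous_polar cr1 c2).
    exact: cM.
  by apply: (@continuous_comp _ _ _ (fun p : R * R => u p.1) M) => //; exact: cM.
- by move=> s t _; rewrite /circle_image polar2pi.
- move=> s t s01; have [Ow1 Ow2 r0] := H s t s01.
  rewrite /circle_image => /eqP; rewrite subr_eq0 => /eqP /(iM _ _ Ow2 Ow1) /eqP.
  rewrite -subr_eq0 addrAC subrr add0r => /eqP E.
  by have := nsq_polar (r s) t; rewrite E nsq0 => /eqP; rewrite eq_sym sqrf_eq0 gt_eqF.
Qed.

Lemma circle_image_periodic M u r t : circle_image M u r (t + 2 * pi) = circle_image M u r t.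
Proof. by rewrite /circle_image polar2pi. Qed.

Lemma circle_image_continuous M O u (r : R) : local_embedding O M ->
  (forall t, O (u + polar r t)) -> continuous (circle_image M u r).
Proof.
move=> [_ cM _] H t; apply: cvgB; last exact: cvg_cst.
apply: (@continuous_comp _ _ _ (fun t => u + polar r t) M); last exact: cM.
apply: cvgD; first exact: cvg_cst.
by apply: continuous_polar; [exact: cvg_cst|exact: cvg_id].
Qed.

Lemma deg_exists M O u : local_embedding O M -> O u -> exists n, deg_at M u n.
Proof.
move=> le Ou; have [oO cM iM] := le.
have [e e0 He] := near_polar (open_near oO Ou).
have He' r t : 0 <= r < e -> O (u + polar r t).
  by move=> re; apply: He => //; rewrite subrr normr0.
have c1 : continuous (circle_image M u (e / 2)).
  by apply: circle_image_continuous le _ => t; apply: He'; lra.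
have n1 t : circle_image M u (e / 2) t <> 0.
  have Ow2 : O (u + polar (e / 2) t) by apply: He'; lra.
  rewrite /circle_image => /eqP; rewrite subr_eq0 => /eqP /(iM _ _ Ow2 Ou) /eqP.
  rewrite -subr_eq0 addrAC subrr add0r => /eqP E.
  have := nsq_polar (e / 2) t; rewrite E nsq0 => /eqP; rewrite eq_sym sqrf_eq0 gt_eqF //; lra.
have [th L] := lift_exists c1 n1.
have [n W] := lift_winds L (circle_image_periodic M u (e / 2)).
exists n, e => // r re.
(* With the centre fixed, the radius moves affinely from [e / 2], where the degree was read, to
   [r]. *)
have := @circle_homotopy M O (fun=> u) (fun s => (1 - s) * (e / 2) + s * r) n.
rewrite /= subr0 subrr mul1r !mul0r addr0 add0r mul1r => -[] // .
- by move=> s; exact: cvg_cst.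
- move=> s; apply: cvgD; apply: cvgM; first [exact: cvg_cst|exact: cvg_id|idtac].
  by apply: cvgB; [exact: cvg_cst|exact: cvg_id].
- by move=> s t s01; split=> //; [apply: He'; nra|nra].
by move=> + _; apply.
Qed.

Lemma deg_unique M u n m : deg_at M u n -> deg_at M u m -> n = m.
Proof.
move=> [r r0 H] [s s0 H'].
have m0 : 0 < Num.min r s by rewrite lt_min r0.
have mr : Num.min r s <= r by rewrite ge_min lexx.
have ms : Num.min r s <= s by rewrite ge_min lexx orbT.
by apply: (@winds_unique R (circle_image M u (Num.min r s / 2))); [apply: H|apply: H']; lra.
Qed.

Lemma deg_locally_constant M O u n : local_embedding O M -> O u -> deg_at M u n ->
  \forall w \near u, deg_at M w n.
Proof.
move=> le Ou [r0 r00 H]; have [oO cM iM] := le.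
have [e e0 He] := near_polar (open_near oO Ou).
have N : \forall w \near u, `|w - u| < e.
  by apply/nbhs_ballP; exists e => //= w; rewrite -ball_normE /= distrC.
apply: filterS N => w wu.
have m0 : 0 < Num.min r0 e by rewrite lt_min r00.
have mr : Num.min r0 e <= r0 by rewrite ge_min lexx.
have me : Num.min r0 e <= e by rewrite ge_min lexx orbT.
exists (Num.min r0 e) => // r rr.
(* The centre slides along the segment from [u] to [w] while the radius is fixed. *)
pose us (s : R) : R * R := u + s *: (w - u).
have u0 : us 0 = u by rewrite /us scale0r addr0.
have u1 : us 1 = w by rewrite /us scale1r addrC subrK.
rewrite -u1; apply/(@circle_homotopy M O us (fun=> r) n) => //; last first.
- by rewrite u0; apply: H; lra.
- move=> s t s01.
  have ue : `|us s - u| < e.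
    rewrite /us addrAC subrr add0r normrZ ger0_norm; last by case/andP: s01.
    by have := normr_ge0 (w - u); nra.
  split; last by lra.
    by have := He (us s) 0 0 ue; rewrite /polar !mul0r addr0; apply; rewrite lexx.
  by apply: He => //; lra.
- by move=> s; exact: cvg_cst.
- move=> s; apply: cvgD; first exact: cvg_cst.
  by apply: cvgZ; [exact: cvg_id|exact: cvg_cst].
Qed.

Lemma deg_ext M N u n : (\forall w \near u, M w = N w) -> deg_at M u n -> deg_at N u n.
Proof.
move=> E [r0 r00 H]; have Eu := nbhs_singleton E.
have [e e0 He] := near_polar E.
have m0 : 0 < Num.min r0 e by rewrite lt_min r00.
have mr : Num.min r0 e <= r0 by rewrite ge_min lexx.
have me : Num.min r0 e <= e by rewrite ge_min lexx orbT.
exists (Num.min r0 e) => // r rr.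
have -> : circle_image N u r = circle_image M u r.
  apply/funext => t; rewrite /circle_image -Eu He //; last by lra.
  by rewrite subrr normr0.
by apply: H; lra.
Qed.

End Degree.

Section DegreeComposition.
Variable R : realType.
Implicit Types (M N : R * R -> R * R) (u w : R * R) (O : set (R * R)).

(** The function [th s - n * s] has period [2 * pi], so advancing its argument by [m] periods, [m]
    of any sign, adds [2 * pi * n * m] to the angle. *)
Lemma winds_power (G : R -> R * R) (n m : int) : winds G n ->
  winds (fun t => G (m%:~R * t)) (n * m).
Proof.
move=> [th [cth L] per].
have cm : continuous (fun t : R => m%:~R * t).
  by move=> t; apply: cvgM; [exact: cvg_cst|exact: cvg_id].
exists (fun t => th (m%:~R * t)).
  split; last by move=> t; exact: L.
  by move=> t; apply: (continuous_comp (cm t)); exact: cth.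
move=> t; have perF : forall s, th (s + 2 * pi) - n%:~R * (s + 2 * pi) = th s - n%:~R * s.
  by move=> s; rewrite per; ring.
have := periodic_int perF m (m%:~R * t).
have -> : m%:~R * (t + 2 * pi) = m%:~R * t + 2 * pi * m%:~R by ring.
rewrite intrM => E; lra.
Qed.

Lemma convex_gt0 (s a b : R) : 0 <= s <= 1 -> 0 < a -> 0 < b ->
  0 < (1 - s) * a + s * b.
Proof.
move=> /andP[]; rewrite le_eqVlt => /orP[/eqP <- _ a0 b0|s0 s1 a0 b0].
  by rewrite subr0 mul1r mul0r addr0.
by rewrite ltr_wpDl ?mulr_gt0 // mulr_ge0 ?subr_ge0 // ltW.
Qed.

(** Seen from [M u], the image of a small circle is [polar (P t) (th t)] with [th] winding [m]
    times. Within a punctured disc on which [N] is injective it is deformed to a circle run [m]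
    times, whose image under [N] winds [n * m] times by [winds_power]. *)
Lemma deg_comp M N O O' u n m : local_embedding O M -> local_embedding O' N ->
  O u -> O' (M u) -> deg_at M u m -> deg_at N (M u) n -> deg_at (N \o M) u (n * m).
Proof.
move=> lM lN Ou O'Mu [r1 r10 HM] [r2 r20 HN].
have [oO cM iM] := lM; have [oO' cN iN] := lN.
have [e1 e10 He1] := near_polar (open_near oO Ou).
have [e2 e20 He2] := near_polar (open_near oO' O'Mu).
have Hn2 (r t : R) : 0 <= r < e2 -> O' (M u + polar r t).
  by move=> re; apply: He2 => //; rewrite subrr normr0.
have cnsq : {for u, continuous (fun w => nsq (M w - M u))}.
  by apply: continuous_nsq; apply: cvgB; [exact: cM|exact: cvg_cst].
have N3 : \forall w \near u, nsq (M w - M u) < e2 ^+ 2.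
  by apply: (cvgr_lt _ cnsq); rewrite subrr nsq0 exprn_gt0.
have [e3 e30 He3] := near_polar N3.
pose r0 := Num.min r1 (Num.min e1 e3).
have r00 : 0 < r0 by rewrite !lt_min r10 e10.
have r01 : r0 <= r1 by rewrite ge_min lexx.
have r0e1 : r0 <= e1 by rewrite !ge_min lexx !orbT.
have r0e3 : r0 <= e3 by rewrite !ge_min lexx !orbT.
exists r0 => // r rr.
have rr1 : 0 < r < r1 by lra.
have Or t : O (u + polar r t).
  by apply: He1; [rewrite subrr normr0|lra].
have [th L per] := HM r rr1.
have [cth _] := L.
pose G := circle_image M u r.
have cG : continuous G := circle_image_continuous lM Or.
pose P t := Num.sqrt (nsq (G t)).
have cP : continuous P.
  move=> t; apply: (@continuous_comp _ _ _ (fun t => nsq (G t)) (@Num.sqrt R)).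
    by apply: continuous_nsq; exact: cG.
  exact: sqrt_continuous.
have PG t : 0 < P t /\ G t = polar (P t) (th t).
  have [p p0 E] := L.2 t.
  have -> : P t = p by rewrite /P /G E nsq_polar sqrtr_sqr gtr0_norm.
  by [].
have Pe t : P t < e2.
  have := He3 u r t; rewrite subrr normr0 => /(_ e30) H.
  have {}H : nsq (G t) < e2 ^+ 2 by apply: H; lra.
  rewrite -(gtr0_norm e20) -sqrtr_sqr ltr_sqrt // exprn_gt0 //.
(* This radius fits both in the disc contained in [O'] and in the range where the degree of [N] is
   known. *)
pose q := Num.min e2 r2 / 2.
have m0 : 0 < Num.min e2 r2 by rewrite lt_min e20.
have mr : Num.min e2 r2 <= e2 by rewrite ge_min lexx.
have me : Num.min e2 r2 <= r2 by rewrite ge_min lexx orbT.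
have q0 : 0 < q by rewrite /q; lra.
have qe2 : q < e2 by rewrite /q; lra.
have qr2 : q < r2 by rewrite /q; lra.
(* Modulus and angle are interpolated separately, which keeps the modulus positive; the angle gains
   [2 * pi * m] per turn at every stage, so each stage is a loop. *)
pose rad s t := (1 - s) * P t + s * q.
pose ang s t := (1 - s) * th t + s * (m%:~R * t).
pose H s t := N (M u + polar (rad s t) (ang s t)) - N (M u).
have rad0 s t : 0 <= s <= 1 -> 0 < rad s t < e2.
  move=> s01; have [Pt _] := PG t; have := Pe t; rewrite /rad => h.
  have h1 : 0 < e2 - P t by lra.
  have h2 : 0 < e2 - q by lra.
  have h3 := convex_gt0 s01 Pt q0; have h4 := convex_gt0 s01 h1 h2.
  by rewrite h3 /=; move: h4; lra.
have cH : jointly_continuous H.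
  move=> s t s01; apply: cvgB; last exact: cvg_cst.
  apply: (@continuous_comp _ _ _
    (fun p : R * R => M u + polar (rad p.1 p.2) (ang p.1 p.2)) N); last first.
    by have /andP[h1 h2] := rad0 s t s01; apply: cN; apply: Hn2; rewrite /= (ltW h1) h2.
  have c1 : {for (s, t), continuous (fun p : R * R => 1 - p.1)}.
    by apply: cvgB; [exact: cvg_cst|exact: cvg_fst].
  have cP2 : {for (s, t), continuous (fun p : R * R => P p.2)}.
    by apply: (@continuous_comp _ _ _ snd P); [exact: cvg_snd|exact: cP].
  have ct2 : {for (s, t), continuous (fun p : R * R => th p.2)}.
    by apply: (@continuous_comp _ _ _ snd th); [exact: cvg_snd|exact: cth].
  apply: cvgD; first exact: cvg_cst.
  have cr : {for (s, t), continuous (fun p : R * R => rad p.1 p.2)}.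
    apply: cvgD; apply: cvgM => //; first exact: cvg_fst.
    exact: cvg_cst.
  have ca : {for (s, t), continuous (fun p : R * R => ang p.1 p.2)}.
    apply: cvgD; apply: cvgM => //; first exact: cvg_fst.
    by apply: cvgM; [exact: cvg_cst|exact: cvg_snd].
  exact: continuous_polar cr ca.
have perH s t : 0 <= s <= 1 -> H s (t + 2 * pi) = H s t.
  move=> _; rewrite /H; congr (N (_ + _) - _).
  have -> : rad s (t + 2 * pi) = rad s t.
    by rewrite /rad /P /G circle_image_periodic.
  have -> : ang s (t + 2 * pi) = ang s t + 2 * pi * m%:~R by rewrite /ang per; ring.
  by rewrite (periodic_int (F := polar (rad s t))) // => v; exact: polar2pi.
have H0 s t : 0 <= s <= 1 -> H s t <> 0.
  move=> s01; have rs := rad0 s t s01.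
  have Ow : O' (M u + polar (rad s t) (ang s t)) by apply: Hn2; lra.
  rewrite /H => /eqP; rewrite subr_eq0 => /eqP /(iN _ _ Ow O'Mu) /eqP.
  rewrite -subr_eq0 addrAC subrr add0r => /eqP E.
  have := nsq_polar (rad s t) (ang s t); rewrite E nsq0 => /eqP.
  by rewrite eq_sym sqrf_eq0 gt_eqF //; lra.
have := winds_homotopy (n * m) cH perH H0.
have -> : H 0 = circle_image (N \o M) u r.
  apply/funext => t; rewrite /H /rad /ang /circle_image subr0 !mul1r !mul0r !addr0.
  have [_ <-] := PG t; congr (N _ - _).
  by rewrite /G /circle_image addrC subrK.
have -> : H 1 = (fun t => circle_image N (M u) q (m%:~R * t)).
  by apply/funext => t; rewrite /H /rad /ang /circle_image subrr !mul1r !mul0r !add0r.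
move=> [_]; apply; apply: winds_power; apply: HN; lra.
Qed.

Lemma deg_id u : deg_at id u 1.
Proof.
exists 1 => // r /andP[r0 _]; exists id; last by move=> t; rewrite mulr1.
split; first by move=> t; exact: cvg_id.
by move=> t; exists r => //; rewrite /circle_image addrAC subrr add0r.
Qed.

(* The degrees of K and K' are integers whose product is 1. *)
Lemma deg_local_homeo K K' O O' u : local_embedding O K -> local_embedding O' K' ->
  O u -> O' (K u) -> (\forall w \near u, K' (K w) = w) ->
  deg_at K u 1 \/ deg_at K u (-1).
Proof.
move=> lK lK' Ou O'u inv.
have [n Hn] := deg_exists lK Ou; have [m Hm] := deg_exists lK' O'u.
have H1 := deg_comp lK lK' Ou O'u Hn Hm.
have H2 : deg_at (K' \o K) u 1.
  by apply: deg_ext (deg_id u); apply: filterS inv => w /= ->.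
have mn := deg_unique H1 H2.
have /orP[/eqP n1|/eqP n1] : (n == 1) || (n == -1).
- have : n \is a GRing.unit by apply/unitrPr; exists m; rewrite mulrC mn.
  by [].
- by left; rewrite -n1.
- by right; rewrite -n1.
Qed.

(** The reflection of the unit square in its vertical median: horizontal and vertical lines keep
    their kind, and only the two sides of the unstable boundary are exchanged. *)
Definition flip (u : R * R) : R * R := (1 - u.1, u.2).

Lemma flipK : involutive flip.
Proof. by case=> a b; rewrite /flip /=; congr pair; ring. Qed.

Lemma continuous_flip : continuous flip.
Proof.
move=> u; apply: (cvg_pair (F := nbhs u) (G := nbhs (1 - u.1)) (H := nbhs u.2)).
  by apply: cvgB; [exact: cvg_cst|exact: cvg_fst].
exact: cvg_snd.
Qed.

(** In polar form around corresponding centres the reflection is [t |-> pi - t], which runs the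
    circle backwards. *)
Lemma deg_flip M u n : deg_at M u n -> deg_at (M \o flip) (flip u) (- n).
Proof.
move=> [r0 r00 H]; exists r0 => // r rr; have [th [cth L] per] := H r rr.
have E t : circle_image (M \o flip) (flip u) r t = circle_image M u r (pi - t).
  rewrite /circle_image /= flipK; congr (M _ - _).
  rewrite /flip /polar /=; have -> : cos (pi - t) = - cos t :> R.
    by rewrite addrC cosDpi cosN.
  have -> : sin (pi - t) = sin t :> R by rewrite addrC sinDpi sinN opprK.
  by apply: injective_projections => /=; ring.
exists (fun t => th (pi - t)).
  split.
    move=> t; apply: (@continuous_comp _ _ _ (fun t => pi - t) th); last exact: cth.
    by apply: cvgB; [exact: cvg_cst|exact: cvg_id].
  by move=> t; rewrite E; exact: L.
move=> t; have := per (pi - (t + 2 * pi)).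
have -> : pi - (t + 2 * pi) + 2 * pi = pi - t :> R by ring.
rewrite mulrNz => ->; ring.
Qed.

End DegreeComposition.

(** * Orientation of parametrizations under a homeomorphism *)

Section SurfaceOrientation.
Variable R : realType.
Implicit Types (T : surface R).

Lemma open_unit_squareE (u : R * R) :
  open_unit_square u = (0 < u.1 < 1 /\ 0 < u.2 < 1).
Proof. by []. Qed.

Lemma open_open_unit_square : open (@open_unit_square R).
Proof.
rewrite openE => u [/andP[h1 h2] /andP[h3 h4]].
have c1 : {for u, continuous (@fst R R)} by exact: cvg_fst.
have c2 : {for u, continuous (@snd R R)} by exact: cvg_snd.
have n1 : \forall w \near u, 0 < w.1 by exact: (cvgr_gt _ c1 _ h1).
have n2 : \forall w \near u, w.1 < 1 by exact: (cvgr_lt _ c1 _ h2).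
have n3 : \forall w \near u, 0 < w.2 by exact: (cvgr_gt _ c2 _ h3).
have n4 : \forall w \near u, w.2 < 1 by exact: (cvgr_lt _ c2 _ h4).
have n12 : \forall w \near u, 0 < w.1 < 1.
  by apply: filterS2 n1 n2 => w w1 w2; apply/andP.
have n34 : \forall w \near u, 0 < w.2 < 1.
  by apply: filterS2 n3 n4 => w w1 w2; apply/andP.
by apply: filterS2 n12 n34.
Qed.

Lemma chart_inj (S : topologicalType) (c : chart R S) x y : is_chart c ->
  cdom c x -> cdom c y -> cmap c x = cmap c y -> x = y.
Proof. by move=> [_ _ ci _ _] cx cy E; rewrite -(ci x cx) E ci. Qed.

(** [k] will be [h], its inverse or the identity; the last case gives the transitions of an
    atlas. *)
Lemma transition_embedding T1 T2 (k : T1 -> T2) (c' : chart R T1) (c : chart R T2) :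
  is_chart c' -> is_chart c -> continuous k -> injective k ->
  local_embedding [set y | (cmap c' @` cdom c') y /\ cdom c (k (cinv c' y))]
    (cmap c \o k \o cinv c').
Proof.
move=> ch' ch ck ik; have [oc' oi' ci' _ _] := ch'; have [oc _ _ _ _] := ch.
have cc' y : (cmap c' @` cdom c') y -> {for y, continuous (cinv c')}.
  by move=> [x cx <-]; exact: chart_inv_continuous.
split.
- rewrite openE => y [iy cy].
  have N1 := open_near oi' iy.
  have N2 : \forall w \near cinv c' y, cdom c (k w).
    by apply: (continuous_near (ck _)); exact: open_near.
  exact: filterS2 N1 (continuous_near (cc' y iy) N2).
- move=> y [iy cy].
  apply: (@continuous_comp _ _ _ (k \o cinv c') (cmap c)); last exact: chart_continuous.
  by apply: (@continuous_comp _ _ _ (cinv c') k); [exact: cc'|exact: ck].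
- move=> y w [[x cx <-] cy] [[x' cx' <-] cw] /= E.
  have := ik _ _ (chart_inj ch cy cw E).
  by rewrite !ci' // => ->.
Qed.

Lemma parametrization_embedding T1 T2 (k : T1 -> T2) (c : chart R T2)
    (rho : R * R -> T1) :
  embeds (@open_unit_square R) rho -> is_chart c -> continuous k -> injective k ->
  local_embedding [set u | open_unit_square u /\ cdom c (k (rho u))]
    (cmap c \o k \o rho).
Proof.
move=> [cr [r' [rK _]]] ch ck ik; have [oc _ _ _ _] := ch.
have cr' u : open_unit_square u -> {for u, continuous rho}.
  exact: open_within_continuous open_open_unit_square cr.
split.
- rewrite openE => u [su cu].
  have N1 := open_near open_open_unit_square su.
  have N2 : \forall w \near rho u, cdom c (k w).
    by apply: (continuous_near (ck _)); exact: open_near.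
  exact: filterS2 N1 (continuous_near (cr' u su) N2).
- move=> u [su cu].
  apply: (@continuous_comp _ _ _ (k \o rho) (cmap c)); last exact: chart_continuous.
  by apply: (@continuous_comp _ _ _ rho k); [exact: cr'|exact: ck].
- move=> u w [su cu] [sw cw] /= E.
  have := ik _ _ (chart_inj ch cu cw E).
  by move=> E'; rewrite -(rK u su) -(rK w sw) E'.
Qed.

Section Dichotomy.
Variables (Sf Sg : surface R) (h : Sf -> Sg) (hinv : Sg -> Sf).
Hypothesis h_homeo : homeomorphism h hinv.
Variable rho : R * R -> Sf.
Hypothesis rho_embeds : embeds (@open_unit_square R) rho.
Hypothesis rho_oriented : forall u c, open_unit_square u -> atlas c ->
  cdom c (rho u) -> preserves_orientation_at (cmap c \o rho) u.

Let deg_everywhere u n := forall c, atlas c -> cdom c (h (rho u)) ->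
  deg_at (cmap c \o h \o rho) u n.

Lemma deg_change_chart u c0 c n : open_unit_square u -> atlas c0 -> atlas c ->
  cdom c0 (h (rho u)) -> cdom c (h (rho u)) ->
  deg_at (cmap c0 \o h \o rho) u n -> deg_at (cmap c \o h \o rho) u n.
Proof.
move=> su a0 a c0u cu H; have [ch chi hK hiK] := h_homeo.
have ch0 := atlas_chart a0; have ch1 := atlas_chart a.
have [_ _ ci0 _ _] := ch0.
have l0 := parametrization_embedding rho_embeds ch0 ch (can_inj hK).
have cid : continuous (@id Sg) by move=> x; exact: cvg_id.
have l1 := transition_embedding ch0 ch1 cid (@inj_id Sg).
have D1 : deg_at (cmap c \o id \o cinv c0) (cmap c0 (h (rho u))) 1.
  by apply/preserves_orientationP; exact: atlas_oriented.
have Ou : [set u | open_unit_square u /\ cdom c0 (h (rho u))] u by [].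
have O'u : [set y | (cmap c0 @` cdom c0) y /\ cdom c (cinv c0 y)]
    ((cmap c0 \o h \o rho) u).
  by split; [exists (h (rho u))|rewrite /= ci0].
have := deg_comp l0 l1 Ou O'u H D1; rewrite mul1r.
apply: deg_ext; have [oO _ _] := l0.
by apply: filterS (open_near oO Ou) => w [_ cw] /=; rewrite ci0.
Qed.

(** In charts [h \o rho] is [rho], of degree 1 by assumption, followed by the local homeomorphism
    [h], of degree 1 or -1. By [deg_change_chart] one chart at [h (rho u)] decides for all. *)
Lemma deg_pm1 u : open_unit_square u -> deg_everywhere u 1 \/ deg_everywhere u (-1).
Proof.
move=> su; have [ch chi hK hiK] := h_homeo.
have [c a cu] := atlas_cover (h (rho u)).
have [c' a' cu'] := atlas_cover (rho u).
have chc := atlas_chart a; have chc' := atlas_chart a'.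
have [_ _ ci _ _] := chc; have [_ _ ci' _ _] := chc'.
have cid : continuous (@id Sf) by move=> x; exact: cvg_id.
have lM := parametrization_embedding rho_embeds chc' cid (@inj_id Sf).
have lK := transition_embedding chc' chc ch (can_inj hK).
have lK' := transition_embedding chc chc' chi (can_inj hiK).
have Ou : [set u | open_unit_square u /\ cdom c' (id (rho u))] u by [].
have DM : deg_at (cmap c' \o id \o rho) u 1.
  by apply/preserves_orientationP; exact: rho_oriented.
set y := (cmap c' \o id \o rho) u.
have Oy : [set y | (cmap c' @` cdom c') y /\ cdom c (h (cinv c' y))] y.
  by split; [exists (rho u)|rewrite /y /= ci'].
have OKy : [set y | (cmap c @` cdom c) y /\ cdom c' (hinv (cinv c y))]
    ((cmap c \o h \o cinv c') y).
  rewrite /y /=; split; first by exists (h (cinv c' (cmap c' (rho u)))); rewrite ?ci'.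
  by rewrite ci' // ci // hK.
have inv : \forall w \near y, (cmap c' \o hinv \o cinv c) ((cmap c \o h \o cinv c') w) = w.
  have [oO _ _] := lK.
  apply: filterS (open_near oO Oy) => w [[x cx <-]] /=.
  by rewrite ci' // => cx'; rewrite ci // hK.
have DE n : deg_at (cmap c \o h \o cinv c') y n -> deg_everywhere u n.
  move=> Dn d ad du; apply: (deg_change_chart su a ad cu du).
  have := deg_comp lM lK Ou Oy DM Dn; rewrite mulr1.
  apply: deg_ext; have [oO _ _] := lM.
  by apply: filterS (open_near oO Ou) => w [_ cw] /=; rewrite ci'.
by have [/DE|/DE] := deg_local_homeo lK lK' Oy OKy inv; [left|right].
Qed.

Lemma deg_everywhere_locally u n : open_unit_square u -> deg_everywhere u n ->
  \forall w \near u, open_unit_square w -> deg_everywhere w n.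
Proof.
move=> su D; have [ch chi hK hiK] := h_homeo.
have [c a cu] := atlas_cover (h (rho u)).
have chc := atlas_chart a.
have l := parametrization_embedding rho_embeds chc ch (can_inj hK).
have Ou : [set u | open_unit_square u /\ cdom c (h (rho u))] u by [].
have [oO _ _] := l.
have N1 := open_near oO Ou.
have N2 := deg_locally_constant l Ou (D c a cu).
apply: filterS2 N1 N2 => w [sw cw] Dw _ d ad dw.
exact: deg_change_chart sw a ad cw dw Dw.
Qed.

Lemma deg_everywhere_exclusive u : deg_everywhere u 1 -> deg_everywhere u (-1) -> False.
Proof.
move=> D1 D2; have [c a cu] := atlas_cover (h (rho u)).
by have := deg_unique (D1 c a cu) (D2 c a cu).
Qed.

(** The degree is locally constant and the square is convex: two points are compared along the
    segment joining them, and the centre of the square fixes the value. *)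
Lemma orientation_dichotomy :
  (forall u, open_unit_square u -> deg_everywhere u 1) \/
  (forall u, open_unit_square u -> deg_everywhere u (-1)).
Proof.
have lc u : open_unit_square u -> \forall w \near u, open_unit_square w ->
    deg_everywhere w 1 = deg_everywhere u 1.
  move=> su; have [D|D] := deg_pm1 su.
    apply: filterS (deg_everywhere_locally su D) => w Hw sw.
    by apply/propext; split=> // _; exact: Hw.
  apply: filterS (deg_everywhere_locally su D) => w Hw sw.
  apply/propext; split=> H; exfalso; first exact: deg_everywhere_exclusive H (Hw sw).
  exact: deg_everywhere_exclusive H D.
have const u v : open_unit_square u -> open_unit_square v ->
    deg_everywhere u 1 = deg_everywhere v 1.
  move=> su sv.
  pose p (s : R) : R * R := u + s *: (v - u).
  have p0 : p 0 = u by rewrite /p scale0r addr0.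
  have p1 : p 1 = v by rewrite /p scale1r addrC subrK.
  have cp : continuous p.
    move=> s; apply: cvgD; first exact: cvg_cst.
    by apply: cvgZ; [exact: cvg_id|exact: cvg_cst].
  have sp s : 0 <= s <= 1 -> open_unit_square (p s).
    move: su sv => [/andP[u1 u2] /andP[u3 u4]] [/andP[v1 v2] /andP[v3 v4]] s01.
    have conv (a b : R) : 0 < a -> 0 < b -> 0 < a + s * (b - a).
      by move=> a0 b0; have := convex_gt0 s01 a0 b0; lra.
    have conv1 (a b : R) : a < 1 -> b < 1 -> a + s * (b - a) < 1.
      move=> a0 b0; have a1 : 0 < 1 - a by lra.
      have b1 : 0 < 1 - b by lra.
      by have := convex_gt0 s01 a1 b1; lra.
    by split; apply/andP; split; first [exact: conv|exact: conv1].
  rewrite -p0 -p1.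
  apply: (@locally_constant_connected R Prop `[0, 1]%classic
    (fun s => deg_everywhere (p s) 1) _ _ 0 1);
    rewrite /= ?in_itv /= ?lexx ?ler01 //; first exact: segment_connected.
  move=> s; rewrite in_itv /= => s01.
  have := continuous_near (cp s) (lc (p s) (sp s s01)).
  by apply: filterS => t Ht; rewrite in_itv /= => t01; apply: Ht; exact: sp.
have half : open_unit_square (2^-1 : R, 2^-1 : R).
  by split; rewrite /open_unit_interval /=; lra.
have [D|D] := deg_pm1 half.
  by left=> u su; rewrite (const u _ su half).
right=> u su; have [Du|//] := deg_pm1 su.
by exfalso; apply: (deg_everywhere_exclusive _ D); rewrite -(const u _ su half).
Qed.

End Dichotomy.

Lemma flip_open_square (u : R * R) : open_unit_square (flip u) <-> open_unit_square u.
Proof.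
by rewrite !open_unit_squareE /flip /=; split=> -[? ?]; split=> //; lra.
Qed.

Lemma flip_square (u : R * R) : unit_square (flip u) <-> unit_square u.
Proof.
rewrite /unit_square /= /flip /unit_interval /=.
by split=> -[/= ? ?]; split=> //=; lra.
Qed.

(* When h reverses the orientation, the parametrization is corrected by a
   reflection of the square. *)
Lemma oriented_image (Sf Sg : surface R) (h : Sf -> Sg) hinv (rho : R * R -> Sf) :
  homeomorphism h hinv -> embeds (@open_unit_square R) rho ->
  (forall u c, open_unit_square u -> atlas c -> cdom c (rho u) ->
     preserves_orientation_at (cmap c \o rho) u) ->
  exists b : bool, let rho' := h \o rho \o (if b then @flip R else id) in
    forall u c, open_unit_square u -> atlas c -> cdom c (rho' u) ->
     preserves_orientation_at (cmap c \o rho') u.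
Proof.
move=> hh er orr; have [D|D] := orientation_dichotomy hh er orr.
  exists false => /= u c su a cu; apply/preserves_orientationP.
  exact: D.
exists true => /= u c su a cu; apply/preserves_orientationP.
have := D (flip u) ((flip_open_square u).2 su) c a cu.
by move=> /deg_flip; rewrite flipK opprK.
Qed.

End SurfaceOrientation.

(** * Transport by a conjugacy *)

Section HomeomorphicImage.
Variables (X Y : topologicalType) (h : X -> Y) (hinv : Y -> X).
Hypothesis hh : homeomorphism h hinv.

Let ch : continuous h. Proof. by case: hh. Qed.
Let chi : continuous hinv. Proof. by case: hh. Qed.
Let hK : cancel h hinv. Proof. by case: hh. Qed.
Let hiK : cancel hinv h. Proof. by case: hh. Qed.

Lemma homeo_imageE (A : set X) : h @` A = hinv @^-1` A.
Proof.
apply/seteqP; split=> y /=; first by move=> [x Ax <-]; rewrite hK.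
by move=> Ay; exists (hinv y).
Qed.

Lemma homeo_mem_image (A : set X) x : (h @` A) (h x) = A x.
Proof. by rewrite homeo_imageE /= hK. Qed.

Lemma homeo_imageK (A : set X) : hinv @` (h @` A) = A.
Proof.
apply/seteqP; split=> x; first by move=> [_ [y Ay <-] <-]; rewrite hK.
by move=> Ax; exists (h x); [exists x|rewrite hK].
Qed.

Lemma homeo_image_inj (A B : set X) : h @` A = h @` B -> A = B.
Proof. by move=> E; rewrite -(homeo_imageK A) E homeo_imageK. Qed.

Lemma homeo_image_eq (A : set X) (B : set Y) : (forall x, A x -> B (h x)) ->
  (forall y, B y -> A (hinv y)) -> B = h @` A.
Proof.
move=> AB BA; apply/seteqP; split=> y; last by move=> [x /AB Bx <-].
by move=> By; exists (hinv y) => //; exact: BA.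
Qed.

Lemma homeo_imageC (A : set X) : h @` (~` A) = ~` (h @` A).
Proof. by rewrite !homeo_imageE. Qed.

Lemma homeo_imageI (A B : set X) : h @` (A `&` B) = h @` A `&` h @` B.
Proof. by rewrite !homeo_imageE. Qed.

Lemma homeo_imageD (A B : set X) : h @` (A `\` B) = h @` A `\` h @` B.
Proof. by rewrite !homeo_imageE. Qed.

Lemma homeo_imageT : h @` setT = setT.
Proof. by rewrite homeo_imageE. Qed.

Lemma homeo_open (A : set X) : open A -> open (h @` A).
Proof. by rewrite homeo_imageE => oA; apply: open_comp => // y _; exact: chi. Qed.

Lemma homeo_connected (A : set X) : connected A -> connected (h @` A).
Proof.
by move=> cA; apply: connected_continuous_connected => //; exact: continuous_subspaceT.
Qed.

Lemma homeo_nonempty (A : set X) : A !=set0 -> h @` A !=set0.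
Proof. by move=> [x Ax]; exists (h x), x. Qed.

Lemma homeo_closure_sub (A : set X) x : closure A x -> closure (h @` A) (h x).
Proof.
move=> cA B NB; have [y [Ay By]] := cA _ (ch NB).
by exists (h y); split=> //; exists y.
Qed.

Lemma homeo_image_set2 x y : h @` [set x; y] = [set h x; h y].
Proof. by rewrite image_setU !image_set1. Qed.

Lemma homeo_component_sub (A : set X) x y : connected_component A x y ->
  connected_component (h @` A) (h x) (h y).
Proof.
move=> [B [Bx BA cB] By]; exists (h @` B); last by exists y.
by split; [exists x|exact: image_subset|exact: homeo_connected].
Qed.

End HomeomorphicImage.

Section HomeomorphicImage2.
Variables (X Y : topologicalType) (h : X -> Y) (hinv : Y -> X).
Hypothesis hh : homeomorphism h hinv.

Lemma homeo_image_sym (B : set Y) : h @` (hinv @` B) = B.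
Proof. exact: (homeo_imageK (homeomorphism_sym hh)). Qed.

Lemma homeo_closure (A : set X) : closure (h @` A) = h @` closure A.
Proof.
apply: (homeo_image_eq hh); first by move=> x; exact: homeo_closure_sub hh _ _.
move=> y /(homeo_closure_sub (homeomorphism_sym hh)).
by rewrite (homeo_imageK hh).
Qed.

Lemma homeo_component (A : set X) x :
  connected_component (h @` A) (h x) = h @` connected_component A x.
Proof.
apply: (homeo_image_eq hh); first by move=> y; exact: homeo_component_sub hh _ _ _.
move=> y /(homeo_component_sub (homeomorphism_sym hh)).
by have [_ _ hK _] := hh; rewrite (homeo_imageK hh) hK.
Qed.

Definition image_sets (D : set (set X)) : set (set Y) := [set h @` A | A in D].

Lemma image_sets_eq (D : set (set X)) (D' : set (set Y)) :
  (forall A, D A -> D' (h @` A)) -> (forall B, D' B -> D (hinv @` B)) ->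
  D' = image_sets D.
Proof.
move=> H1 H2; apply/seteqP; split=> B.
  by move=> D'B; exists (hinv @` B); [exact: H2|rewrite homeo_image_sym].
by move=> [A DA <-]; exact: H1.
Qed.

Lemma bigcup_image_sets (D : set (set X)) (P : set X -> set X) (Q : set Y -> set Y) :
  (forall A, D A -> Q (h @` A) = h @` P A) ->
  \bigcup_(B in image_sets D) Q B = h @` \bigcup_(A in D) P A.
Proof.
move=> QP; apply/seteqP; split=> y.
  move=> [_ [A DA <-]]; rewrite QP // => -[x PAx <-].
  by exists x => //; exists A.
by move=> [x [A DA PAx] <-]; exists (h @` A); [exists A|rewrite QP //; exists x].
Qed.

End HomeomorphicImage2.

Lemma image_setsK (X Y : topologicalType) (h : X -> Y) hinv (D : set (set X)) :
  homeomorphism h hinv -> image_sets hinv (image_sets h D) = D.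
Proof.
move=> hh; apply/seteqP; split=> A.
  by move=> [_ [B DB <-] <-]; rewrite (homeo_imageK hh).
by move=> DA; exists (h @` A); [exists A|rewrite (homeo_imageK hh)].
Qed.

(** * Transport of leaves, arcs and separatrices *)

Section FoliationImage.
Variables (R : realType) (S T : surface R) (h : S -> T) (hinv : T -> S).
Variables (F : measured_foliation S) (G : measured_foliation T).

(** Both directions are required, which makes the relation symmetric: a notion is carried forward
    once, and the converse is the same statement for [hinv]. *)
Record foliation_conj : Prop := FoliationConj {
  folc_homeo : homeomorphism h hinv;
  folc_path : forall X, leaf_path F X -> leaf_path G (h \o X);
  folc_path_inv : forall X, leaf_path G X -> leaf_path F (hinv \o X) }.

End FoliationImage.

Lemma foliation_conj_sym (R : realType) (S T : surface R) (h : S -> T) hinv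
    (F : measured_foliation S) (G : measured_foliation T) :
  foliation_conj h hinv F G -> foliation_conj hinv h G F.
Proof. by move=> [hh p q]; split=> //; exact: homeomorphism_sym. Qed.

Section FoliationForward.
Variables (R : realType) (S T : surface R) (h : S -> T) (hinv : T -> S).
Variables (F : measured_foliation S) (G : measured_foliation T).
Hypothesis fc : foliation_conj h hinv F G.

Let hh := folc_homeo fc.
Let hK : cancel h hinv. Proof. by case: hh. Qed.
Let hiK : cancel hinv h. Proof. by case: hh. Qed.

Lemma leaf_component_forward A x y :
  leaf_component F A x y -> leaf_component G (h @` A) (h x) (h y).
Proof.
move=> [X [lX X0 X1 XA]]; exists (h \o X); split.
- exact: folc_path fc _ lX.
- by rewrite /= X0.
- by rewrite /= X1.
- by rewrite -image_comp; exact: image_subset.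
Qed.

Lemma leaf_arc_param_forward X : leaf_arc_param F X -> leaf_arc_param G (h \o X).
Proof.
move=> [lX iX]; split; first exact: folc_path fc _ lX.
by move=> s t us ut /= /(can_inj hK); exact: iX.
Qed.

Lemma leaf_arc_forward I a b : leaf_arc F I a b -> leaf_arc G (h @` I) (h a) (h b).
Proof.
move=> [X [pX X0 X1 ->]]; exists (h \o X); split.
- exact: leaf_arc_param_forward.
- by rewrite /= X0.
- by rewrite /= X1.
- by rewrite image_comp.
Qed.

End FoliationForward.

Section FoliationTransport.
Variables (R : realType) (S T : surface R) (h : S -> T) (hinv : T -> S).
Variables (F : measured_foliation S) (G : measured_foliation T).
Hypothesis fc : foliation_conj h hinv F G.

Let hh := folc_homeo fc.
Let fc' := foliation_conj_sym fc.
Let hK : cancel h hinv. Proof. by case: hh. Qed.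
Let hiK : cancel hinv h. Proof. by case: hh. Qed.

Lemma leaf_component_image A x :
  leaf_component G (h @` A) (h x) = h @` leaf_component F A x.
Proof.
apply: (homeo_image_eq hh); first by move=> y; exact: (leaf_component_forward fc).
by move=> y /(leaf_component_forward fc'); rewrite (homeo_imageK hh) hK.
Qed.

Lemma leaf_image x : leaf G (h x) = h @` leaf F x.
Proof. by rewrite -leaf_component_image (homeo_imageT hh). Qed.

Lemma leaf_arc_image I a b : leaf_arc G (h @` I) (h a) (h b) <-> leaf_arc F I a b.
Proof.
split; last exact: (leaf_arc_forward fc).
by move=> /(leaf_arc_forward fc'); rewrite (homeo_imageK hh) !hK.
Qed.

Lemma separatrix_forward p A : separatrix F p A -> separatrix G (h p) (h @` A).
Proof.
move=> [x [lx xp ->]]; exists (h x); split.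
- by rewrite leaf_image; exists x.
- by move=> /(can_inj hK).
- by rewrite -leaf_component_image (homeo_imageC hh) image_set1.
Qed.

Lemma is_endpoint_image I : is_endpoint G (h @` I) = h @` is_endpoint F I.
Proof.
apply: (homeo_image_eq hh) => a.
  by move=> [b /leaf_arc_image H]; exists (h b).
move=> [b H]; exists (hinv b); apply/leaf_arc_image.
by rewrite !hiK.
Qed.

Lemma support_image (D : set (set S)) : Defs.support (image_sets h D) = h @` Defs.support D.
Proof. by apply: (@bigcup_image_sets _ _ h D id id). Qed.

Lemma regular_part_image (D : set (set S)) :
  regular_part G (image_sets h D) = h @` regular_part F D.
Proof.
rewrite /regular_part (homeo_imageD hh) support_image; congr (_ `\` _).
by apply: bigcup_image_sets => I _; exact: is_endpoint_image.
Qed.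

End FoliationTransport.

Record conjugacy (R : realType) (Sf Sg : surface R) (f : pseudo_anosov Sf)
    (g : pseudo_anosov Sg) (h : Sf -> Sg) (hinv : Sg -> Sf) : Prop := Conjugacy {
  conj_stable : foliation_conj h hinv (stable f) (stable g);
  conj_unstable : foliation_conj h hinv (unstable f) (unstable g);
  conj_comm : forall x, g (h x) = h (f x);
  conj_marked : marked g = h @` marked f }.

Lemma conjugacy_sym (R : realType) (Sf Sg : surface R) (f : pseudo_anosov Sf)
    (g : pseudo_anosov Sg) h hinv :
  conjugacy f g h hinv -> conjugacy g f hinv h.
Proof.
move=> [cs cu cc cm]; split.
- exact: foliation_conj_sym.
- exact: foliation_conj_sym.
- exact: conj_comm_sym (folc_homeo cs) cc.
- by rewrite cm (homeo_imageK (folc_homeo cs)).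
Qed.

(** When there are singularities [marked] consists of them, and [conj_singular] applies both ways.
    Without singularities it is a chosen family, which the dynamics does not determine: the
    assumption supplies it. *)
Lemma conjugacy_of_homeomorphism (R : realType) (Sf Sg : surface R)
    (f : pseudo_anosov Sf) (g : pseudo_anosov Sg) (h : Sf -> Sg) (hinv : Sg -> Sf) :
  homeomorphism h hinv -> (forall x, g (h x) = h (f x)) ->
  (fsing (stable f) = set0 -> marked g = h @` marked f) -> conjugacy f g h hinv.
Proof.
move=> hh cc hm; have hh' := homeomorphism_sym hh.
have cc' := conj_comm_sym hh cc.
split=> //.
- split=> // X; first exact: conj_stable_path hh cc X.
  exact: conj_stable_path hh' cc' X.
- split=> // X; first exact: conj_unstable_path hh cc X.
  exact: conj_unstable_path hh' cc' X.
have [/hm//|/eqP/set0P ne] := pselect (fsing (stable f) = set0).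
have E : fsing (stable g) = h @` fsing (stable f).
  apply: (homeo_image_eq hh) => x; first exact: conj_singular hh cc x.
  exact: conj_singular hh' cc' x.
rewrite (marked_singular ne) marked_singular // E.
exact: homeo_nonempty.
Qed.

Lemma within_continuous_precomp (X Y Z : topologicalType) (A : set X) (B : set Y)
    (f : Y -> Z) (p : X -> Y) :
  {within B, continuous f} -> continuous p -> (forall x, A x -> B (p x)) ->
  {within A, continuous (f \o p)}.
Proof.
move=> cf cp pAB; apply/subspace_continuousP => x Ax V NV.
have := continuous_near (cp x) (within_near cf (pAB x Ax) NV).
by apply: filterS => y H Ay; apply: H; exact: pAB.
Qed.

(** * Reflection of the square and reflected parametrizations *)

Section Reflection.
Variable R : realType.

Definition reflect_coord (b : bool) (c : R) : R := if b then 1 - c else c.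

Definition reflect b : R * R -> R * R := if b then @flip R else id.

Lemma reflectE b u : reflect b u = (reflect_coord b u.1, u.2).
Proof. by case: b => //; case: u. Qed.

Lemma reflect_coordK b : involutive (reflect_coord b).
Proof. by case: b => c //=; rewrite subKr. Qed.

Lemma reflectK b : involutive (reflect b).
Proof. by case: b => //; exact: flipK. Qed.

Lemma continuous_reflect b : continuous (reflect b).
Proof. by case: b => u; [exact: continuous_flip|exact: cvg_id]. Qed.

Lemma reflect_coord_unit b (c : R) : unit_interval (reflect_coord b c) <-> unit_interval c.
Proof. by case: b => //; rewrite /unit_interval /=; split; lra. Qed.

Lemma reflect_square b (u : R * R) : unit_square (reflect b u) <-> unit_square u.
Proof. by case: b => //; exact: flip_square. Qed.

Lemma reflect_open_square b (u : R * R) :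
  open_unit_square (reflect b u) <-> open_unit_square u.
Proof. by case: b => //; exact: flip_open_square. Qed.

Lemma image_reflect (T : Type) b (rho : R * R -> T) (A : set (R * R)) :
  (forall u, A (reflect b u) <-> A u) -> (rho \o reflect b) @` A = rho @` A.
Proof.
move=> H; apply/seteqP; split=> y.
  by move=> [u Au <-]; exists (reflect b u) => //; apply/H.
by move=> [u Au <-]; exists (reflect b u); [apply/H|rewrite /= reflectK].
Qed.

Section Leaves.
Variables (S T : surface R) (h : S -> T) (b : bool) (rho : R * R -> S).
Let rho' := h \o rho \o reflect b.

Lemma hleaf_image c : hleaf rho' c = h @` hleaf rho c.
Proof.
apply/seteqP; split=> y.
  move=> [t ut <-]; exists (rho (reflect_coord b t, c)); last by rewrite /rho' /= reflectE.
  by exists (reflect_coord b t) => //; apply/reflect_coord_unit.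
move=> [_ [t ut <-] <-]; exists (reflect_coord b t); first by apply/reflect_coord_unit.
by rewrite /rho' /= reflectE /= reflect_coordK.
Qed.

Lemma vleaf_image c : vleaf rho' c = h @` vleaf rho (reflect_coord b c).
Proof.
apply/seteqP; split=> y.
  by move=> [t ut <-]; exists (rho (reflect_coord b c, t)); [exists t|rewrite /rho' /= reflectE].
by move=> [_ [t ut <-] <-]; exists t => //; rewrite /rho' /= reflectE.
Qed.

Lemma sboundary_image : sboundary rho' = h @` sboundary rho.
Proof. by rewrite /sboundary !hleaf_image image_setU. Qed.

Lemma uboundary_image : uboundary rho' = h @` uboundary rho.
Proof.
rewrite /uboundary !vleaf_image /reflect_coord image_setU.
by case: b; rewrite // subr0 subrr setUC.
Qed.

Lemma rect_interior_image : rect_interior rho' = h @` rect_interior rho.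
Proof.
rewrite /rect_interior image_comp; apply: image_reflect => u.
exact: reflect_open_square.
Qed.

Lemma corners_image : corners rho' = h @` corners rho.
Proof.
rewrite /corners image_setU !image_setU !image_set1 /rho' /= !reflectE /=.
rewrite /reflect_coord; case: b => //.
by rewrite subr0 subrr setUC.
Qed.

Lemma square_image : rho' @` @unit_square R = h @` (rho @` @unit_square R).
Proof.
rewrite image_comp; apply: image_reflect => u; exact: reflect_square.
Qed.

Lemma embeds_image hinv (A : set (R * R)) : homeomorphism h hinv ->
  (forall u, A (reflect b u) <-> A u) -> embeds A rho -> embeds A rho'.
Proof.
move=> [ch chi hK hiK] HA [cr [r' [rK cr']]]; split.
  apply: (@within_continuous_precomp _ _ _ A A (h \o rho)).
  - by apply: within_continuous_comp => // y _; exact: ch.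
  - exact: continuous_reflect.
  - by move=> u Au; apply/HA.
exists (reflect b \o r' \o hinv); split.
  move=> u Au; rewrite /rho' /= hK rK ?reflectK //; exact/HA.
apply: (@within_continuous_precomp _ _ _ _ (rho @` A) (reflect b \o r')) => //.
  by apply: within_continuous_comp => // y _; exact: continuous_reflect.
move=> _ [u Au <-]; rewrite /rho' /= hK; exists (reflect b u) => //; exact/HA.
Qed.

End Leaves.

(** A reflected parametrization runs its horizontal leaves backwards. *)
Lemma leaf_arc_param_reverse (S : surface R) (F : measured_foliation S) X :
  leaf_arc_param F X -> leaf_arc_param F (fun t => X (1 - t)).
Proof.
move=> [lX iX].
have u1 (t : R) : unit_interval t -> unit_interval (1 - t).
  by rewrite /unit_interval /=; lra.
split.
  apply: (@leaf_path_reparam R S F X (fun t => 1 - t)) => //.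
  by move=> t; apply: cvgB; [exact: cvg_cst|exact: cvg_id].
move=> s t /set_mem us /set_mem ut E.
have := iX (1 - s) (1 - t) (mem_set (u1 s us)) (mem_set (u1 t ut)) E.
by move=> E'; lra.
Qed.

End Reflection.

(** * Transport of rectangles, first intersection points and rails *)

Section Forward.
Variables (R : realType) (Sf Sg : surface R) (f : pseudo_anosov Sf)
  (g : pseudo_anosov Sg) (h : Sf -> Sg) (hinv : Sg -> Sf).
Hypothesis cj : conjugacy f g h hinv.

Let cs := conj_stable cj.
Let cu := conj_unstable cj.
Let hh := folc_homeo cs.
Let ch : continuous h. Proof. by case: hh. Qed.
Let hK : cancel h hinv. Proof. by case: hh. Qed.
Let hiK : cancel hinv h. Proof. by case: hh. Qed.

Lemma closed_interval_like_forward A :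
  closed_interval_like A -> closed_interval_like (h @` A).
Proof.
move=> [X [cX iX ->]]; exists (h \o X); split.
- by apply: within_continuous_comp => // y _; exact: ch.
- by move=> s t us ut /= /(can_inj hK); exact: iX.
- by rewrite image_comp.
Qed.

Lemma trivially_bifoliated_forward r :
  trivially_bifoliated f r -> trivially_bifoliated g (h @` r).
Proof.
move=> [or_ cr ner H]; split.
- exact: homeo_open hh _ or_.
- exact: homeo_connected hh _ cr.
- exact: homeo_nonempty.
move=> _ _ [x rx <-] [y ry <-] /=.
rewrite (leaf_component_image cs) (leaf_component_image cu) !(homeo_closure hh).
have [I1 I2 [w rw E]] := H x y rx ry; split.
- exact: closed_interval_like_forward.
- exact: closed_interval_like_forward.
- by exists (h w); [exists w|rewrite -(homeo_imageI hh) E image_set1].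
Qed.

Lemma rectangle_forward A : rectangle f A -> rectangle g (h @` A).
Proof.
move=> [r tr ->]; exists (h @` r); first exact: trivially_bifoliated_forward.
by rewrite (homeo_closure hh).
Qed.

Lemma marked_image x : marked g (h x) = marked f x.
Proof. by rewrite (conj_marked cj) (homeo_mem_image hh). Qed.

Lemma iter_conj n x : iter n g (h x) = h (iter n f x).
Proof. by elim: n => //= n ->; rewrite (conj_comm cj). Qed.

Lemma first_intersection_forward x : first_intersection f x -> first_intersection g (h x).
Proof.
move=> [nx [p [q [A [B [[mp mq] [sA sB] [Ax Bx] [I [J [aI aJ E]]]]]]]]].
split; first by rewrite marked_image.
exists (h p), (h q), (h @` A), (h @` B); split.
- by rewrite !marked_image.
- by split; [exact: separatrix_forward cs _ _ sA|exact: separatrix_forward cu _ _ sB].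
- by split; exists x.
exists (h @` I), (h @` J); split.
- exact/(leaf_arc_image cs).
- exact/(leaf_arc_image cu).
- rewrite -(image_set1 h p) -(image_set1 h q) -!(homeo_imageD hh).
  by rewrite -(homeo_imageI hh) E image_set1.
Qed.

Lemma Ju_forward z x : Ju f z x -> Ju g (h z) (h x).
Proof.
move=> [q [J [mq aJ Jx]]]; exists (h q), (h @` J); split.
- by rewrite marked_image.
- exact/(leaf_arc_image cu).
- by exists x.
Qed.

Lemma periodic_forward x : Defs.periodic f x -> Defs.periodic g (h x).
Proof. by move=> [n n0 E]; exists n => //; rewrite iter_conj E. Qed.

Lemma parametrizes_forward rho A : parametrizes f rho A ->
  exists b, parametrizes g (h \o rho \o reflect b) (h @` A).
Proof.
move=> [[cr AE] er orr hp vp].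
have [b Hb] := oriented_image hh er orr.
exists b; split.
- split; last by rewrite square_image -AE.
  apply: (@within_continuous_precomp _ _ _ _ (@unit_square R) (h \o rho)).
  + by apply: within_continuous_comp => // y _; exact: ch.
  + exact: continuous_reflect.
  + by move=> u su; apply/reflect_square.
- exact: (embeds_image hh (@reflect_open_square R b) er).
- exact: Hb.
- move=> c uc; case: b {Hb}; last exact: leaf_arc_param_forward cs _ (hp c uc).
  exact: leaf_arc_param_forward cs _ (leaf_arc_param_reverse (hp c uc)).
- move=> c uc.
  have -> : (fun t => (h \o rho \o reflect b) (c, t)) =
      h \o (fun t => rho (reflect_coord b c, t)).
    by apply/funext => t; rewrite /= reflectE.
  apply: leaf_arc_param_forward cu _ (vp _ _); exact/reflect_coord_unit.
Qed.

Lemma subrectangle_forward F G H A intA : foliation_conj h hinv F G ->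
  subrectangle f F H A intA -> subrectangle g G (h @` H) (h @` A) (h @` intA).
Proof.
move=> fc [rH HA [sg psg E]]; split.
- exact: rectangle_forward.
- exact: image_subset.
have [b pb] := parametrizes_forward psg.
exists (h \o sg \o reflect b) => //.
rewrite rect_interior_image => _ [x ix <-].
by rewrite !(leaf_component_image fc) E.
Qed.

Lemma regular_rail_forward (F G : measured_foliation Sf) (F' G' : measured_foliation Sg)
    delta J :
  foliation_conj h hinv F F' -> foliation_conj h hinv G G' ->
  regular_rail F G delta J -> regular_rail F' G' (image_sets h delta) (h @` J).
Proof.
move=> fF fG [a [b [aJ E ra rb]]]; exists (h a), (h b).
rewrite (regular_part_image fG); split.
- exact/(leaf_arc_image fF).
- rewrite (support_image h) -(homeo_image_set2 h) -(homeo_imageD hh) -(homeo_imageI hh).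
  by rewrite E image_set0.
- by exists a.
- by exists b.
Qed.

(** [phi b] is the effect of the reflection on the index of the leaves [along]: [reflect_coord b]
    for vertical ones, the identity for horizontal ones. Both kinds of rails are thus treated at
    once; the exceptional side [c0] becomes [phi s c0]. *)
Lemma extreme_rail_forward (F G : measured_foliation Sf) (F' G' : measured_foliation Sg)
    (along across along' across' : _) delta J (phi : bool -> R -> R) :
  foliation_conj h hinv F F' -> foliation_conj h hinv G G' ->
  (forall b rho c, along' (h \o rho \o reflect b) c = h @` along rho (phi b c)) ->
  (forall b rho, across' (h \o rho \o reflect b) 0 `|` across' (h \o rho \o reflect b) 1
     = h @` (across rho 0 `|` across rho 1)) ->
  (forall b, involutive (phi b)) ->
  (forall b c, unit_interval (phi b c) <-> unit_interval c) ->
  (forall b c, c = 0 \/ c = 1 -> phi b c = 0 \/ phi b c = 1) ->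
  extreme_rail f F G along across delta J ->
  extreme_rail g F' G' along' across' (image_sets h delta) (h @` J).
Proof.
move=> fF fG alE acE phiK phiu phi01 [a [b [aJ nab [A [rho [c0 [[rA pA] er ac [c01 JE] reg]]]]]]].
exists (h a), (h b); split.
- exact/(leaf_arc_image fF).
- by rewrite (regular_part_image fG) !(homeo_mem_image hh).
have [s ps] := parametrizes_forward pA.
exists (h @` A), (h \o rho \o reflect s), (phi s c0); split.
- by split=> //; exact: rectangle_forward.
- exact: (embeds_image hh (@reflect_square R s) er).
- by rewrite acE (support_image h); exact: image_subset.
- by split; [exact: phi01|rewrite alE phiK JE].
move=> c uc cc0; rewrite alE; apply: (regular_rail_forward fF fG).
by apply: reg; [exact/phiu|move=> E; apply: cc0; rewrite -E phiK].
Qed.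

Lemma extreme_urail_forward delta J :
  extreme_rail f (unstable f) (stable f) (@vleaf R Sf) (@hleaf R Sf) delta J ->
  extreme_rail g (unstable g) (stable g) (@vleaf R Sg) (@hleaf R Sg)
    (image_sets h delta) (h @` J).
Proof.
apply: (extreme_rail_forward (phi := @reflect_coord R) cu cs).
- by move=> b rho c; exact: vleaf_image.
- by move=> b rho; exact: sboundary_image.
- exact: reflect_coordK.
- exact: reflect_coord_unit.
- by case=> c [] -> /=; rewrite ?subr0 ?subrr; auto.
Qed.

Lemma extreme_srail_forward delta J :
  extreme_rail f (stable f) (unstable f) (@hleaf R Sf) (@vleaf R Sf) delta J ->
  extreme_rail g (stable g) (unstable g) (@hleaf R Sg) (@vleaf R Sg)
    (image_sets h delta) (h @` J).
Proof.
apply: (extreme_rail_forward (phi := fun=> id) cs cu) => //.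
- by move=> b rho c; exact: hleaf_image.
- by move=> b rho; exact: uboundary_image.
Qed.

End Forward.

(** * Transport of graphs and compatibility *)

Section Equalities.
Variables (R : realType) (Sf Sg : surface R) (f : pseudo_anosov Sf)
  (g : pseudo_anosov Sg) (h : Sf -> Sg) (hinv : Sg -> Sf).
Hypothesis cj : conjugacy f g h hinv.

Let cs := conj_stable cj.
Let cu := conj_unstable cj.
Let hh := folc_homeo cs.
Let cj' := conjugacy_sym cj.
Let hK : cancel h hinv. Proof. by case: hh. Qed.
Let hiK : cancel hinv h. Proof. by case: hh. Qed.

Lemma Ju_image z : Ju g (h z) = h @` Ju f z.
Proof.
apply: (homeo_image_eq hh) => [x|y]; first exact: (Ju_forward cj).
by move=> /(Ju_forward cj'); rewrite hK.
Qed.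

Lemma cal_Ju_image z : cal_Ju g (h z) = h @` cal_Ju f z.
Proof.
apply: (homeo_image_eq hh) => [x|y] [i _ /=].
  by move=> H; exists i => //=; rewrite (iter_conj cj) Ju_image (homeo_mem_image hh).
rewrite Ju_image => H; exists i => //=.
by rewrite (iter_conj cj') -(homeo_mem_image hh) hiK.
Qed.

Lemma periodic_image : Defs.periodic g = h @` Defs.periodic f.
Proof.
apply: (homeo_image_eq hh) => [x|y]; first exact: (periodic_forward cj).
exact: (periodic_forward cj').
Qed.

Lemma image_eq0_homeo (A : set Sf) : h @` A = set0 <-> A = set0.
Proof.
split=> [E|->]; last exact: image_set0.
by apply: (homeo_image_inj hh); rewrite image_set0.
Qed.

Lemma cut_arc_image (I A : set Sf) p x :
  (h @` I `\` [set h p; h x]) `&` h @` A = set0 <-> (I `\` [set p; x]) `&` A = set0.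
Proof.
rewrite -(homeo_image_set2 h) -(homeo_imageD hh) -(homeo_imageI hh).
exact: image_eq0_homeo.
Qed.

(** That the interior of [I] avoids [cal_Ju] is a negative condition, for which an inclusion would
    not do: the equality [cal_Ju_image] is used. *)
Lemma delta_s_forward z I : delta_s f z I -> delta_s g (h z) (h @` I).
Proof.
move=> [p [x [aI mp Jx E]]]; exists (h p), (h x); split.
- exact/(leaf_arc_image cs).
- by rewrite (marked_image cj).
- by rewrite cal_Ju_image (homeo_mem_image hh).
- by rewrite cal_Ju_image; apply/cut_arc_image.
Qed.

Lemma image_family_image n (D : set (set Sf)) :
  image_family g n (image_sets h D) = image_sets h (image_family f n D).
Proof.
have E (I : set Sf) : iter n g @` (h @` I) = h @` (iter n f @` I).
  rewrite !image_comp; apply: eq_imagel => x _ /=; exact: (iter_conj cj).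
apply/seteqP; split=> B.
  move=> [_ [I DI <-] <-]; rewrite E; exists (iter n f @` I) => //; by exists I.
by move=> [_ [I DI <-] <-]; rewrite -E; exists (h @` I) => //; exists I.
Qed.

(** Extreme rails occur as hypotheses: those of the image are first carried back by [hinv], then the
    inclusion obtained is carried forward. *)
Lemma compatible_forward ds du : compatible f ds du ->
  compatible g (image_sets h ds) (image_sets h du).
Proof.
move=> [H1 H2 H3 H4]; rewrite /compatible !(support_image h); split.
- move=> _ a [I dI <-]; rewrite (is_endpoint_image cs) => -[x ex <-].
  by exists x => //; exact: H1 dI ex.
- move=> _ a [I dI <-]; rewrite (is_endpoint_image cu) => -[x ex <-].
  by exists x => //; exact: H2 dI ex.
- move=> J /(extreme_urail_forward cj'); rewrite (image_setsK _ hh) => /H3 JD y Jy.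
  by exists (hinv y) => //; apply: JD; exists y.
- move=> J /(extreme_srail_forward cj'); rewrite (image_setsK _ hh) => /H4 JD y Jy.
  by exists (hinv y) => //; apply: JD; exists y.
Qed.

End Equalities.

Section Families.
Variables (R : realType) (Sf Sg : surface R) (f : pseudo_anosov Sf)
  (g : pseudo_anosov Sg) (h : Sf -> Sg) (hinv : Sg -> Sf).
Hypothesis cj : conjugacy f g h hinv.

Let cs := conj_stable cj.
Let cu := conj_unstable cj.
Let hh := folc_homeo cs.
Let cj' := conjugacy_sym cj.
Let hK : cancel h hinv. Proof. by case: hh. Qed.
Let hiK : cancel hinv h. Proof. by case: hh. Qed.

Lemma delta_s_image z : delta_s g (h z) = image_sets h (delta_s f z).
Proof.
apply: (image_sets_eq hh) => [I|J]; first exact: (delta_s_forward cj).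
by move=> /(delta_s_forward cj'); rewrite hK.
Qed.

Lemma support_delta_s_image z :
  Defs.support (delta_s g (h z)) = h @` Defs.support (delta_s f z).
Proof. by rewrite delta_s_image (support_image h). Qed.

(** Avoiding the support of [delta_s] is again a negative condition, so the equality for that
    support had to come first. *)
Lemma delta_u_forward z I : delta_u f z I -> delta_u g (h z) (h @` I).
Proof.
move=> [p [x [aI mp Jx E]]]; exists (h p), (h x); split.
- exact/(leaf_arc_image cu).
- by rewrite (marked_image cj).
- by rewrite support_delta_s_image (homeo_mem_image hh).
- by rewrite support_delta_s_image; apply/(cut_arc_image cj).
Qed.

End Families.

(** * Transport of compatibility coefficients and Markov partitions *)

Section Final.
Variables (R : realType) (Sf Sg : surface R) (f : pseudo_anosov Sf)
  (g : pseudo_anosov Sg) (h : Sf -> Sg) (hinv : Sg -> Sf).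
Hypothesis cj : conjugacy f g h hinv.

Let cs := conj_stable cj.
Let cu := conj_unstable cj.
Let hh := folc_homeo cs.
Let cj' := conjugacy_sym cj.
Let hK : cancel h hinv. Proof. by case: hh. Qed.
Let hiK : cancel hinv h. Proof. by case: hh. Qed.

Lemma delta_u_image z : delta_u g (h z) = image_sets h (delta_u f z).
Proof.
apply: (image_sets_eq hh) => [I|J]; first exact: (delta_u_forward cj).
by move=> /(delta_u_forward cj'); rewrite hK.
Qed.

Lemma iterated_delta_u_image z n : image_family g n (delta_u g (h z)) =
  image_sets h (image_family f n (delta_u f z)).
Proof. by rewrite delta_u_image (image_family_image cj). Qed.

Lemma compatible_image ds du :
  compatible g (image_sets h ds) (image_sets h du) <-> compatible f ds du.
Proof.
split; last exact: (compatible_forward cj).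
by move=> /(compatible_forward cj'); rewrite !(image_setsK _ hh).
Qed.

Lemma compatibility_coefficient_image z n :
  compatibility_coefficient g (h z) n <-> compatibility_coefficient f z n.
Proof.
have E k : compatible g (delta_s g (h z)) (image_family g k (delta_u g (h z))) <->
    compatible f (delta_s f z) (image_family f k (delta_u f z)).
  by rewrite (delta_s_image cj) iterated_delta_u_image; exact: compatible_image.
split=> -[H1 H2]; split.
- by move=> k nk; apply/E; exact: H1.
- by move=> m Hm; apply: H2 => k mk; apply/E; exact: Hm.
- by move=> k nk; apply/E; exact: H1.
- by move=> m Hm; apply: H2 => k mk; apply/E; exact: Hm.
Qed.

Lemma primitive_rectangles_image z n :
  primitive_rectangles g (h z) n = image_sets h (primitive_rectangles f z n).
Proof.
rewrite /primitive_rectangles iterated_delta_u_image (delta_s_image cj).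
rewrite !(support_image h) -image_setU -(homeo_imageC hh).
apply/seteqP; split=> B.
  move=> [_ [x Cx <-] <-]; rewrite (homeo_component hh) (homeo_closure hh).
  by eexists; last reflexivity; exists x.
move=> [_ [x Cx <-] <-]; exists (h x); first by exists x.
by rewrite (homeo_component hh) (homeo_closure hh).
Qed.

Lemma preimage_image (A : set Sf) : g @^-1` (h @` A) = h @` (f @^-1` A).
Proof.
rewrite !(homeo_imageE hh); apply/seteqP; split=> y /=.
  by rewrite (conj_comm cj').
by rewrite (conj_comm cj').
Qed.

Lemma image_image_conj (A : set Sf) : g @` (h @` A) = h @` (f @` A).
Proof. by rewrite !image_comp; apply: eq_imagel => x _ /=; exact: conj_comm cj _. Qed.

(** The reflection [b A] may vary with the rectangle. It does not affect [rect_interior], through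
    which all conditions on pairs of rectangles are expressed. *)
Lemma markov_image (RR : set (set Sf)) (rho : set Sf -> R * R -> Sf) rho'
    (b : set Sf -> bool) :
  (forall A, RR A -> rho' (h @` A) = h \o rho A \o reflect (b A)) ->
  (forall A, RR A -> parametrizes g (rho' (h @` A)) (h @` A)) ->
  markov_partition f RR rho -> markov_partition g (image_sets h RR) rho'.
Proof.
move=> rhoE rhoP [fin rp cov dis mk].
have intE A : RR A -> rect_interior (rho' (h @` A)) = h @` rect_interior (rho A).
  by move=> RA; rewrite rhoE // rect_interior_image.
split.
- exact: finite_image.
- move=> _ [A RA <-]; split; last exact: rhoP.
  by apply: (rectangle_forward cj); exact: (rp A RA).1.
- rewrite (@bigcup_image_sets _ _ h RR id id) //.
  by rewrite [X in h @` X]cov (homeo_imageT hh).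
- move=> _ _ [A RA <-] [B RB <-] AB.
  rewrite !intE // -(homeo_imageI hh) dis ?image_set0 // => E.
  by apply: AB; rewrite E.
move=> _ _ [A RA <-] [B RB <-] intA intB; rewrite /intA /intB !intE //.
have [M1 M2] := mk A B RA RB.
split=> y.
  rewrite preimage_image -(homeo_imageI hh) => -[x Cx <-].
  rewrite (homeo_component hh) (homeo_closure hh).
  by apply: (subrectangle_forward cj cs); exact: M1.
rewrite image_image_conj -(homeo_imageI hh) => -[x Cx <-].
rewrite (homeo_component hh) (homeo_closure hh).
by apply: (subrectangle_forward cj cu); exact: M2.
Qed.

Lemma primitive_markov_partition_image z n (RR : set (set Sf)) :
  primitive_markov_partition f z n RR ->
  primitive_markov_partition g (h z) n (image_sets h RR).
Proof.
move=> [RE [rho [mk ad sb ub]]]; split; first by rewrite RE primitive_rectangles_image.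
(* A reflection is known only for members of [RR]; elsewhere the value [true] is arbitrary and lets
   [choice] produce one function [b]. *)
have H A : exists b, RR A -> parametrizes g (h \o rho A \o reflect b) (h @` A).
  have [RA|nRA] := pselect (RR A); last by exists true.
  have [_ rp _ _ _] := mk; have [b pb] := parametrizes_forward cj (rp A RA).2.
  by exists b.
have [b bP] := choice H.
(* Parametrizations are indexed by sets of the target; the rectangle behind [B] is recovered as its
   image by [hinv]. *)
pose rho' B := h \o rho (hinv @` B) \o reflect (b (hinv @` B)).
have rhoE A : rho' (h @` A) = h \o rho A \o reflect (b A).
  by rewrite /rho' (homeo_imageK hh).
have sE : partition_sboundary (image_sets h RR) rho' = h @` partition_sboundary RR rho.
  apply: (@bigcup_image_sets _ _ h RR (fun A => sboundary (rho A)) (fun B => sboundary (rho' B))).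
  by move=> A RA; rewrite rhoE sboundary_image.
have uE : partition_uboundary (image_sets h RR) rho' = h @` partition_uboundary RR rho.
  apply: (@bigcup_image_sets _ _ h RR (fun A => uboundary (rho A)) (fun B => uboundary (rho' B))).
  by move=> A RA; rewrite rhoE uboundary_image.
exists rho'; split.
- apply: (markov_image (b := b) _ _ mk) => A RA //.
  by rewrite rhoE; exact: bP.
- have [E cor] := ad; split.
    rewrite sE uE -image_setU (periodic_image cj) -(homeo_imageI hh) E.
    by rewrite (conj_marked cj).
  move=> y _ + [A RA <-] [x Ax xy]; rewrite -xy (marked_image cj) => mx.
  by rewrite rhoE corners_image; exists x => //; exact: cor mx RA Ax.
- by rewrite sE sb (support_delta_s_image cj).
- by rewrite uE ub iterated_delta_u_image (support_image h).
Qed.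

End Final.

Unset Implicit Arguments.

Theorem proposition4 (R : realType) (Sf Sg : surface R)
    (f : pseudo_anosov Sf) (g : pseudo_anosov Sg)
    (h : Sf -> Sg) (hinv : Sg -> Sf)
    (h_homeo : homeomorphism h hinv)
    (h_conj : (g : Sg -> Sg) = h \o f \o hinv)
    (h_marked : fsing (stable f) = set0 -> marked g = h @` marked f)
    (z : Sf) (z_first : first_intersection f z) :
  [/\ first_intersection g (h z),
      forall n : nat, compatibility_coefficient f z n <->
                      compatibility_coefficient g (h z) n
    & forall n0 n : nat, compatibility_coefficient f z n0 -> (n0 <= n)%N ->
        [set h @` A | A in primitive_rectangles f z n] =
          primitive_rectangles g (h z) n /\
        forall RR : set (set Sf), primitive_markov_partition f z n RR ->
          primitive_markov_partition g (h z) n [set h @` A | A in RR]].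
Proof.
have comm x : g (h x) = h (f x).
  by have [_ _ hK _] := h_homeo; rewrite h_conj /= hK.
have cj := conjugacy_of_homeomorphism h_homeo comm h_marked.
split.
- exact: first_intersection_forward cj _ z_first.
- by move=> n; rewrite (compatibility_coefficient_image cj).
move=> n0 n _ _; split; first by rewrite (primitive_rectangles_image cj).
by move=> RR; exact: (primitive_markov_partition_image cj).
Qed.
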